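(* Let $\Omega$ be a Polish space and let $\mathscr{T}=(T(t))_{t\ge 0}$ be a stochastically continuous Markovian semigroup on $\mathscr{M}(\Omega)$. If $T(t_0)$ is strong Feller for some $t_0>0$, then the following are equivalent: (i) $\mathrm{fix}(\mathscr{T})$ separates $\mathrm{fix}(\mathscr{T}') := \{ f\in C_b(\Omega) : T'(t)f=f \text{ for all } t\geq 0\}$. (ii) The semigroup $\mathscr{T}$ is weakly ergodic in the sense that $\lim_{t\to\infty} A_t \mu$ exists in the $\sigma(\mathscr{M}(\Omega),C_b(\Omega))$-topology for all $\mu\in\mathscr{M}(\Omega)$. (iii) The semigroup $\mathscr{T}$ is $B_b$-ergodic. (iv) $\lim_{t\to\infty} T(t)\mu$ exists (in the total variation norm) for each $\mu\in\mathscr{M}(\Omega)$.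
   Context: $\Omega$ is a Polish space with Borel $\sigma$-algebra $\mathscr{B}(\Omega)$. $\mathscr{M}(\Omega)$ is the Banach lattice of (finite) signed measures on $\mathscr{B}(\Omega)$ with the total variation norm, $B_b(\Omega)$ the space of bounded Borel-measurable real functions and $C_b(\Omega)$ the space of bounded continuous real functions on $\Omega$; $\langle\cdot,\cdot\rangle$ denotes the duality $\langle\mu,f\rangle=\int_\Omega f\,\mathrm{d}\mu$ between $\mathscr{M}(\Omega)$ and $B_b(\Omega)$. $\mathscr{L}(\mathscr{M}(\Omega))$ denotes the bounded linear operators on $\mathscr{M}(\Omega)$. A Markovian transition kernel is a map $k:\Omega\times\mathscr{B}(\Omega)\to[0,\infty)$ such that $k(x,\cdot)$ is a probability measure for every $x\in\Omega$ and $k(\cdot,A)$ is measurable for every $A\in\mathscr{B}(\Omega)$. An operator $T\in\mathscr{L}(\mathscr{M}(\Omega))$ is Markovian if there is a Markovian transition kernel $k$ with $(T\mu)(A)=\int_\Omega k(x,A)\,\mathrm{d}\mu(x)$ for all $\mu\in\mathscr{M}(\Omega)$, $A\in\mathscr{B}(\Omega)$. In this case $T'$ denotes the restriction to $B_b(\Omega)$ of the norm adjoint $T^*$, i.e. $(T'f)(x)=\int_\Omega f(y)\,k(x,\mathrm{d}y)$; $T'(t)$ stands for $(T(t))'$. A Markovian operator $T$ is strong Feller if $T'f\in C_b(\Omega)$ for all $f\in B_b(\Omega)$. A Markovian semigroup on $\mathscr{M}(\Omega)$ is a family $(T(t))_{t\ge0}$ of Markovian operators with $T(t+s)=T(t)T(s)$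 for all $t,s\ge0$ and $T(0)=I$. It is stochastically continuous if $t\mapsto\langle T(t)\mu,f\rangle$ is continuous on $[0,\infty)$ for all $f\in C_b(\Omega)$ and $\mu\in\mathscr{M}(\Omega)$. For such a semigroup and $t>0$, $A_t\in\mathscr{L}(\mathscr{M}(\Omega))$ denotes the Markovian operator satisfying $\langle A_t\mu,f\rangle=\frac1t\int_0^t\langle T(s)\mu,f\rangle\,\mathrm{d}s$ for all $\mu\in\mathscr{M}(\Omega)$, $f\in B_b(\Omega)$. The semigroup is $B_b$-ergodic if $\lim_{t\to\infty}A_t\mu$ exists in the $\sigma(\mathscr{M}(\Omega),B_b(\Omega))$-topology for all $\mu\in\mathscr{M}(\Omega)$. $\mathrm{fix}(\mathscr{T})=\{\mu\in\mathscr{M}(\Omega): T(t)\mu=\mu\text{ for all }t\ge0\}$. That $\mathrm{fix}(\mathscr{T})$ separates $\mathrm{fix}(\mathscr{T}')$ means: for every $0\ne f\in\mathrm{fix}(\mathscr{T}')$ there is $\mu\in\mathrm{fix}(\mathscr{T})$ with $\langle\mu,f\rangle\ne0$. *)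

(* Defs.v *)
From HB Require Import structures.
From mathcomp Require Import all_boot all_order all_algebra.
From mathcomp Require Import all_classical all_reals all_analysis.

Set Implicit Arguments.
Unset Strict Implicit.
Unset Printing Implicit Defensive.

Import Order.TTheory GRing.Theory Num.Theory.
Import numFieldNormedType.Exports.

Local Open Scope classical_set_scope.
Local Open Scope ring_scope.

Definition is_metric (R : realType) (T : Type) (d : T -> T -> R) : Prop :=
  [/\ forall x y, 0 <= d x y,
      forall x y, d x y = 0 <-> x = y,
      forall x y, d x y = d y x
    & forall x y z, d x z <= d x y + d y z].

Definition metrizes (R : realType) (T : topologicalType) (d : T -> T -> R) :
    Prop :=
  forall (x : T) (A : set T),
    nbhs x A <-> exists2 e : R, 0 < e & [set y | d x y < e] `<=` A.

Definition complete_metric (R : realType) (T : topologicalType)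
    (d : T -> T -> R) : Prop :=
  forall u : nat -> T,
    (forall e : R, 0 < e ->
      exists N, forall m n, (N <= m)%N -> (N <= n)%N -> d (u m) (u n) < e) ->
    exists l : T, u @ \oo --> l.

Definition polish (R : realType) (T : topologicalType) : Prop :=
  (exists2 D : set T, countable D & dense D) /\
  (exists d : T -> T -> R, [/\ is_metric d, metrizes d & complete_metric d]).

Notation borel Omega := (g_sigma_algebraType (@open Omega)).

(* Charges are total functions on [set Omega] and are unconstrained outside
   the Borel sets.  The space of signed measures is thus the quotient of this
   type by [charge_eq] below, and equalities between signed measures are always
   stated with [charge_eq]. *)
Notation signed_measure R Omega := (charge (borel Omega) R).

Section signed_measures.
Context (R : realType) (Omega : ptopologicalType).
Local Notation M := (signed_measure R Omega).
Implicit Types (mu nu : M) (f : Omega -> R) (T : M -> M).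

Definition charge_eq mu nu : Prop :=
  forall A : set (borel Omega), measurable A -> mu A = nu A.

Lemma hahn_sig mu :
  {PN : set (borel Omega) * set (borel Omega)
      | hahn_decomposition mu PN.1 PN.2}.
Proof. by have [P /cid[N PN]] := cid (Hahn_decomposition mu); exists (P, N). Qed.

(* The positive and negative parts do not depend on the chosen Hahn
   decomposition, see [Hahn_decomposition_uniq]. *)
Definition positive_part mu : {measure set (borel Omega) -> \bar R} :=
  jordan_pos (svalP (hahn_sig mu)).

Definition negative_part mu : {measure set (borel Omega) -> \bar R} :=
  jordan_neg (svalP (hahn_sig mu)).

Definition tv_norm mu : R :=
  fine (charge_variation (svalP (hahn_sig mu)) setT).

Definition pairing mu f : R :=
  \int[positive_part mu]_x f x - \int[negative_part mu]_x f x.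

Definition Bb : set (Omega -> R) :=
  [set f | measurable_fun setT (f : borel Omega -> R) /\ bounded_fun f].

Definition Cb : set (Omega -> R) :=
  [set f | continuous f /\ bounded_fun f].

(* The first clause says that [T] is defined on the quotient by [charge_eq]. *)
Definition bounded_operator T : Prop :=
  [/\ forall mu nu, charge_eq mu nu -> charge_eq (T mu) (T nu),
      forall mu nu, charge_eq (T (cadd mu nu)) (cadd (T mu) (T nu)),
      forall (a : R) mu, charge_eq (T (cscale a mu)) (cscale a (T mu))
    & exists C : R, forall mu, tv_norm (T mu) <= C * tv_norm mu].

Local Notation kernel := (R.-pker (borel Omega) ~> (borel Omega)).

Definition has_kernel T (k : kernel) : Prop :=
  forall mu (A : set (borel Omega)), measurable A ->
    T mu A = (pairing mu (fun x => fine (k x A)))%:E.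

Definition markovian T : Prop :=
  bounded_operator T /\ exists k : kernel, has_kernel T k.

(* The kernel of a Markovian operator is unique up to its values outside the
   Borel sets; the default value is irrelevant. *)
Definition kernel_of T : kernel :=
  if pselect (exists k : kernel, has_kernel T k) is left h then sval (cid h)
  else kdirac (@measurable_id _ (borel Omega) setT).

Definition adjoint T f : Omega -> R := fun x => \int[kernel_of T x]_y f y.

Definition strong_feller T : Prop := forall f, Bb f -> Cb (adjoint T f).

Implicit Types S : R -> M -> M.

(* Only the values [S t] with [0 <= t] are meaningful. *)
Definition markovian_semigroup S : Prop :=
  [/\ forall t, 0 <= t -> markovian (S t),
      forall t s mu, 0 <= t -> 0 <= s ->
        charge_eq (S (t + s) mu) (S t (S s mu))
    & forall mu, charge_eq (S 0 mu) mu].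

Definition stochastically_continuous S : Prop :=
  forall f mu, Cb f ->
    {within `[0, +oo[, continuous (fun t : R => pairing (S t mu) f)}.

Definition is_average S (t : R) T : Prop :=
  markovian T /\
  forall mu f, Bb f ->
    pairing (T mu) f =
    t^-1 * \int[@lebesgue_measure R]_(s in `[0, t]) pairing (S s mu) f.

(* For [0 < t] and a stochastically continuous Markovian semigroup [S], there
   is a unique (up to [charge_eq]) operator satisfying [is_average S t]; the
   default value is irrelevant. *)
Definition average S (t : R) : M -> M :=
  if pselect (exists T, is_average S t T) is left h then sval (cid h) else id.

Definition fix_semigroup S : set M :=
  [set mu | forall t, 0 <= t -> charge_eq (S t mu) mu].

Definition fix_adjoint S : set (Omega -> R) :=
  [set f | Cb f /\ forall t, 0 <= t -> adjoint (S t) f = f].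

Definition fix_separates S : Prop :=
  forall f, fix_adjoint S f -> f <> cst 0 ->
    exists2 mu, fix_semigroup S mu & pairing mu f <> 0.

(* Convergence as [t --> +oo] in the topology sigma(M, F). *)
Definition sigma_cvg (F : set (Omega -> R)) (u : R -> M) nu : Prop :=
  forall f, F f -> pairing (u t) f @[t --> +oo] --> pairing nu f.

Definition tv_cvg (u : R -> M) nu : Prop :=
  tv_norm (cadd (u t) (copp nu)) @[t --> +oo] --> 0.

Definition ergodic (F : set (Omega -> R)) S : Prop :=
  forall mu, exists nu, sigma_cvg F (fun t => average S t mu) nu.

Definition weakly_ergodic S : Prop := ergodic Cb S.

Definition Bb_ergodic S : Prop := ergodic Bb S.

Definition tv_convergent S : Prop :=
  forall mu, exists nu, tv_cvg (fun t => S t mu) nu.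

End signed_measures.

(* Main.v *)
(** Only the convergence in total variation of a semigroup whose fixed space
    separates needs work. Write [P t] for the adjoint semigroup. By the strong
    Feller property all the measures [k_t0(x, .)] are dominated by one finite
    measure [m], and there is an invariant measure [pi] dominating all the
    others. Let [N] be a [pi]-null set such that [m] is dominated by [pi] off
    [N]. The functions [P (n t0) 1_N] decrease to a continuous fixed function
    annihilated by every invariant measure, hence to 0 by separation.
      The set of all [P t0 f] with [|f| <= 1] is totally bounded in [L1(pi)],
    because the kernel [k_t0] has a density with respect to [m]. A limit [F] of
    [P t f] along an ultrafilter finer than [+oo] is therefore recurrent in
    [L1(pi)]. As [P t] contracts [L2(pi)], recurrence forces
    [P t (F^2) = (P t F)^2], so that [k_t(x, .)] is carried by a level set of
    [F]. Then [s |-> P (t0 + s) 1_{F > c} x] is continuous with values in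
    [{0, 1}], hence constant, and [F] is fixed. Consequently [P t f] converges in
    [L1(pi)], and the orbits are Cauchy in [L1(pi)] uniformly in [|f| <= 1].
      Finally, for any finite measure [mu], the measure [mu k_(n t0)] is for large
    [n] absolutely continuous with respect to [pi] up to a small mass on [N],
    which makes the orbit of [mu] Cauchy in total variation. *)
Require Import Defs.
From HB Require Import structures.
From mathcomp Require Import all_boot all_order all_algebra.
From mathcomp Require Import all_classical all_reals all_analysis.
From mathcomp Require Import measurable_realfun ring lra.

Set Implicit Arguments.
Unset Strict Implicit.
Unset Printing Implicit Defensive.

Import Order.TTheory GRing.Theory Num.Theory.
Import numFieldNormedType.Exports.

Local Open Scope classical_set_scope.
Local Open Scope ring_scope.

(** * Bounded measurable functions *)

(** In discrete time the result fails: the flip of two points is strong Feller and its fixed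
    measures separate, yet its powers do not converge. Periodicity must therefore be excluded by the
    continuity of time, and the strong Feller property is what makes [P t] of an indicator
    continuous in [t], for [t >= t0]. For a general bounded Borel [f] no continuity of [P t f] in
    time is at hand, only joint measurability in time and space; the averages are built from that by
    Fubini. The ultrafilter replaces the extraction of subsequences: out of finitely many balls
    covering the orbit it selects one. It yields only one cluster point [F]; the full limit comes
    afterwards, because once [F] is fixed the distance of the orbit to [F] cannot increase. In the
    step from weak ergodicity to separation, test functions must stay continuous under [P s], which
    is ensured only for [s >= t0]; the semigroup law recovers the smaller times. Semigroup
    identities are proved on functions, through the pairing, since charges are only known up to
    [charge_eq]. *)

Section bounded_measurable.
Context d (T : measurableType d) (R : realType).
Implicit Types (f g : T -> R) (mu : {measure set T -> \bar R}).

(** On [borel Omega] this unfolds to [Bb]. Products and the time axis require the version for an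
    arbitrary measurable space. *)
Definition bmeas f : Prop := measurable_fun setT f /\ bounded_fun f.

Lemma bmeasP f : bmeas f <->
  measurable_fun setT f /\ exists M, forall x, `|f x| <= M.
Proof.
split=> -[mf]; last first.
  move=> [M fM]; split=> //; exists M; split; first exact: num_real.
  by move=> r Mr x _ /=; rewrite (le_trans (fM x))// ltW.
move=> [M [_ fM]]; split=> //; exists (M + 1) => x.
by apply: fM => //; rewrite ltrDl.
Qed.

Lemma bmeas_of f M : measurable_fun setT f -> (forall x, `|f x| <= M) ->
  bmeas f.
Proof. by move=> mf fM; apply/bmeasP; split=> //; exists M. Qed.

Lemma bmeas_cst r : bmeas (fun=> r).
Proof. by apply: (@bmeas_of _ `|r|). Qed.

Lemma bmeas_indic A : measurable A -> bmeas (\1_A : T -> R).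
Proof.
move=> mA; apply: (@bmeas_of _ 1) => // x.
by rewrite indicE; case: (_ \in _); rewrite ?normr1 ?normr0.
Qed.

Lemma bmeasD f g : bmeas f -> bmeas g -> bmeas (fun x => f x + g x).
Proof.
move=> /bmeasP[mf [M fM]] /bmeasP[mg [N gN]].
apply: (@bmeas_of _ (M + N)); first exact: measurable_funD.
by move=> x; rewrite (le_trans (ler_normD _ _))// lerD.
Qed.

Lemma bmeasM f g : bmeas f -> bmeas g -> bmeas (fun x => f x * g x).
Proof.
move=> /bmeasP[mf [M fM]] /bmeasP[mg [N gN]].
apply: (@bmeas_of _ (M * N)); first exact: measurable_funM.
by move=> x; rewrite normrM ler_pM.
Qed.

Lemma bmeasZ r f : bmeas f -> bmeas (fun x => r * f x).
Proof. by apply: bmeasM; exact: bmeas_cst. Qed.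

Lemma bmeasN f : bmeas f -> bmeas (fun x => - f x).
Proof. by move=> /(bmeasZ (-1)); under eq_fun do rewrite mulN1r. Qed.

Lemma bmeasB f g : bmeas f -> bmeas g -> bmeas (fun x => f x - g x).
Proof. by move=> bf bg; apply: bmeasD => //; exact: bmeasN. Qed.

Lemma bmeas_abs f : bmeas f -> bmeas (fun x => `|f x|).
Proof.
move=> /bmeasP[mf [M fM]]; apply: (@bmeas_of _ M).
  exact: measurableT_comp.
by move=> x; rewrite normr_id.
Qed.

Lemma bmeas_integrable mu f : (mu setT < +oo)%E -> bmeas f ->
  mu.-integrable setT (EFin \o f).
Proof. by move=> fmu [mf bf]; exact: measurable_bounded_integrable. Qed.

Lemma bmeas_lim (f_ : nat -> T -> R) f (M : R) :
  (forall n, bmeas (f_ n)) -> (forall n x, `|f_ n x| <= M) ->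
  (forall x, f_ ^~ x @ \oo --> f x) -> bmeas f.
Proof.
move=> bf fM ff; apply: (@bmeas_of _ M).
  by apply: (measurable_fun_cvg (h := f_)) => [n|x _]; [case: (bf n)|exact: ff].
move=> x; have : (fun n => `|f_ n x|) @ \oo --> `|f x| by exact: cvg_norm.
move=> h; rewrite -(cvg_lim _ h)//; apply: limr_le.
  by apply/cvg_ex; eexists; exact: h.
by apply: nearW => n; exact: fM.
Qed.

Lemma bounded_cvg_Rintegral mu (f_ : nat -> T -> R) f (M : R) :
  (mu setT < +oo)%E ->
  (forall n, bmeas (f_ n)) -> (forall n x, `|f_ n x| <= M) ->
  (forall x, f_ ^~ x @ \oo --> f x) ->
  (fun n => \int[mu]_x f_ n x) @ \oo --> \int[mu]_x f x.
Proof.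
move=> fmu bf fM ff; have bF := bmeas_lim bf fM ff.
have [] := @dominated_convergence _ T R mu setT measurableT
  (fun n => EFin \o f_ n) (EFin \o f) (cst M%:E).
- by move=> n; apply/measurable_EFinP; case: (bf n).
- by apply/measurable_EFinP; case: bF.
- by apply: aeW => x _; apply/fine_cvgP; split; [exact: nearW|exact: ff].
- exact: (bmeas_integrable fmu (bmeas_cst M)).
- by apply: aeW => x n _; rewrite /= lee_fin.
have -> : (\int[mu]_x (EFin \o f) x)%E = (\int[mu]_x f x)%:E.
  rewrite /Rintegral fineK//.
  exact: integrable_fin_num (bmeas_integrable fmu bF).
move=> _ _ /fine_cvg; apply: cvg_trans; apply: near_eq_cvg.
by apply: nearW => n.
Qed.

Section integral.
Variable mu : {measure set T -> \bar R}.
Hypothesis fmu : (mu setT < +oo)%E.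

Lemma bintD f g : bmeas f -> bmeas g ->
  \int[mu]_x (f x + g x) = \int[mu]_x f x + \int[mu]_x g x.
Proof. by move=> bf bg; rewrite RintegralD//; exact: bmeas_integrable. Qed.

Lemma bintB f g : bmeas f -> bmeas g ->
  \int[mu]_x (f x - g x) = \int[mu]_x f x - \int[mu]_x g x.
Proof. by move=> bf bg; rewrite RintegralB//; exact: bmeas_integrable. Qed.

Lemma bintZ r f : bmeas f -> \int[mu]_x (r * f x) = r * \int[mu]_x f x.
Proof. by move=> bf; rewrite RintegralZl//; exact: bmeas_integrable. Qed.

Lemma le_bint f g : bmeas f -> bmeas g -> (forall x, f x <= g x) ->
  \int[mu]_x f x <= \int[mu]_x g x.
Proof. by move=> bf bg fg; apply: le_Rintegral => //; exact: bmeas_integrable. Qed.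

Lemma le_norm_bint f : bmeas f -> `|\int[mu]_x f x| <= \int[mu]_x `|f x|.
Proof. by move=> bf; apply: le_normr_Rintegral => //; exact: bmeas_integrable. Qed.

Lemma bint_cst r : \int[mu]_x r = r * fine (mu setT).
Proof. by rewrite Rintegral_cst. Qed.

Lemma bint_indic A : measurable A -> \int[mu]_x \1_A x = fine (mu A).
Proof. by move=> mA; rewrite /Rintegral integral_indic// setIT. Qed.

Lemma bint_bound f M : bmeas f -> (forall x, `|f x| <= M) ->
  `|\int[mu]_x f x| <= M * fine (mu setT).
Proof.
move=> bf fM; apply: (le_trans (le_norm_bint bf)).
by rewrite -bint_cst; apply: le_bint => //; [exact: bmeas_abs|exact: bmeas_cst].
Qed.

Lemma EFin_bint f : bmeas f ->
  (\int[mu]_x f x)%:E = (\int[mu]_x (f x)%:E)%E.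
Proof.
move=> bf; rewrite /Rintegral fineK//.
exact: integrable_fin_num (bmeas_integrable fmu bf).
Qed.

Lemma fin_measure A : measurable A -> mu A \is a fin_num.
Proof.
move=> mA; rewrite ge0_fin_numE//; apply: le_lt_trans fmu.
by apply: le_measure; rewrite ?inE.
Qed.

Lemma bint_eq0 f : bmeas f -> (forall x, 0 <= f x) -> \int[mu]_x f x = 0 ->
  {ae mu, forall x, f x = 0}.
Proof.
move=> bf f0 If.
have : (\int[mu]_x `|(f x)%:E| = 0)%E.
  under eq_integral do rewrite gee0_abs ?lee_fin//.
  by rewrite -EFin_bint// If.
move=> /ae_eq_integral_abs-/(_ measurableT).
have mf : measurable_fun setT (fun x => (f x)%:E).
  by apply/measurable_EFinP; case: bf.
move=> /(_ mf) H.
apply: filterS H => x /(_ I) /= []; by move=> ->.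
Qed.

Lemma ae_eq_bint f g : bmeas f -> bmeas g -> {ae mu, forall x, f x = g x} ->
  \int[mu]_x f x = \int[mu]_x g x.
Proof.
move=> [mf _] [mg _] fg; congr fine; apply: ae_eq_integral => //.
- exact/measurable_EFinP.
- exact/measurable_EFinP.
- by apply: filterS fg => x -> _.
Qed.

End integral.

(** * A functional monotone class theorem *)

Section induction.
Variables (G : set (set T)) (Q : (T -> R) -> Prop).
Hypothesis GE : @measurable _ T = <<s G >>.
Hypothesis GI : setI_closed G.
Hypothesis Q1 : Q (fun=> 1).
Hypothesis QG : forall A, G A -> Q (\1_A).
Hypothesis Qlin : forall a f g, bmeas f -> bmeas g -> Q f -> Q g ->
  Q (fun x => a * f x + g x).
Hypothesis Qlim : forall (f_ : nat -> T -> R) f (M : R), (forall n, bmeas (f_ n)) ->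
  (forall n, Q (f_ n)) -> (forall n x, `|f_ n x| <= M) ->
  (forall x, f_ ^~ x @ \oo --> f x) -> Q f.

Let Q0 : Q (fun=> 0).
Proof.
have := Qlin (-1) (bmeas_cst 1) (bmeas_cst 1) Q1 Q1.
by under eq_fun do rewrite mulr1 addNr.
Qed.

Let Qadd f g : bmeas f -> bmeas g -> Q f -> Q g -> Q (fun x => f x + g x).
Proof.
move=> bf bg Qf Qg; have := Qlin (1) bf bg Qf Qg.
by under eq_fun do rewrite mul1r.
Qed.

Let Qscale r f : bmeas f -> Q f -> Q (fun x => r * f x).
Proof.
move=> bf Qf; have := Qlin (r) bf (bmeas_cst 0) Qf Q0.
by under eq_fun do rewrite addr0.
Qed.

Let Qind A : measurable A -> Q (\1_A).
Proof.
move=> mA; have : <<s G >> A by rewrite -GE.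
clear mA; move: A; apply: (dynkin_induction (P := fun A => Q (\1_A)) GE GI).
- by rewrite indicT.
- by move=> B /QG.
- move=> B mB QB.
  have := Qlin (-1) (bmeas_indic mB) (bmeas_cst 1) QB Q1.
  congr Q; apply/funext => x; rewrite !indicE in_setC.
  by case: (x \in B) => /=; lra.
- move=> F mF tF QF.
  have mU n : measurable (\big[setU/set0]_(i < n) F i).
    exact: bigsetU_measurable.
  apply: (Qlim (f_ := fun n => \1_(\big[setU/set0]_(i < n) F i)) (M := 1)).
  + by move=> n; exact: bmeas_indic.
  + elim=> [|n IH].
      rewrite big_ord0; move: Q0; congr Q; apply/funext => x.
      by rewrite indicE in_set0.
    move: (Qadd (bmeas_indic (mU n)) (bmeas_indic (mF n)) IH (QF n)).
    congr Q; apply/funext => x; rewrite big_ord_recr/= !indicE in_setU.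
    have [xU|] := boolP (x \in \big[setU/set0]_(i < n) F i); last first.
      by rewrite add0r.
    have [xF|] := boolP (x \in F n); last by rewrite addr0.
    move: xU xF; rewrite !inE -bigcup_mkord => -[k /= kn Fkx] Fnx.
    have kE : k = n by apply: tF => //; exists x.
    by move: kn; rewrite kE ltnn.
  + by move=> n x; rewrite indicE; case: (_ \in _); rewrite ?normr1 ?normr0.
  + move=> x; have [[k _ Fkx]|nx] := pselect ((\bigcup_k F k) x).
      rewrite [X in _ --> X](_ : _ = 1); last first.
        by rewrite indicE mem_set//; exists k.
      apply: cvg_near_cst; exists k.+1 => // n /= kn.
      by rewrite indicE mem_set// -bigcup_mkord; exists k.
    rewrite [X in _ --> X](_ : _ = 0); last by rewrite indicE memNset.
    apply: cvg_near_cst; apply: nearW => n.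
    rewrite indicE memNset// -bigcup_mkord => -[k /= _ Fkx].
    by apply: nx; exists k.
Qed.

Import HBSimple HBNNSimple.

Let Qsfun (h : {sfun T >-> R}) : Q (fun x => h x).
Proof.
rewrite (_ : (fun x => h x) = fun x =>
  \sum_(y \in range h) (y * \1_(h @^-1` [set y]) x)); last first.
  by apply/funext => x; rewrite fimfunE.
have fin : finite_set (range h) by [].
under eq_fun do rewrite fsbig_finite//=.
suff H (s : seq R) : bmeas (fun x => \sum_(i <- s) i * \1_(h @^-1` [set i]) x)
    /\ Q (fun x => \sum_(i <- s) i * \1_(h @^-1` [set i]) x).
  exact: (H _).2.
elim: s => [|y s [IHb IHQ]].
  under eq_fun do rewrite big_nil; split; [exact: bmeas_cst|exact: Q0].
under eq_fun do rewrite big_cons.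
have bi : bmeas (\1_(h @^-1` [set y]) : T -> R) by exact: bmeas_indic.
split; first by apply: bmeasD => //; exact: bmeasZ.
by apply: Qlin => //; apply: Qind.
Qed.

(** The sets with indicator in [Q] form a Dynkin system, hence contain all measurable sets;
    linearity gives simple functions. The shift by [M] makes [f] nonnegative, so that it is an
    increasing limit of simple functions, all bounded by [M + M]. *)
Lemma bmeas_ind f : bmeas f -> Q f.
Proof.
move=> bf; have /bmeasP[mf [M fM]] := bf.
pose g x := f x + M.
have g0 x : 0 <= g x by rewrite -lerBlDr sub0r; have := fM x; rewrite ler_norml => /andP[].
have mg : measurable_fun setT (EFin \o g).
  by apply/measurable_EFinP; exact: measurable_funD.
pose h := nnsfun_approx measurableT mg.
have hle n x : h n x <= g x.
  rewrite -lee_fin nnsfun_approxE; apply: le_approx => // y _.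
  by rewrite lee_fin.
have hg x : h ^~ x @ \oo --> g x.
  have g0' y : (0 <= (EFin \o g) y)%E by rewrite lee_fin.
  have /fine_cvg := @cvg_nnsfun_approx _ T R setT measurableT _ mg
    (fun y _ => g0' y) x Logic.I.
  by apply: cvg_trans; apply: near_eq_cvg; exact: nearW.
have Qg : Q g.
  apply: (Qlim (f_ := fun n => h n) (M := M + M)) => //.
  - move=> n; apply: (@bmeas_of _ (M + M)) => // x.
    rewrite ger0_norm// (le_trans (hle n x))// lerD2r.
    by rewrite (le_trans (ler_norm _)).

  - move=> n x; rewrite ger0_norm// (le_trans (hle n x))// lerD2r.
    by rewrite (le_trans (ler_norm _)).
have bg : bmeas g by apply: bmeasD => //; exact: bmeas_cst.
have := Qadd bg (bmeas_cst (- M)) Qg.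
have QM : Q (fun=> - M).
  by have := Qscale (- M) (bmeas_cst 1) Q1; under eq_fun do rewrite mulr1.
by move=> /(_ QM); under eq_fun do rewrite /g addrK.
Qed.

End induction.

Lemma bmeas_indm (Q : (T -> R) -> Prop) :
  (forall A, measurable A -> Q (\1_A)) ->
  (forall a f g, bmeas f -> bmeas g -> Q f -> Q g ->
    Q (fun x => a * f x + g x)) ->
  (forall (f_ : nat -> T -> R) f (M : R), (forall n, bmeas (f_ n)) ->
    (forall n, Q (f_ n)) -> (forall n x, `|f_ n x| <= M) ->
    (forall x, f_ ^~ x @ \oo --> f x) -> Q f) ->
  forall f, bmeas f -> Q f.
Proof.
move=> Qi Ql Qlim f; apply: (@bmeas_ind measurable Q) => //.
- exact/esym/sigma_algebra_id/sigma_algebra_measurable.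
- by move=> A B; exact: measurableI.
- by have := Qi _ measurableT; rewrite indicT.
Qed.

End bounded_measurable.

(** * Finite kernels *)

Section finite_measure_alias.
Context d (T : measurableType d) (R : realType) (mu : {measure set T -> \bar R}).
Hypothesis fmu : (mu setT < +oo)%E.

(* The vacuous [let] makes [fmu] an argument of the alias, so that the instance
   below can refer to it. *)
Definition finite_alias : set T -> \bar R := let _ := fmu in mu.

HB.instance Definition _ := Measure.on finite_alias.

Let finite_alias_fin : fin_num_fun finite_alias.
Proof. by move=> A mA; exact: fin_measure. Qed.

HB.instance Definition _ :=
  Measure_isFinite.Build d T R finite_alias finite_alias_fin.

Definition to_finite : {finite_measure set T -> \bar R} := finite_alias.

End finite_measure_alias.

Section kernel_operator.
Context d d' (X : measurableType d) (Y : measurableType d') (R : realType).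

(** For [kernel_of T] this unfolds to [adjoint T]. *)
Definition kop (k : X -> {measure set Y -> \bar R}) (f : Y -> R) (x : X) : R :=
  \int[k x]_y f y.

Section fker.
Variable k : R.-fker X ~> Y.

Lemma fker_fin x : (k x setT < +oo)%E.
Proof. by have [r kr] := measure_uub k; rewrite (lt_le_trans (kr x))// leey. Qed.

Lemma fker_bound : exists2 r : R, 0 <= r & forall x, fine (k x setT) <= r.
Proof.
have [r kr] := measure_uub k; exists `|r| => // x.
rewrite -lee_fin fineK; last exact: (fin_measure (fker_fin x)).
by rewrite (le_trans (ltW (kr x)))// lee_fin ler_norm.
Qed.

Let kf_bounded f : bmeas f -> exists M, forall x, `|kop k f x| <= M.
Proof.
move=> bf; have /bmeasP[_ [M fM]] := bf; have [r r0 kr] := fker_bound.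
exists (`|M| * r) => x.
have fM' y : `|f y| <= `|M| by rewrite (le_trans (fM y))// ler_norm.
rewrite (le_trans (bint_bound (fker_fin x) bf fM'))//.
by rewrite ler_wpM2l.
Qed.

Lemma kopD f g x : bmeas f -> bmeas g ->
  kop k (fun y => f y + g y) x = kop k f x + kop k g x.
Proof. by move=> bf bg; apply: bintD => //; exact: fker_fin. Qed.

Lemma kopB f g x : bmeas f -> bmeas g ->
  kop k (fun y => f y - g y) x = kop k f x - kop k g x.
Proof. by move=> bf bg; apply: bintB => //; exact: fker_fin. Qed.

Lemma kopZ r f x : bmeas f ->
  kop k (fun y => r * f y) x = r * kop k f x.
Proof. by move=> bf; apply: bintZ => //; exact: fker_fin. Qed.

Lemma kop_le f g x : bmeas f -> bmeas g -> (forall y, f y <= g y) ->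
  kop k f x <= kop k g x.
Proof. by move=> bf bg fg; apply: le_bint => //; exact: fker_fin. Qed.

Lemma kop_norm_le f x : bmeas f ->
  `|kop k f x| <= kop k (fun y => `|f y|) x.
Proof. by move=> bf; apply: le_norm_bint => //; exact: fker_fin. Qed.

Lemma kop_indic A x : measurable A -> kop k (\1_A) x = fine (k x A).
Proof. by move=> mA; rewrite /kop bint_indic. Qed.

Lemma kop_lim (f_ : nat -> Y -> R) f (M : R) x :
  (forall n, bmeas (f_ n)) -> (forall n y, `|f_ n y| <= M) ->
  (forall y, f_ ^~ y @ \oo --> f y) ->
  (fun n => kop k (f_ n) x) @ \oo --> kop k f x.
Proof. by move=> bf fM ff; apply: bounded_cvg_Rintegral bf fM ff; exact: fker_fin. Qed.

Lemma kop_bmeas f : bmeas f -> bmeas (kop k f).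
Proof.
move=> bf; have [M fM] := kf_bounded bf; apply: bmeas_of fM.
apply: (bmeas_indm (Q := fun f => measurable_fun setT (kop k f))) bf.
- move=> A mA; have -> : kop k (\1_A) = fun x => fine (k x A).
    by apply/funext => x; rewrite kop_indic.
  by apply: measurableT_comp => //; exact: measurable_kernel.
- move=> a g h bg bh mg mh.
  have -> : kop k (fun x => a * g x + h x) = fun x => a * kop k g x + kop k h x.
    by apply/funext => x; rewrite kopD ?kopZ//; exact: bmeasZ.
  by apply: measurable_funD => //; exact: measurable_funM.
- move=> g_ g N bg mg gN gg.
  apply: (measurable_fun_cvg (h := fun n => kop k (g_ n))) => // x _.
  exact: kop_lim gN gg.
Qed.

End fker.

Section pker.
Variable k : R.-pker X ~> Y.

Lemma pkerT x : k x setT = 1%E. Proof. exact: prob_kernel. Qed.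

Lemma kop_cst r x : kop k (fun=> r) x = r.
Proof. by rewrite /kop bint_cst pkerT mulr1. Qed.

Lemma kop_bound f M x : bmeas f -> (forall y, `|f y| <= M) -> `|kop k f x| <= M.
Proof.
move=> bf fM; have := bint_bound (fker_fin k x) bf fM.
by rewrite pkerT mulr1.
Qed.

End pker.

(** * Composition of a measure with a kernel *)

Section joint.
Variables (mu : {measure set X -> \bar R}) (k : R.-fker X ~> Y).

(** The measure mu(dx) k(x, dy) on the product; a constant kernel gives the product measure. *)
Definition kjoint (A : set (X * Y)) : \bar R := (\int[mu]_x k x (xsection A x))%E.

Let kjoint0 : kjoint set0 = 0%E.
Proof. by rewrite /kjoint integral0_eq// => x _; rewrite xsection0 measure0. Qed.

Let kjoint_ge0 A : (0 <= kjoint A)%E.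
Proof. by apply: integral_ge0. Qed.

Let kjoint_sigma_additive : semi_sigma_additive kjoint.
Proof.
move=> F mF tF mUF.
rewrite [X in _ --> X](_ : _ = (\sum_(0 <= n <oo) kjoint (F n))%E).
  apply/cvg_ex; exists (\sum_(0 <= n <oo) kjoint (F n))%E => /=.
  by apply: is_cvg_nneseries => n _ _; exact: kjoint_ge0.
rewrite /kjoint -integral_nneseries//.
  apply: eq_integral => x _; rewrite -measure_semi_bigcup//.
  - by rewrite xsection_bigcup.
  - by move=> n; exact: measurable_xsection.
  - exact: trivIset_xsection.
  - by rewrite -xsection_bigcup; exact: measurable_xsection.
by move=> n; apply: measurable_fun_xsection_finite_kernel; rewrite inE.
Qed.

HB.instance Definition _ := isMeasure.Build _ _ _ kjoint
  kjoint0 kjoint_ge0 kjoint_sigma_additive.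

Hypothesis fmu : (mu setT < +oo)%E.

Lemma kjoint_fin : (kjoint setT < +oo)%E.
Proof.
have [r r0 kr] := fker_bound k.
apply: (@le_lt_trans _ _ (\int[mu]_x r%:E)%E).
  apply: ge0_le_integral => //.
  - by apply: measurable_fun_xsection_finite_kernel; rewrite inE.
  - move=> x _; rewrite -[leLHS]fineK; last first.
      apply: (fin_measure (fker_fin k x)); exact: measurable_xsection.
    rewrite lee_fin; apply: le_trans (kr x).
    apply: fine_le; rewrite ?(fin_measure (fker_fin k x))//.
      exact: measurable_xsection.
    by apply: le_measure; rewrite ?inE//; exact: measurable_xsection.
rewrite integral_cst//.
by rewrite -(fineK (fin_measure fmu measurableT)) -EFinM ltry.
Qed.

Lemma bmeas_section (f : X * Y -> R) x : bmeas f -> bmeas (fun y => f (x, y)).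
Proof.
move=> /bmeasP[mf [M fM]]; apply: (@bmeas_of _ _ _ _ M) => //.
exact: measurableT_comp.
Qed.

(** Measurability of the inner integral and the disintegration formula go through the monotone class
    induction together, because the inductive steps for the formula use the measurability. *)
Lemma kjoint_Rintegral (f : X * Y -> R) : bmeas f ->
  bmeas (fun x => kop k (fun y => f (x, y)) x) /\
  \int[kjoint]_z f z = \int[mu]_x kop k (fun y => f (x, y)) x.
Proof.
pose Q (f : X * Y -> R) := bmeas (fun x => kop k (fun y => f (x, y)) x) /\
  \int[kjoint]_z f z = \int[mu]_x kop k (fun y => f (x, y)) x.
have Qind A : measurable A -> Q (\1_A).
  move=> mA.
  have E x : kop k (fun y => \1_A (x, y)) x = fine (k x (xsection A x)).
    rewrite -bint_indic /kop; last exact: measurable_xsection.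
    by congr fine; apply: eq_integral => y _; rewrite !indicE mem_xsection.
  have bk : bmeas (fun x => kop k (fun y => \1_A (x, y)) x).
    have [r r0 kr] := fker_bound k.
    apply: (@bmeas_of _ _ _ _ r).
      under eq_fun do rewrite E.
      apply: measurableT_comp => //.
      by apply: measurable_fun_xsection_finite_kernel; rewrite inE.
    move=> x; rewrite E ger0_norm ?fine_ge0//; apply: le_trans (kr x).
    apply: fine_le; rewrite ?(fin_measure (fker_fin k x))//.
      exact: measurable_xsection.
    by apply: le_measure; rewrite ?inE//; exact: measurable_xsection.
  split=> //; rewrite bint_indic//; congr fine; apply: eq_integral => x _.
  by rewrite E fineK//; apply: (fin_measure (fker_fin k x)); exact: measurable_xsection.
apply: (bmeas_indm (Q := Q) Qind).
- move=> a g h bg bh [bg' Ig] [bh' Ih].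
  have E x : kop k (fun y => a * g (x, y) + h (x, y)) x =
      a * kop k (fun y => g (x, y)) x + kop k (fun y => h (x, y)) x.
    rewrite kopD ?kopZ//; try exact: bmeas_section.
    by apply: bmeasZ; exact: bmeas_section.
  rewrite /Q; under eq_fun do rewrite E; split.
    by apply: bmeasD => //; exact: bmeasZ.
  rewrite bintD//; [|exact: kjoint_fin|exact: bmeasZ].
  rewrite bintZ//; last exact: kjoint_fin.
  by rewrite Ig Ih -bintZ// -bintD//; exact: bmeasZ.
- move=> g_ g N bg Qg gN gg.
  have cg x : (fun n => kop k (fun y => g_ n (x, y)) x) @ \oo -->
      kop k (fun y => g (x, y)) x.
    by apply: kop_lim => // n; exact: bmeas_section.
  have [r r0 kr] := fker_bound k.
  have N'0 : forall n x, `|kop k (fun y => g_ n (x, y)) x| <= `|N| * r.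
    move=> n x; have gN' y : `|g_ n (x, y)| <= `|N|.
      by rewrite (le_trans (gN _ _))// ler_norm.
    rewrite (le_trans (bint_bound (fker_fin k x) (bmeas_section _ (bg n)) gN'))//.
    by rewrite ler_wpM2l.
  split; first by apply: bmeas_lim N'0 cg => n; case: (Qg n).
  have := bounded_cvg_Rintegral fmu (fun n => (Qg n).1) N'0 cg.
  have := bounded_cvg_Rintegral kjoint_fin bg gN gg.
  under eq_fun do rewrite (Qg _).2.
  move=> h1 h2; rewrite -(cvg_lim _ h1)// -(cvg_lim _ h2)//.
Qed.

(** The measure mu k on [Y], that is, the second marginal of [kjoint]. *)
Definition kbind (A : set Y) : \bar R := (\int[mu]_x k x A)%E.

End joint.

Section bind.
Variables (mu : {measure set X -> \bar R}) (k : R.-fker X ~> Y).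

Let kbind0 : kbind mu k set0 = 0%E.
Proof. by rewrite /kbind integral0_eq// => x _; rewrite measure0. Qed.

Let kbind_ge0 A : (0 <= kbind mu k A)%E.
Proof. by apply: integral_ge0. Qed.

Let kbind_sigma_additive : semi_sigma_additive (kbind mu k).
Proof.
move=> F mF tF mUF.
rewrite [X in _ --> X](_ : _ = (\sum_(0 <= n <oo) kbind mu k (F n))%E).
  apply/cvg_ex; exists (\sum_(0 <= n <oo) kbind mu k (F n))%E => /=.
  by apply: is_cvg_nneseries => n _ _; exact: kbind_ge0.
rewrite /kbind -integral_nneseries//.
  by apply: eq_integral => x _; rewrite -measure_semi_bigcup.
by move=> n; exact: measurable_kernel.
Qed.

HB.instance Definition _ := isMeasure.Build _ _ _ (kbind mu k)
  kbind0 kbind_ge0 kbind_sigma_additive.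

Hypothesis fmu : (mu setT < +oo)%E.

Lemma kbind_fin : (kbind mu k setT < +oo)%E.
Proof.
rewrite [ltLHS](_ : _ = kjoint mu k setT); first exact: kjoint_fin.
apply: eq_integral => x _; congr (k x _).
by apply/seteqP; split=> // y _; rewrite /xsection/= inE.
Qed.

Lemma kbind_Rintegral f : bmeas f ->
  \int[kbind mu k]_y f y = \int[mu]_x kop k f x.
Proof.
pose Q (f : Y -> R) := \int[kbind mu k]_y f y = \int[mu]_x kop k f x.
have Qind A : measurable A -> Q (\1_A).
  move=> mA; rewrite /Q bint_indic//; congr fine; apply: eq_integral => x _.
  by rewrite kop_indic// fineK//; exact: (fin_measure (fker_fin k x)).
apply: (bmeas_indm (Q := Q) Qind).
- move=> a g h bg bh Qg Qh; have bkg := kop_bmeas k bg.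
  rewrite /Q (bintD kbind_fin (bmeasZ a bg) bh) (bintZ kbind_fin a bg) Qg Qh.
  rewrite -(bintZ fmu a bkg) -(bintD fmu (bmeasZ a bkg) (kop_bmeas k bh)).
  by apply: eq_Rintegral => x _; rewrite (kopD _ _ (bmeasZ a bg) bh) (kopZ _ _ _ bg).
- move=> g_ g N bg Qg gN gg.
  have [r r0 kr] := fker_bound k.
  have N'0 n x : `|kop k (g_ n) x| <= `|N| * r.
    have gN' y : `|g_ n y| <= `|N| by rewrite (le_trans (gN _ _))// ler_norm.
    rewrite (le_trans (bint_bound (fker_fin k x) (bg n) gN'))//.
    by rewrite ler_wpM2l.
  have := bounded_cvg_Rintegral fmu (fun n => kop_bmeas k (bg n)) N'0
    (fun x => kop_lim bg gN gg).
  have := bounded_cvg_Rintegral kbind_fin bg gN gg.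
  under eq_fun do rewrite Qg.
  by move=> h1 h2; rewrite /Q -(cvg_lim _ h1)// -(cvg_lim _ h2).
Qed.

End bind.

End kernel_operator.

(** * Bounded Borel functions on a metric space *)

Section polish_space.
Context (R : realType) (Omega : ptopologicalType).
Implicit Types (f : Omega -> R) (U : set Omega).

Lemma continuous_bmeas f : Cb f -> bmeas (f : borel Omega -> R).
Proof.
move=> [cf bf]; split=> //.
apply: (measurability _ (RGenOpens.measurableE R)) => _ [_ [a [b ->] <-]].
rewrite setTI; apply: sub_sigma_algebra.
by apply: open_comp; [move=> x _; exact: cf|exact: interval_open].
Qed.

Variable d : Omega -> Omega -> R.
Hypothesis md : is_metric d.
Hypothesis metr : metrizes d.

Let d_ge0 x y : 0 <= d x y. Proof. by case: md. Qed.
Let dxx x : d x x = 0. Proof. by case: md => _ h _ _; apply/h. Qed.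
Let dC x y : d x y = d y x. Proof. by case: md. Qed.
Let dtri y x z : d x z <= d x y + d y z. Proof. by case: md. Qed.

Lemma metrizes_cvg f x :
  (forall e, 0 < e -> exists2 r, 0 < r & forall y, d x y < r -> `|f x - f y| < e) ->
  {for x, continuous f}.
Proof.
move=> h; apply/cvgrPdist_lt => e e0; have [r r0 hr] := h e e0.
by apply/metr; exists r.
Qed.

Lemma open_dist_ball x r : 0 < r -> open [set y | d x y < r].
Proof.
move=> r0; rewrite openE => y /= yr; apply/metr; exists (r - d x y).
  by rewrite subr_gt0.
by move=> z /= yz; rewrite (le_lt_trans (dtri y x z))// -ltrBrDl.
Qed.

(** The functions min(1, n dist(x, ~U)) are Lipschitz, and the distance to the complement is
    positive exactly on the open set [U]. *)
Lemma open_indic_approx U : open U -> exists f_ : nat -> Omega -> R,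
  [/\ forall n, Cb (f_ n), forall n x, `|f_ n x| <= 1 &
      forall x, f_ ^~ x @ \oo --> (\1_U x : R)].
Proof.
move=> oU; have [UT|/existsNP[z0 nUz0]] := pselect (forall x, U x).
  exists (fun _ _ => 1); split=> [_|_ x|x].
  - split; first by move=> x; exact: cvg_cst.
    by apply/ (bmeas_cst (borel Omega) (1 : R)).2.
  - by rewrite normr1.
  - by rewrite indicE mem_set//; exact: cvg_cst.
(* The point [z0] outside [U] makes the sets [D x] nonempty, so that the infimum is a genuine
   distance; this is why the whole space was treated apart. *)
pose D x := [set d x y | y in ~` U].
have Dn0 x : D x !=set0 by exists (d x z0), z0.
have Dlb x : has_lbound (D x) by exists 0 => _ [y _ <-].
pose dist x := inf (D x).
have dist_ge0 x : 0 <= dist x by apply: lb_le_inf => // _ [y _ <-].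
have dist_lip x y : dist x <= d x y + dist y.
  rewrite -lerBlDl; apply: lb_le_inf => // _ [z nUz <-].
  rewrite lerBlDl (le_trans _ (dtri y x z))//.
  by apply: ge_inf => //; exists z.
have dist0 x : ~ U x -> dist x = 0.
  move=> nUx; apply/eqP; rewrite eq_le dist_ge0 andbT.
  by rewrite -(dxx x); apply: ge_inf => //; exists x.
have dist_gt0 x : U x -> 0 < dist x.
  move=> Ux; have /metr[e e0 eU] : nbhs x U by apply: open_nbhs_nbhs.
  apply: (lt_le_trans e0); apply: lb_le_inf => // _ [y nUy <-].
  by rewrite leNgt; apply/negP => /eU.
exists (fun n x => Num.min 1 (n%:R * dist x)).
have le1 n x : `|Num.min 1 (n%:R * dist x)| <= 1.
  rewrite ger0_norm; first by rewrite ge_min lexx.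
  by rewrite le_min ler01 mulr_ge0.
split=> // [n|x].
- split; last by exists 1; split=> // M M1 x _ /=; rewrite (le_trans (le1 n x))// ltW.
  (* The Lipschitz constant is [n], possibly 0, hence the division by [n.+1]. *)
  move=> x; apply: metrizes_cvg => e e0; exists (e / n.+1%:R).
    by rewrite divr_gt0.
  move=> y; rewrite ltr_pdivlMr// => xye.
  have H u v : Num.min 1 (n%:R * dist u) <= Num.min 1 (n%:R * dist v) + n%:R * d u v.
    rewrite -lerBlDr le_min; apply/andP; split.
      rewrite lerBlDr (@le_trans _ _ 1) ?ge_min ?lexx//.
      by rewrite lerDl mulr_ge0.
    rewrite lerBlDr ge_min; apply/orP; right.
    by rewrite addrC -mulrDr ler_wpM2l.
  have : n%:R * d x y < e.
    rewrite (le_lt_trans _ xye)// mulrC ler_wpM2l// ler_nat//.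
  have := H x y; have := H y x; rewrite (dC y x) => h1 h2 h3.
  by rewrite ltr_norml; apply/andP; split; lra.
- have [Ux|nUx] := pselect (U x); last first.
    rewrite indicE memNset//; apply: cvg_near_cst; apply: nearW => n.
    by rewrite dist0// mulr0 min_r// ler01.
  rewrite indicE mem_set//=; apply: cvg_near_cst; near=> n.
  apply/min_l; rewrite -ler_pdivrMr ?dist_gt0// div1r.
  near: n; exact: nbhs_infty_ger.
Unshelve. all: by end_near. Qed.

(** Open sets are stable under intersection and generate the Borel sets, and their indicators are
    bounded limits of continuous functions. *)
Lemma Bb_ind (Q : (Omega -> R) -> Prop) :
  (forall f, Cb f -> Q f) ->
  (forall a f g, Bb f -> Bb g -> Q f -> Q g -> Q (fun x => a * f x + g x)) ->
  (forall (f_ : nat -> Omega -> R) f (M : R), (forall n, Bb (f_ n)) ->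
    (forall n, Q (f_ n)) -> (forall n x, `|f_ n x| <= M) ->
    (forall x, f_ ^~ x @ \oo --> f x) -> Q f) ->
  forall f, Bb f -> Q f.
Proof.
move=> Qc Ql Qlim f.
apply: (@bmeas_ind _ (borel Omega) R (@open Omega) Q) => //.
- by move=> A B; exact: openI.
- apply: Qc; split; first by move=> x; exact: cvg_cst.
  exact: (bmeas_cst (borel Omega) (1 : R)).2.
- move=> A /open_indic_approx[f_ [cf f1 ff]].
  apply: (Qlim f_ _ 1) => // n; last exact: Qc.
  exact: continuous_bmeas.
Qed.

(** The base consists of the balls of radius [n.+1%:R^-1] around the points of [D]. It is presented
    as a sequence so that it can index a series of measures. *)
Lemma dense_countable_base (D : set Omega) : countable D -> dense D ->
  exists B : nat -> set Omega, (forall n, open (B n)) /\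
    forall (W : set Omega) x, open W -> W x -> exists n, B n x /\ B n `<=` W.
Proof.
move=> cD dD.
pose F (p : nat * Omega) : set Omega := [set y | d p.2 y < p.1.+1%:R^-1].
pose S : set (set Omega) := F @` (setT `*` D).
have cS : countable S.
  apply: (@sub_countable _ _ _ ([set: nat] `*` D)); first exact: card_image_le.
  exact: countableX.
have HB (W : set Omega) x : open W -> W x -> exists B, [/\ S B, B x & B `<=` W].
  move=> oW Wx; have /metr[e e0 eW] : nbhs x W by apply: open_nbhs_nbhs.
  have [n ne] : exists n : nat, n.+1%:R^-1 < e / 2.
    exists (Num.truncn (e / 2)^-1).
    by rewrite invf_plt ?posrE ?divr_gt0// truncnS_gt.
  have [] := dD [set y | d x y < n.+1%:R^-1].
  - by exists x; rewrite /= dxx invr_gt0.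
  - by apply: open_dist_ball; rewrite invr_gt0.
  move=> z [/= xz Dz]; exists (F (n, z)); split.
  - by exists (n, z).
  - by rewrite /F/= dC.
  - move=> y; rewrite /F/= => zy; apply: eW => /=.
    rewrite (le_lt_trans (dtri z x y))//.
    by rewrite [ltRHS](splitr e) ltrD// (lt_trans _ ne).
have S0 : S !=set0 by have [B []] := HB setT point openT Logic.I; exists B.
have [S0'|[g]] := pfcard_geP cS; first by move: S0; rewrite S0' => -[].
exists (fun n => g n); split.
  move=> n; have /= [p _ <-] : S (g n) by exact: funS.
  by apply: open_dist_ball; rewrite invr_gt0.
move=> W x oW Wx; have [B [SB Bx BW]] := HB W x oW Wx.
have [n _ nB] := surj (f := g) SB.
by exists n; rewrite nB.
Qed.

End polish_space.

(** * Signed measures *)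

Section charge_completeness.
Context d (T : measurableType d) (R : realType).
Context (I : Type) (F : set_system I) {FF : ProperFilter F}.
Variable u : I -> {charge set T -> \bar R}.
Hypothesis u_cauchy : forall e : R, 0 < e -> exists2 S : set I, F S &
  forall i j, S i -> S j -> forall A, measurable A ->
    `|fine (u i A) - fine (u j A)| <= e.

(** The setwise limit along any proper filter: it serves both for [+oo] and for an ultrafilter. The
    Cauchy condition [u_cauchy], uniform over measurable sets, is the total variation one up to a
    factor 2. *)
Definition charge_lim (A : set T) : \bar R := (lim (fine (u i A) @[i --> F]))%:E.

Lemma charge_fin (nu : {charge set T -> \bar R}) A : measurable A ->
  nu A \is a fin_num.
Proof. by move=> mA; exact: fin_num_measure. Qed.

Lemma charge_lim_cvg A : measurable A ->
  fine (u i A) @[i --> F] --> fine (charge_lim A).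
Proof.
move=> mA; apply/cauchy_cvgP/cauchy_exP => e e0.
have [S FS uS] := u_cauchy (divr_gt0 e0 (ltr0n R 2)).
have [i0 Si0] := filter_ex FS.
exists (fine (u i0 A)).
suff : \forall i \near F, ball (fine (u i0 A)) e (fine (u i A)) by [].
apply: filterS FS => i Si.
change (`|fine (u i0 A) - fine (u i A)| < e).
rewrite (le_lt_trans (uS _ _ Si0 Si A mA))//.
by rewrite ltr_pdivrMr// mulr_natr mulr2n ltrDl.
Qed.

Lemma charge_lim_unif (e : R) : 0 < e ->
  \forall i \near F, forall A, measurable A ->
    `|fine (u i A) - fine (charge_lim A)| <= e.
Proof.
move=> e0; have [S FS uS] := u_cauchy e0.
apply: filterS (FS) => i Si A mA; have cA := charge_lim_cvg mA.
have h : `|fine (u i A) - fine (u j A)| @[j --> F] -->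
    `|fine (u i A) - fine (charge_lim A)|.
  by apply: cvg_norm; apply: cvgB => //; exact: cvg_cst.
rewrite -(cvg_lim _ h)//; apply: limr_le.
  by apply/cvg_ex; eexists; exact: h.
by apply: filterS (FS) => j Sj; exact: uS.
Qed.

Let charge_lim0 : charge_lim set0 = 0%E.
Proof.
rewrite /charge_lim; under eq_fun do rewrite charge0/=.
by rewrite lim_cst.
Qed.

Let charge_lim_fin A : measurable A -> charge_lim A \is a fin_num.
Proof. by []. Qed.

Let charge_lim_sum (A : (set T)^nat) k : (forall n, measurable (A n)) ->
  trivIset setT A ->
  (\sum_(0 <= n < k) charge_lim (A n))%E = charge_lim (\big[setU/set0]_(n < k) A n).
Proof.
move=> mA tA; rewrite big_mkord sumEFin; congr EFin; apply/esym/cvg_lim => //.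
have E i : fine (u i (\big[setU/set0]_(n < k) A n)) = \sum_(n < k) fine (u i (A n)).
  rewrite (@charge_semi_additive _ _ _ (u i) A k)//; last first.
    exact: bigsetU_measurable.
  by rewrite sum_fine// => n _; exact: charge_fin.
under eq_cvg do rewrite E.
apply: cvg_big => [|n _]; first exact: add_continuous.
exact: charge_lim_cvg.
Qed.

Let charge_lim_sigma_additive : semi_sigma_additive charge_lim.
Proof.
move=> A mA tA mU.
under eq_fun do rewrite charge_lim_sum//.
apply/fine_cvgP; split; first exact: nearW.
apply/cvgrPdist_le => /= e e0.
(* One index [i] approximates the limit on all sets simultaneously, so the sigma-additivity of [u i]
   passes to the limit at the cost of three thirds of [e]. *)
have e3 : 0 < e / 3 by rewrite divr_gt0.
have [i Hi] := filter_ex (charge_lim_unif e3).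
have := charge_semi_sigma_additive (s := u i) A mA tA mU.
have E k : (\sum_(0 <= n < k) u i (A n))%E = u i (\big[setU/set0]_(n < k) A n).
  rewrite big_mkord -(@charge_semi_additive _ _ _ (u i) A k)//.
  exact: bigsetU_measurable.
under eq_fun do rewrite E.
rewrite -(fineK (charge_fin (u i) mU)) => /fine_cvg/cvgrPdist_le/(_ _ e3).
apply: filterS => k /= Hk.
have h1 := Hi _ mU.
have h2 : `|fine (u i (\big[setU/set0]_(n < k) A n)) -
    fine (charge_lim (\big[setU/set0]_(n < k) A n))| <= e / 3.
  by apply: Hi; exact: bigsetU_measurable.
move: Hk h1 h2; rewrite /=; set a := lim _; set b := lim _.
rewrite !ler_norml => /andP[a1 a2] /andP[b1 b2] /andP[c1 c2].
have : e = e / 3 + e / 3 + e / 3 by lra.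
by move=> ?; apply/andP; split; lra.
Qed.

HB.instance Definition _ := isCharge.Build _ _ _ charge_lim
  charge_lim0 charge_lim_fin charge_lim_sigma_additive.

Lemma charge_cauchy_cvg : exists nu : {charge set T -> \bar R},
  forall e : R, 0 < e -> \forall i \near F, forall A, measurable A ->
    `|fine (u i A) - fine (nu A)| <= e.
Proof. by exists charge_lim => e e0; exact: charge_lim_unif. Qed.

End charge_completeness.

Section signed_measures.
Context (R : realType) (Omega : ptopologicalType).
Local Notation M := (signed_measure R Omega).
Local Notation kernel := (R.-pker (borel Omega) ~> (borel Omega)).
Implicit Types (mu nu : M) (f g : Omega -> R) (A : set (borel Omega)).

Lemma positive_part_fin mu : (positive_part mu setT < +oo)%E.
Proof. by rewrite ltey_eq fin_num_measure. Qed.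

Lemma negative_part_fin mu : (negative_part mu setT < +oo)%E.
Proof. by rewrite ltey_eq fin_num_measure. Qed.

Lemma chargeE mu A : measurable A ->
  mu A = (positive_part mu A - negative_part mu A)%E.
Proof.
by move=> mA; rewrite (jordan_decomp (svalP (hahn_sig mu)) mA) /cadd/= cscaleN1.
Qed.

Lemma fine_chargeE mu A : measurable A ->
  fine (mu A) = fine (positive_part mu A) - fine (negative_part mu A).
Proof.
move=> mA; rewrite (chargeE _ mA) fineB//.
- exact: (fin_measure (positive_part_fin mu)).
- exact: (fin_measure (negative_part_fin mu)).
Qed.

Section pairing_lemmas.
Variable mu : M.
Let pfin := positive_part_fin mu.
Let nfin := negative_part_fin mu.

Lemma pairingD f g : Bb f -> Bb g ->
  pairing mu (fun x => f x + g x) = pairing mu f + pairing mu g.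
Proof.
move=> bf bg; rewrite /pairing (bintD pfin bf bg) (bintD nfin bf bg).
by rewrite opprD addrACA.
Qed.

Lemma pairingZ r f : Bb f -> pairing mu (fun x => r * f x) = r * pairing mu f.
Proof.
by move=> bf; rewrite /pairing (bintZ pfin r bf) (bintZ nfin r bf) mulrBr.
Qed.

Lemma pairingB f g : Bb f -> Bb g ->
  pairing mu (fun x => f x - g x) = pairing mu f - pairing mu g.
Proof.
move=> bf bg; rewrite /pairing (bintB pfin bf bg) (bintB nfin bf bg).
by rewrite !opprB addrACA [in RHS]addrC -addrA; ring.
Qed.

Lemma pairing_indic A : measurable A -> pairing mu (\1_A) = fine (mu A).
Proof. by move=> mA; rewrite /pairing !bint_indic// fine_chargeE. Qed.

Lemma pairing_lim (f_ : nat -> Omega -> R) f (N : R) :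
  (forall n, Bb (f_ n)) -> (forall n x, `|f_ n x| <= N) ->
  (forall x, f_ ^~ x @ \oo --> f x) ->
  (fun n => pairing mu (f_ n)) @ \oo --> pairing mu f.
Proof.
by move=> bf fM ff; apply: cvgB;
  [exact: (bounded_cvg_Rintegral pfin bf)|exact: (bounded_cvg_Rintegral nfin bf)].
Qed.

Lemma tv_normE : tv_norm mu =
  fine (positive_part mu setT) + fine (negative_part mu setT).
Proof.
rewrite /tv_norm /charge_variation fineD//.
- exact: (fin_measure pfin).
- exact: (fin_measure nfin).
Qed.

Lemma pairing_bound f N : Bb f -> (forall x, `|f x| <= N) ->
  `|pairing mu f| <= N * tv_norm mu.
Proof.
move=> bf fN; rewrite tv_normE mulrDr (le_trans (ler_normB _ _))// lerD//.
  exact: (bint_bound pfin bf fN).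
exact: (bint_bound nfin bf fN).
Qed.

Lemma tv_norm_ge0 : 0 <= tv_norm mu.
Proof. by rewrite tv_normE addr_ge0// fine_ge0. Qed.

(** The masses of the two Jordan parts are the values of [mu] and of [- mu] on the two sets of the
    Hahn decomposition; this is the origin of the factor 2. *)
Lemma tv_norm_le e : (forall A, measurable A -> `|fine (mu A)| <= e) ->
  tv_norm mu <= 2 * e.
Proof.
move=> H; rewrite tv_normE mulr2n mulrDl !mul1r.
have [mP mN] : measurable (sval (hahn_sig mu)).1 /\
    measurable (sval (hahn_sig mu)).2.
  by have [[mP _] [mN _] _ _] := svalP (hahn_sig mu).
rewrite lerD//.
  rewrite (_ : positive_part mu setT = mu (sval (hahn_sig mu)).1).
    by rewrite (le_trans (ler_norm _))// H.
  transitivity (jordan_pos (svalP (hahn_sig mu)) setT) => //.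
  by rewrite jordan_posE cjordan_posE /crestr0 mem_set// /crestr setTI.
rewrite (_ : negative_part mu setT = - mu (sval (hahn_sig mu)).2)%E.
  by rewrite fineN (le_trans (ler_norm _))// normrN H.
transitivity (jordan_neg (svalP (hahn_sig mu)) setT) => //.
by rewrite jordan_negE cjordan_negE /crestr0 mem_set// /crestr setTI.
Qed.

End pairing_lemmas.

(** The Jordan parts of a sum or of an image are not those of its ingredients, so pairings cannot be
    computed part by part. Linearity, bounded convergence and the values on indicators determine
    them instead. *)
Lemma pairing_unique mu (J : (Omega -> R) -> R) :
  (forall f g a, Bb f -> Bb g ->
    J (fun x => a * f x + g x) = a * J f + J g) ->
  (forall (f_ : nat -> Omega -> R) f (N : R), (forall n, Bb (f_ n)) ->
    (forall n x, `|f_ n x| <= N) -> (forall x, f_ ^~ x @ \oo --> f x) ->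
    (fun n => J (f_ n)) @ \oo --> J f) ->
  (forall A, measurable A -> J (\1_A) = fine (mu A)) ->
  forall f, Bb f -> pairing mu f = J f.
Proof.
move=> Jlin Jlim Jind f bf.
apply: (@bmeas_indm _ (borel Omega) R (fun f => pairing mu f = J f)) => //.
- by move=> A mA; rewrite pairing_indic// Jind.
- move=> a g h bg bh Qg Qh; rewrite pairingD ?pairingZ// ?Jlin ?Qg ?Qh//.
  exact: bmeasZ.
- move=> f_ g N bf_ Qf fN fg.
  have h1 := pairing_lim (mu := mu) bf_ fN fg; have h2 := Jlim _ _ _ bf_ fN fg.
  rewrite -(cvg_lim _ h1)// -(cvg_lim _ h2)//; congr (lim (_ @ \oo)).
  by apply/funext => n; exact: Qf.
Qed.

Section difference.
Variables (mu : M) (m1 m2 : {measure set (borel Omega) -> \bar R}).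
Hypothesis fm1 : (m1 setT < +oo)%E.
Hypothesis fm2 : (m2 setT < +oo)%E.
Hypothesis muE : forall A, measurable A -> mu A = (m1 A - m2 A)%E.

(** Any decomposition into finite measures computes the pairing, not only the Jordan one. *)
Lemma pairing_diff f : Bb f ->
  pairing mu f = \int[m1]_x f x - \int[m2]_x f x.
Proof.
apply: (@pairing_unique mu (fun f => \int[m1]_x f x - \int[m2]_x f x)) => //.
- move=> g h a bg bh.
  rewrite (bintD fm1 (bmeasZ a bg) bh) (bintD fm2 (bmeasZ a bg) bh).
  by rewrite (bintZ fm1 a bg) (bintZ fm2 a bg); ring.
- move=> f_ g N bf fN fg; apply: cvgB.
    exact: (bounded_cvg_Rintegral fm1 bf).
  exact: (bounded_cvg_Rintegral fm2 bf).
- move=> A mA; rewrite !bint_indic// muE// fineB//.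
    exact: (fin_measure fm1).
  exact: (fin_measure fm2).
Qed.

End difference.

Lemma charge_eqP mu nu :
  charge_eq mu nu <-> forall f, Bb f -> pairing mu f = pairing nu f.
Proof.
split=> [E f bf|E A mA].
  rewrite (pairing_diff (positive_part_fin nu) (negative_part_fin nu))//.
  by move=> A mA; rewrite E// chargeE.
rewrite -(fineK (charge_fin mu mA)) -(fineK (charge_fin nu mA)).
by rewrite -!pairing_indic// E//; exact: bmeas_indic.
Qed.

Lemma charge_eq_sym mu nu : charge_eq mu nu -> charge_eq nu mu.
Proof. by move=> E A mA; rewrite E. Qed.

Lemma charge_eq_trans mu nu la :
  charge_eq mu nu -> charge_eq nu la -> charge_eq mu la.
Proof. by move=> E F A mA; rewrite E// F. Qed.

Lemma pairing_ext mu nu f : Bb f -> charge_eq mu nu -> pairing mu f = pairing nu f.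
Proof. by move=> bf /charge_eqP; exact. Qed.

Lemma pairing_cadd mu nu f : Bb f ->
  pairing (cadd mu nu) f = pairing mu f + pairing nu f.
Proof.
apply: (@pairing_unique _ (fun f => pairing mu f + pairing nu f)) => //.
- move=> g h a bg bh; rewrite !pairingD ?pairingZ//; try exact: bmeasZ.
  by ring.
- by move=> f_ g N bf fN fg; apply: cvgD; exact: pairing_lim.
- move=> A mA; rewrite !pairing_indic// fineD//; exact: charge_fin.
Qed.

Lemma pairing_cscale a mu f : Bb f -> pairing (cscale a mu) f = a * pairing mu f.
Proof.
apply: (@pairing_unique _ (fun f => a * pairing mu f)) => //.
- move=> g h b bg bh; rewrite !pairingD ?pairingZ//; try exact: bmeasZ.
  by ring.
- by move=> f_ g N bf fN fg; apply: cvgM; [exact: cvg_cst|exact: pairing_lim].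
- move=> A mA; rewrite !pairing_indic//.
  by rewrite /= /cscale fineM//; exact: charge_fin.
Qed.

Lemma pairing_copp mu f : Bb f -> pairing (copp mu) f = - pairing mu f.
Proof.
apply: (@pairing_unique _ (fun f => - pairing mu f)) => //.
- move=> g h b bg bh; rewrite !pairingD ?pairingZ//; try exact: bmeasZ.
  by ring.
- by move=> f_ g N bf fN fg; apply: cvgN; exact: pairing_lim.
- move=> A mA; rewrite !pairing_indic//.
  by rewrite /= /copp fineN.
Qed.

Section charge_of.
Variables (m : {measure set (borel Omega) -> \bar R}).
Hypothesis fm : (m setT < +oo)%E.

Definition charge_of : M := charge_of_finite_measure (to_finite fm).

Lemma charge_ofE A : charge_of A = m A. Proof. by []. Qed.

Lemma pairing_charge_of f : Bb f -> pairing charge_of f = \int[m]_x f x.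
Proof.
move=> bf; have f0 : (@mzero _ (borel Omega) R setT < +oo)%E by rewrite /mzero ltry.
rewrite (pairing_diff (m1 := m) fm f0)//.
  by rewrite [X in _ - X](_ : _ = 0) ?subr0// /Rintegral integral_measure_zero.
by move=> A mA; rewrite charge_ofE /mzero sube0.
Qed.

End charge_of.

Lemma has_kernel_pairing (T : M -> M) (k : kernel) mu f : has_kernel T k -> Bb f ->
  pairing (T mu) f = pairing mu (kop k f).
Proof.
move=> Tk; apply: (@pairing_unique _ (fun f => pairing mu (kop k f))) => //.
- move=> g h a bg bh; rewrite -pairingZ; last exact: kop_bmeas.
  rewrite -pairingD; [|by apply: bmeasZ; exact: kop_bmeas|exact: kop_bmeas].
  congr (pairing mu _); apply/funext => x.
  by rewrite kopD ?kopZ//; exact: bmeasZ.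
- move=> f_ g N bf fN fg; apply: (@pairing_lim _ _ _ N).
  + by move=> n; exact: (kop_bmeas k (bf n)).
  + by move=> n x; exact: (kop_bound k x (bf n) (fN n)).
  + by move=> x; exact: (kop_lim bf fN fg).
- move=> A mA; rewrite Tk//=; congr (pairing mu _).
  by apply/funext => x; rewrite kop_indic.
Qed.

Lemma kernel_ofP (T : M -> M) : markovian T -> has_kernel T (kernel_of T).
Proof.
by move=> [_ Tk]; rewrite /kernel_of; case: pselect => // h; exact: (svalP (cid h)).
Qed.

Lemma adjoint_pairing (T : M -> M) mu f : markovian T -> Bb f ->
  pairing (T mu) f = pairing mu (adjoint T f).
Proof. by move=> mT; apply: has_kernel_pairing; exact: kernel_ofP. Qed.

Section operator_of_kernel.
Variable k : kernel.

Definition kernel_op mu : M :=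
  cadd (charge_of (kbind_fin k (positive_part_fin mu)))
       (copp (charge_of (kbind_fin k (negative_part_fin mu)))).

Lemma kernel_op_pairing mu f : Bb f ->
  pairing (kernel_op mu) f = pairing mu (kop k f).
Proof.
move=> bf; rewrite pairing_cadd// pairing_copp// !pairing_charge_of//.
rewrite (kbind_Rintegral k (positive_part_fin mu) bf).
by rewrite (kbind_Rintegral k (negative_part_fin mu) bf).
Qed.

Lemma kernel_op_has_kernel : has_kernel kernel_op k.
Proof.
move=> mu A mA; rewrite -[LHS]fineK; last exact: charge_fin.
congr EFin; rewrite -pairing_indic// kernel_op_pairing; last exact: bmeas_indic.
by congr (pairing mu _); apply/funext => x; rewrite kop_indic.
Qed.

Lemma kernel_op_markovian : markovian kernel_op.
Proof.
split; last by exists k; exact: kernel_op_has_kernel.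
have bk f : Bb f -> Bb (kop k f) by exact: kop_bmeas.
split=> [mu nu E|mu nu|a mu|].
- by apply/charge_eqP => f bf; rewrite !kernel_op_pairing//; apply: pairing_ext E; exact: bk.
- apply/charge_eqP => f bf.
  by rewrite pairing_cadd// !kernel_op_pairing// pairing_cadd//; exact: bk.
- apply/charge_eqP => f bf.
  by rewrite pairing_cscale// !kernel_op_pairing// pairing_cscale//; exact: bk.
(* The constant 2 is that of [tv_norm_le]. *)
- exists 2 => mu; apply: tv_norm_le => A mA.
  rewrite -pairing_indic// kernel_op_pairing; last exact: bmeas_indic.
  rewrite -[leRHS]mul1r; apply: pairing_bound; first exact/bk/bmeas_indic.
  move=> x; apply: kop_bound; first exact: bmeas_indic.
  by move=> y; rewrite indicE; case: (_ \in _); rewrite ?normr1 ?normr0.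
Qed.

End operator_of_kernel.

Lemma Cb_charge_eq (d : Omega -> Omega -> R) mu nu : is_metric d -> metrizes d ->
  (forall f, Cb f -> pairing mu f = pairing nu f) -> charge_eq mu nu.
Proof.
move=> md metr E; apply/charge_eqP; apply: (Bb_ind md metr) => //.
- move=> a f g bf bg Ef Eg; rewrite !pairingD ?pairingZ ?Ef ?Eg//; exact: bmeasZ.
- move=> f_ f N bf Ef fN ff.
  have h1 := pairing_lim (mu := mu) bf fN ff; have h2 := pairing_lim (mu := nu) bf fN ff.
  rewrite -(cvg_lim _ h1)// -(cvg_lim _ h2)//; congr (lim (_ @ \oo)).
  by apply/funext => n; exact: Ef.
Qed.

End signed_measures.

(** * The adjoint semigroup and its averages *)

Section constant_kernel.
Context d d' (X : measurableType d) (Y : measurableType d') (R : realType).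
Variable m : {measure set Y -> \bar R}.
Hypothesis fm : (m setT < +oo)%E.

(** As in [finite_alias], the vacuous [let] keeps [fm] as an argument for the instances. With this
    kernel, integrals against product measures become instances of [kjoint]. *)
Definition kconst (_ : X) : {measure set Y -> \bar R} := let _ := fm in m.

Let kconst_measurable U : measurable U -> measurable_fun [set: X] (kconst ^~ U).
Proof. by move=> mU; exact: measurable_cst. Qed.

HB.instance Definition _ := isKernel.Build _ _ _ _ _ kconst kconst_measurable.

Let kconst_uub : measure_fam_uub kconst.
Proof.
exists (fine (m setT) + 1) => x; change (m setT < (fine (m setT) + 1)%:E)%E.
rewrite -[ltLHS](fineK (fin_measure fm measurableT)).
by rewrite lte_fin ltrDl.
Qed.

HB.instance Definition _ := Kernel_isFinite.Build _ _ _ _ _ kconst kconst_uub.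

End constant_kernel.

Lemma bmeas_swap d d' (X : measurableType d) (Y : measurableType d')
    (R : realType) (f : X * Y -> R) :
  bmeas f -> bmeas (fun z : Y * X => f (z.2, z.1)).
Proof.
move=> /bmeasP[mf [M fM]].
apply: (@bmeas_of _ _ _ _ M) => [|z]; last exact: fM.
by apply: (measurableT_comp mf); exact: measurable_swap.
Qed.

Section fubini.
Context d d' (X : measurableType d) (Y : measurableType d') (R : realType).
Variables (mu : {measure set X -> \bar R}) (nu : {measure set Y -> \bar R}).
Hypotheses (fmu : (mu setT < +oo)%E) (fnu : (nu setT < +oo)%E).

Lemma bmeas_bint2 (f : X * Y -> R) : bmeas f ->
  bmeas (fun x => \int[nu]_y f (x, y)).
Proof. by move=> bf; exact: (kjoint_Rintegral (kconst fnu) fmu bf).1. Qed.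

Lemma bint_swap (f : X * Y -> R) : bmeas f ->
  \int[mu]_x \int[nu]_y f (x, y) = \int[nu]_y \int[mu]_x f (x, y).
Proof.
move=> bf; pose m1 := to_finite fmu; pose m2 := to_finite fnu.
have bf2 := bmeas_swap bf.
have int12 : (m1 \x m2)%E.-integrable setT (EFin \o f).
  apply: bmeas_integrable => //.
  have -> : [set: X * Y] = [set: X] `*` [set: Y] by rewrite setXTT.
  rewrite [ltLHS](product_measure1E m1 m2)// ltey_eq fin_numM//.
    exact: (fin_measure fmu).
  exact: (fin_measure fnu).
have := Fubini int12.
rewrite /Rintegral => E.
have E1 : (\int[m1]_x \int[m2]_y (EFin \o f) (x, y))%E =
    (\int[mu]_x (\int[nu]_y f (x, y))%:E)%E.
  apply: eq_integral => x _; rewrite (EFin_bint fnu)//.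
  exact: bmeas_section.
have E2 : (\int[m2]_y \int[m1]_x (EFin \o f) (x, y))%E =
    (\int[nu]_y (\int[mu]_x f (x, y))%:E)%E.
  apply: eq_integral => y _; rewrite (EFin_bint fmu)//.
  exact: (bmeas_section y bf2).
by rewrite E1 E2 in E; congr fine.
Qed.

End fubini.

Section uniform.
Context (R : realType) (t : R) (t0 : 0 < t).

(** Time averages become integrals against a probability measure, so that they compose with kernels.
    As [integral_uniform] concerns nonnegative functions, [f] is shifted by its bound. *)
Lemma bint_uniform (f : measurableTypeR R -> R) : bmeas f ->
  \int[uniform_prob t0]_s f s =
  t^-1 * \int[@lebesgue_measure R]_(s in `[0, t]) f s.
Proof.
move=> bf; have /bmeasP[mf [M fM]] := bf.
have ft : (@lebesgue_measure R `[0%R, t] < +oo)%E.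
  by rewrite lebesgue_measure_itv/= lte_fin t0 -EFinB ltry.
have iD (g : measurableTypeR R -> R) : bmeas g ->
    (@lebesgue_measure R).-integrable `[0%R, t] (EFin \o g).
  move=> /bmeasP[mg [N gN]]; apply: measurable_bounded_integrable => //.
    exact: measurable_funTS.
  exists N; split; first exact: num_real.
  by move=> r Nr x _ /=; rewrite (le_trans (gN x))// ltW.
have fU : (uniform_prob t0 setT < +oo)%E by rewrite probability_setT ltry.
have bM := bmeas_cst (measurableTypeR R) M.
have mg : measurable_fun setT (fun x : measurableTypeR R => (f x + M)%:E).
  by apply/measurable_EFinP; exact: measurable_funD.
have g0 x : (0 <= (f x + M)%:E)%E.
  by rewrite lee_fin -lerBlDr sub0r; have := fM x; rewrite ler_norml => /andP[].
have := integral_uniform t0 mg g0.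
rewrite -(EFin_bint fU (bmeasD bf bM)) (bintD fU bf bM).
have IM : \int[uniform_prob t0]_x M = M.
  rewrite bint_cst -[RHS]mulr1; congr (_ * _).
  by rewrite [X in fine X](_ : _ = 1%E)//; exact: probability_setT.
rewrite IM subr0.
have -> : (\int[@lebesgue_measure R]_(x in `[0%R, t]) (f x + M)%:E)%E =
    (\int[@lebesgue_measure R]_(x in `[0%R, t]) f x + M * t)%:E.
  rewrite (_ : M * t = \int[@lebesgue_measure R]_(x in `[0%R, t]) M); last first.
    by rewrite Rintegral_cst//= lebesgue_measure_itv/= lte_fin t0 -EFinB/= subr0.
  rewrite -RintegralD//; [|exact: iD|exact: (iD _ bM)].
  rewrite /Rintegral fineK//; apply: integrable_fin_num => //.
  exact: (iD _ (bmeasD bf bM)).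
rewrite -EFinM => -[]; rewrite mulrDr mulrCA mulVf ?gt_eqF// mulr1.
by move=> /addIr.
Qed.

End uniform.

Section semigroup.
Context (R : realType) (Omega : ptopologicalType).
Local Notation M := (signed_measure R Omega).
Variable S : R -> M -> M.
Hypothesis HS : markovian_semigroup S.
Implicit Types (mu nu : M) (f g : Omega -> R).

Definition P (t : R) f : Omega -> R := kop (kernel_of (S t)) f.

Let mS t : 0 <= t -> markovian (S t). Proof. by case: HS => h _ _; exact: h. Qed.

Lemma P_Bb t f : Bb f -> Bb (P t f). Proof. exact: kop_bmeas. Qed.

Lemma P_pairing (t : R) mu f : 0 <= t -> Bb f -> pairing (S t mu) f = pairing mu (P t f).
Proof. by move=> t0 bf; exact: (adjoint_pairing mu (mS t0) bf). Qed.

Lemma dirac_fin (x : borel Omega) : (@dirac _ (borel Omega) x R setT < +oo)%E.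
Proof. by rewrite diracT ltry. Qed.

Definition dirac_charge (x : Omega) : M := charge_of (dirac_fin x).

Lemma pairing_dirac x f : Bb f -> pairing (dirac_charge x) f = f x.
Proof.
move=> bf; rewrite pairing_charge_of// /Rintegral integral_dirac//.
  by rewrite diracT mul1e.
by apply/measurable_EFinP; case: bf.
Qed.

(** Pairing with the Dirac charge at [x] turns the semigroup law of [S] into a pointwise one;
    passing to adjoints reverses the order of the two factors. *)
Lemma P_semigroup (t s : R) f x : 0 <= t -> 0 <= s -> Bb f ->
  P (t + s) f x = P s (P t f) x.
Proof.
move=> t0 s0 bf; have [_ Hadd _] := HS.
rewrite -(pairing_dirac x (P_Bb _ bf)) -P_pairing ?addr_ge0//.
rewrite (pairing_ext bf (Hadd t s (dirac_charge x) t0 s0)).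
rewrite P_pairing// P_pairing//; last exact: P_Bb.
by rewrite pairing_dirac//; do 2 apply: P_Bb.
Qed.

Hypothesis HC : stochastically_continuous S.

Lemma P_continuous f x (t : R) : Cb f -> 0 <= t -> forall e : R, 0 < e ->
  exists2 r, 0 < r & forall s, 0 <= s -> `|t - s| < r -> `|P t f x - P s f x| < e.
Proof.
move=> cf t0 e e0; have bf := continuous_bmeas cf.
have := @HC f (dirac_charge x) cf => /subspace_continuousP/(_ t).
have t0' : `[0, +oo[%classic t by rewrite /= in_itv/= t0.
move=> /(_ t0')/cvgrPdist_lt/(_ e e0) /=.
rewrite near_withinE => -[r /= r0 hr]; exists r => // s s0 ts.
have s0' : `[0, +oo[%classic s by rewrite /= in_itv/= s0.
have := hr s ts s0'.
by rewrite /from_subspace !P_pairing// !pairing_dirac//; exact: P_Bb.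
Qed.

Variable d : Omega -> Omega -> R.
Hypotheses (md : is_metric d) (metr : metrizes d).

(* Nothing is known about [S t] for [t < 0], hence the truncation of times. *)
Definition tpos (s : R) : R := Num.max s 0.

Lemma tpos_ge0 s : 0 <= tpos s. Proof. by rewrite /tpos le_max lexx orbT. Qed.

Lemma tposE (s : R) : 0 <= s -> tpos s = s. Proof. by move=> s0; exact/max_l. Qed.

(** Times are rounded down to multiples of [n.+1%:R^-1], so that for each [n] only countably many
    operators [P] occur. *)
Let grid (n : nat) (s : R) : nat := Num.truncn (n.+1%:R * tpos s).

Let grid_measurable n k : measurable [set s : measurableTypeR R | grid n s = k].
Proof.
have mt : measurable_fun setT (fun s : measurableTypeR R => n.+1%:R * tpos s).
  by apply: measurable_funM => //; exact: measurable_maxr.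
have := mt measurableT `[k%:R, k.+1%:R[%classic (measurable_itv _).
rewrite setTI; congr measurable; apply/seteqP; split => s /=.
  by rewrite in_itv/= => h; apply/eqP; rewrite truncn_eq// mulr_ge0// tpos_ge0.
rewrite in_itv/= => /eqP; rewrite truncn_eq// mulr_ge0// tpos_ge0//.
Qed.

Let grid_dist n s : 0 <= tpos s - (grid n s)%:R / n.+1%:R <= n.+1%:R^-1.
Proof.
have := truncn_itv (mulr_ge0 (ler0n R n.+1) (tpos_ge0 s)).
rewrite -/(grid n s) => /andP[h1 h2]; apply/andP; split.
  by rewrite subr_ge0 ler_pdivrMr// mulrC.
rewrite lerBlDr -[X in _ <= X + _]mul1r -mulrDl ler_pdivlMr// mulrC.
by rewrite (le_trans (ltW h2))// -natr1 addrC.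
Qed.

(** For continuous [f], continuity in time makes the function the limit of its versions with rounded
    times, which are measurable on countably many strips. Bounded Borel functions follow by
    [Bb_ind]. *)
Lemma joint_bmeas f : Bb f ->
  bmeas (fun z : borel Omega * measurableTypeR R => P (tpos z.2) f z.1).
Proof.
pose Q f := bmeas (fun z : borel Omega * measurableTypeR R => P (tpos z.2) f z.1).
apply: (Bb_ind md metr (Q := Q)).
- move=> g cg; have bg := continuous_bmeas cg; have /bmeasP[_ [N gN]] := bg.
  pose h n (z : borel Omega * measurableTypeR R) :=
    P ((grid n z.2)%:R / n.+1%:R) g z.1.
  apply: (@bmeas_lim _ _ _ h _ N).
  + move=> n; apply: (@bmeas_of _ _ _ _ N) => [|z]; last exact: kop_bound.
    move=> _ B mB; rewrite setTI.
    rewrite (_ : _ @^-1` _ = \bigcup_k ((P (k%:R / n.+1%:R) g @^-1` B) `*`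
        [set s | grid n s = k])); last first.
      apply/seteqP; split=> [[x s] /= ?|[x s] [k _ /= [h1 h2]]]; last by rewrite /h/= h2.
      by exists (grid n s).
    apply: bigcupT_measurable => k; apply: measurableX => //.
    by rewrite -[X in measurable X]setTI; apply: (P_Bb _ bg).1.
  + by move=> n z; exact: kop_bound.
  + move=> [x s] /=; apply/cvgrPdist_lt => e e0.
    have [r r0 hr] := P_continuous x cg (tpos_ge0 s) e0.
    near=> n; apply: hr; first by rewrite divr_ge0.
    have /andP[h1 h2] := grid_dist n s.
    rewrite ger0_norm// (le_lt_trans h2)//.
    near: n; exact: near_infty_natSinv_lt (PosNum r0).
- move=> a g h bg bh Qg Qh.
  rewrite /Q (_ : (fun z => _) = fun z : borel Omega * measurableTypeR R =>
      a * P (tpos z.2) g z.1 + P (tpos z.2) h z.1); last first.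
    apply/funext => z; rewrite /P kopD ?kopZ//; exact: bmeasZ.
  by apply: bmeasD => //; exact: bmeasZ.
- move=> g_ g N bg Qg gN gg.
  pose h n (z : borel Omega * measurableTypeR R) := P (tpos z.2) (g_ n) z.1.
  apply: (@bmeas_lim _ _ _ h _ N) => //.
  + by move=> n z; exact: (kop_bound _ _ (bg n) (gN n)).
  + by move=> z; exact: (kop_lim bg gN gg).
Unshelve. all: by end_near. Qed.

Lemma P_bint_bmeas f (m : {measure set (borel Omega) -> \bar R}) :
  (m setT < +oo)%E -> Bb f ->
  bmeas (fun s : measurableTypeR R => \int[m]_x P (tpos s) f x).
Proof.
move=> fm bf; have bj := bmeas_swap (joint_bmeas bf).
have fU : (uniform_prob (@ltr01 R) setT < +oo)%E.
  by rewrite probability_setT ltry.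
exact: (bmeas_bint2 fU fm bj).
Qed.

Lemma P_pairing_bmeas f mu : Bb f ->
  bmeas (fun s : measurableTypeR R => pairing mu (P (tpos s) f)).
Proof.
move=> bf; have bp := P_bint_bmeas (positive_part_fin mu) bf.
have bn := P_bint_bmeas (negative_part_fin mu) bf.
exact: (bmeasB bp bn).
Qed.

(** * Existence of the averages *)

Section time_kernel.
Variable x : borel Omega.

(** With the starting point frozen, the transition probabilities form a kernel from times to states;
    composing the uniform law with it gives the kernel of the average. *)
Definition time_kernel (s : measurableTypeR R) :
  {measure set (borel Omega) -> \bar R} := kernel_of (S (tpos s)) x.

Let time_kernel_measurable U : measurable U ->
  measurable_fun setT (time_kernel ^~ U).
Proof.
move=> mU; rewrite (_ : time_kernel ^~ U = fun s => (P (tpos s) (\1_U) x)%:E).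
  apply/measurable_EFinP.
  exact: (bmeas_section x (joint_bmeas (bmeas_indic R mU))).1.
apply/funext => s; rewrite /P kop_indic// fineK//.
exact: (fin_measure (fker_fin (kernel_of (S (tpos s))) x)).
Qed.

HB.instance Definition _ := isKernel.Build _ _ _ _ _ time_kernel
  time_kernel_measurable.

Let time_kernelT s : time_kernel s setT = 1%E.
Proof. exact: prob_kernel. Qed.

HB.instance Definition _ := Kernel_isProbability.Build _ _ _ _ _ time_kernel
  time_kernelT.

End time_kernel.

Section average.
Variables (t : R) (t0 : 0 < t).

Let fU : (uniform_prob t0 setT < +oo)%E.
Proof. by rewrite probability_setT ltry. Qed.

Definition avg_kernel (x : borel Omega) : {measure set (borel Omega) -> \bar R} :=
  kbind (uniform_prob t0) (time_kernel x).

Lemma avg_kop f x : Bb f ->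
  kop avg_kernel f x = \int[uniform_prob t0]_s P (tpos s) f x.
Proof. by move=> bf; exact: (kbind_Rintegral (time_kernel x) fU bf). Qed.

Lemma avg_fin x : (avg_kernel x setT < +oo)%E.
Proof. exact: (kbind_fin (time_kernel x) fU). Qed.

Lemma avg_joint f (m : {measure set (borel Omega) -> \bar R}) :
  (m setT < +oo)%E -> Bb f ->
  Bb (kop avg_kernel f) /\ \int[m]_x kop avg_kernel f x =
  \int[uniform_prob t0]_s \int[m]_x P (tpos s) f x.
Proof.
move=> fm bf; rewrite (_ : kop avg_kernel f =
  fun x => \int[uniform_prob t0]_s P (tpos s) f x); last first.
  by apply/funext => x; exact: avg_kop.
have bj := joint_bmeas bf; split; first exact: (bmeas_bint2 fm fU bj).
exact: (bint_swap fm fU bj).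
Qed.

Let avg_measurable U : measurable U -> measurable_fun setT (avg_kernel ^~ U).
Proof.
move=> mU; rewrite (_ : avg_kernel ^~ U = fun x => (kop avg_kernel (\1_U) x)%:E).
  apply/measurable_EFinP.
  exact: (avg_joint (dirac_fin point) (bmeas_indic R mU)).1.1.
apply/funext => x; rewrite /kop bint_indic// fineK//.
exact: (fin_measure (avg_fin x)).
Qed.

HB.instance Definition _ := isKernel.Build _ _ _ _ _ avg_kernel avg_measurable.

Let avg_kernelT x : avg_kernel x setT = 1%E.
Proof.
rewrite /avg_kernel /= /kbind.
under eq_integral do rewrite pkerT.
by rewrite integral_cst// mul1e; exact: probability_setT.
Qed.

HB.instance Definition _ := Kernel_isProbability.Build _ _ _ _ _ avg_kernel
  avg_kernelT.

Lemma average_ex : is_average S t (kernel_op avg_kernel).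
Proof.
split=> [|mu f bf]; first exact: kernel_op_markovian.
rewrite kernel_op_pairing// /pairing.
have [_ ->] := avg_joint (positive_part_fin mu) bf.
have [_ ->] := avg_joint (negative_part_fin mu) bf.
have bp := P_bint_bmeas (positive_part_fin mu) bf.
have bn := P_bint_bmeas (negative_part_fin mu) bf.
rewrite -(bintB fU bp bn) (bint_uniform t0 (bmeasB bp bn)); congr (_ * _).
apply: eq_Rintegral => s; rewrite inE/= in_itv/= => /andP[s0 _].
rewrite tposE// [RHS]P_pairing//.
Qed.

Lemma averageP : is_average S t (average S t).
Proof.
rewrite /average; case: pselect => [h|h]; first exact: (svalP (cid h)).
by exfalso; apply: h; exists (kernel_op avg_kernel); exact: average_ex.
Qed.

Lemma average_pairing mu f : Bb f -> pairing (average S t mu) f =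
  \int[uniform_prob t0]_s pairing mu (P (tpos s) f).
Proof.
move=> bf; rewrite (averageP.2 mu f bf) (bint_uniform t0 (P_pairing_bmeas mu bf)).
congr (_ * _); apply: eq_Rintegral => s; rewrite inE/= in_itv/= => /andP[s0 _].
by rewrite tposE// P_pairing.
Qed.

End average.

End semigroup.

(** * Total variation convergence, ergodicity and separation *)

Section cesaro.
Context (R : realType).
Implicit Types (f : measurableTypeR R -> R).

Lemma cesaro_cvg0 f : bmeas f -> f s @[s --> +oo] --> 0 ->
  forall e : R, 0 < e -> exists T : R, forall t (t0 : 0 < t), T < t ->
    `|\int[uniform_prob t0]_s f s| <= e.
Proof.
move=> bf f0 e e0; have /bmeasP[_ [K fK]] := bf.
have K0 : 0 <= K by exact: le_trans (fK 0).
have e2 : 0 < e / 2 by rewrite divr_gt0.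
have /cvgrPdist_le/(_ _ e2)[T [_ HT]] := f0.
pose T' := Num.max T 0; have T'0 : 0 <= T' by rewrite le_max lexx orbT.
(* The interval from 0 to [T'] has uniform weight at most [T' / t], so it contributes at most
   [e / 2] once [t] exceeds [2 * K * T' / e]. *)
exists (Num.max T' (2 * K * T' / e)) => t t0; rewrite gt_max => /andP[Tt T't].
have fU : (uniform_prob t0 setT < +oo)%E by rewrite probability_setT ltry.
have UT : fine (uniform_prob t0 setT) = 1.
  by rewrite [X in fine X](_ : _ = 1%E)//; exact: probability_setT.
have mI : measurable (`[0, T']%classic : set (measurableTypeR R)) by exact: measurable_itv.
have bI := bmeas_indic R mI.
(* The majorant of [f] has to hold on the whole line; this term handles the negative times, which
   the uniform law does not charge. *)
have bJ : bmeas (fun s : measurableTypeR R => \1_(`]-oo, 0[%classic) s : R).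
  by apply: bmeas_indic; exact: measurable_itv.
have IJ : \int[uniform_prob t0]_s (\1_(`]-oo, 0[%classic) s : R) = 0.
  rewrite (bint_uniform t0 bJ) (@eq_Rintegral _ _ _ _ _ (fun=> 0)).
    by rewrite Rintegral_cst//= mul0r mulr0.
  move=> s; rewrite inE/= in_itv/= => /andP[s0 _].
  by rewrite indicE memNset//= in_itv/= ltNge s0.
have II : \int[uniform_prob t0]_s (\1_(`[0, T']%classic) s : R) <= t^-1 * T'.
  rewrite (bint_uniform t0 bI); apply: ler_wpM2l; first by rewrite invr_ge0 ltW.
  rewrite /Rintegral integral_indic//=.
  have -> : [set` `[0, T']] `&` [set` `[0, t]] = [set` `[0%R, T']] :> set R.
    apply/seteqP; split => [s [] //|s /= sT]; split => //.
    move: sT; rewrite /= !in_itv/= => /andP[-> sT] /=.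
    by rewrite (le_trans sT)// ltW.
  by rewrite lebesgue_measure_itv/=; case: ifPn => _ /=; rewrite ?subr0.
have bG : bmeas (fun s : measurableTypeR R => e / 2 + (K * \1_(`[0, T']%classic) s
    + K * \1_(`]-oo, 0[%classic) s)).
  by apply: bmeasD; [exact: bmeas_cst|apply: bmeasD; exact: bmeasZ].
rewrite (le_trans (le_norm_bint fU bf))//.
apply: (@le_trans _ _ (\int[uniform_prob t0]_s (e / 2 + (K * \1_(`[0, T']%classic) s
    + K * \1_(`]-oo, 0[%classic) s)))).
  apply: (le_bint fU (bmeas_abs bf) bG) => s.
  have h0 : 0 <= (\1_(`[0, T']%classic) s : R) by rewrite indicE.
  have h1 : 0 <= (\1_(`]-oo, 0[%classic) s : R) by rewrite indicE.
  have [s0|s0] := ltP s 0.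
    have -> : \1_(`]-oo, 0[%classic) s = 1 :> R by rewrite indicE mem_set//= in_itv.
    by have := mulr_ge0 K0 h0; have := fK s; move: e2; lra.
  have [sT|sT] := leP s T'.
    have -> : \1_(`[0, T']%classic) s = 1 :> R.
      by rewrite indicE mem_set//= in_itv/= s0.
    by have := mulr_ge0 K0 h1; have := fK s; move: e2; lra.
  have Ts : T < s by apply: le_lt_trans sT; rewrite le_max lexx.
  have := HT s Ts; rewrite sub0r normrN.
  by have := mulr_ge0 K0 h0; have := mulr_ge0 K0 h1; lra.
rewrite (bintD fU (bmeas_cst _ (e / 2)) (bmeasD (bmeasZ K bI) (bmeasZ K bJ))).
rewrite (bintD fU (bmeasZ K bI) (bmeasZ K bJ)) (bintZ fU K bI) (bintZ fU K bJ).
rewrite bint_cst UT mulr1 IJ mulr0 addr0.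
rewrite [leRHS](splitr e) lerD2l (le_trans (ler_wpM2l K0 II))//.
rewrite mulrCA mulrC ler_pdivrMr//.
by move: T't; rewrite ltr_pdivrMr//; lra.
Qed.

Lemma Rintegral_shift (f : R -> R) (s t : R) : continuous f -> 0 < t ->
  \int[@lebesgue_measure R]_(r in `[0, t]) f (r + s) =
  \int[@lebesgue_measure R]_(r in `[s, t + s]) f r.
Proof.
move=> cf t0; congr fine; pose F : R -> R := shift s.
have F' : derive1 F = fun=> 1.
  apply/funext => r; rewrite derive1E.
  by have [] := is_derive_shift r (1 : R) s.
have := @integration_by_substitution_increasing R F f 0 t (ltW t0).
rewrite F' /F/= add0r => ->.
- by apply: eq_integral => r _ /=; rewrite mulr1.
- by move=> x y _ _; rewrite /F ltrD2r.
- by move=> r _; exact: cvg_cst.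
- exact: is_cvg_cst.
- exact: is_cvg_cst.
- have cF : continuous F by move=> r; apply: cvgD; [exact: cvg_id|exact: cvg_cst].
  split.
  + by move=> r _; have [] := is_derive_shift r 1 s.
  + by apply: cvg_at_right_filter; exact: cF.
  + by apply: cvg_at_left_filter; exact: cF.
- exact: continuous_subspaceT.
Qed.

(** After a change of variable, the integrals over [s, t + s] and [0, t] differ by those over ]t, t
    + s] and [0, s], each at most [N * s]. This makes limits of averages invariant. *)
Lemma uniform_shift (f : R -> R) N s t (t0 : 0 < t) : continuous f ->
  (forall r, `|f r| <= N) -> 0 <= s ->
  `|\int[uniform_prob t0]_r f (r + s) - \int[uniform_prob t0]_r f r|
    <= t^-1 * (2 * N * s).
Proof.
move=> cf fN s0.
have mf (g : R -> R) : continuous g -> measurable_fun [set: measurableTypeR R] g.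
  by move=> cg; exact: continuous_measurable_fun.
have cfs : continuous (fun r => f (r + s)).
  move=> r; apply: (@continuous_comp _ _ _ (fun r => r + s) f); last exact: cf.
  by apply: cvgD; [exact: cvg_id|exact: cvg_cst].
have bf : bmeas (f : measurableTypeR R -> R) by apply: (bmeas_of (mf _ cf) fN).
have bfs : bmeas (fun r : measurableTypeR R => f (r + s)).
  by apply: (bmeas_of (mf _ cfs)) => r; exact: fN.
rewrite (bint_uniform t0 bf) (bint_uniform t0 bfs) -mulrBr normrM ger0_norm; last first.
  by rewrite invr_ge0 ltW.
apply: ler_wpM2l; first by rewrite invr_ge0 ltW.
rewrite Rintegral_shift//.
have iD (a b : itv_bound R) : (lebesgue_measure [set` Interval a b] < +oo)%E ->
    (@lebesgue_measure R).-integrable [set` Interval a b] (EFin \o f).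
  move=> fin; apply: measurable_bounded_integrable => //.
    by apply: measurable_funTS; exact: mf.
  exists N; split; first exact: num_real.
  by move=> r Nr x _ /=; rewrite (le_trans (fN x))// ltW.
have fin (a b : R) b1 b2 : (lebesgue_measure [set` Interval (BSide b1 a) (BSide b2 b)] < +oo)%E.
  by rewrite lebesgue_measure_itv/=; case: ifPn => _; rewrite ?ltry// -EFinB ltry.
have ts : 0 <= t + s by rewrite addr_ge0// ltW.
have bound (a b : R) b1 : a <= b ->
  `|\int[@lebesgue_measure R]_(r in [set` Interval (BSide b1 a) (BRight b)]) f r| <= N * (b - a).
  move=> ab; rewrite (le_trans (le_normr_Rintegral _ (iD _ _ (fin _ _ _ _))))//.
  apply: (@le_trans _ _ (\int[@lebesgue_measure R]_(r in [set` Interval (BSide b1 a) (BRight b)]) N)).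
    apply: le_Rintegral => //.
    - by apply: integrable_norm; exact: (iD _ _ (fin _ _ _ _)).
    - apply: measurable_bounded_integrable.
      + exact: measurable_itv.
      + exact: fin.
      + exact: measurable_cst.
      + exists `|N|; split; first exact: num_real.
        by move=> r Nr x _ /=; exact: ltW.
  rewrite Rintegral_cst//= lebesgue_measure_itv/= lte_fin.
  have N0 : 0 <= N by exact: le_trans (fN 0).
  by case: ifPn => //= _; rewrite mulr0 mulr_ge0// subr_ge0.
have E1 := @Rintegral_itvB R f (BLeft 0) (BRight (t + s)) s (iD _ _ (fin _ _ _ _)).
have E2 := @Rintegral_itvB R f (BLeft 0) (BRight (t + s)) t (iD _ _ (fin _ _ _ _)).
rewrite -Rintegral_itv_obnd_cbnd; last exact: (iD _ _ (fin _ _ _ _)).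
move: E1 E2; rewrite !bnd_simp s0 (ltW t0) lerDr (ltW t0) lerDl s0.
move=> /(_ isT isT) E1 /(_ isT isT) E2.
have B1 := bound 0 s true s0.
have B2 : `|\int[@lebesgue_measure R]_(r in `]t, (t + s)]) f r| <= N * (t + s - t).
  by apply: bound; rewrite lerDl.
rewrite -E1 (_ : _ - _ - _ = \int[@lebesgue_measure R]_(r in `]t, (t + s)]) f r -
  \int[@lebesgue_measure R]_(r in `[0, s]) f r); last by rewrite -E2; ring.
rewrite (le_trans (ler_normB _ _))//.
have -> : 2 * N * s = N * (t + s - t) + N * (s - 0) by ring.
exact: lerD.
Qed.

End cesaro.

Section easy_implications.
Context (R : realType) (Omega : ptopologicalType).
Local Notation M := (signed_measure R Omega).
Variable S : R -> M -> M.
Hypotheses (HS : markovian_semigroup S) (HC : stochastically_continuous S).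
Variable d : Omega -> Omega -> R.
Hypotheses (md : is_metric d) (metr : metrizes d).

Lemma P_tpos_continuous g x : Cb g -> continuous (fun r : R => P S (tpos r) g x).
Proof.
move=> cg r; apply/cvgrPdist_lt => e e0.
have [q q0 hq] := P_continuous HS HC x cg (tpos_ge0 r) e0.
have : {for r, continuous (@tpos R)}.
  by apply: continuous_max; [exact: cvg_id|exact: cvg_cst].
move=> /cvgrPdist_lt/(_ _ q0); apply: filterS => s /hq; apply.
exact: tpos_ge0.
Qed.

Lemma tv_convergent_Bb_ergodic : tv_convergent S -> Bb_ergodic S.
Proof.
move=> tvS mu; have [nu munu] := tvS mu; exists nu => f bf.
have /bmeasP[_ [N fN]] := bf.
pose g (s : measurableTypeR R) := pairing mu (P S (tpos s) f) - pairing nu f.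
have bg : bmeas g.
  apply: bmeasB; last exact: bmeas_cst.
  exact: (P_pairing_bmeas HS HC md metr).
have N0 : 0 <= N by exact: le_trans (fN point).
have g0 : g s @[s --> +oo] --> 0.
  apply/cvgrPdist_le => e e0.
  (* The bound [N] may be 0, hence [N + 1]. *)
  have eN : 0 < e / (N + 1) by rewrite divr_gt0// ltr_wpDl.
  have /cvgrPdist_le/(_ _ eN) := munu.
  near_simpl => H; near=> s.
  have s0 : 0 <= s by near: s; apply: nbhs_pinfty_ge; exact: num_real.
  rewrite sub0r normrN /g tposE// -(P_pairing HS)//.
  have -> : pairing (S s mu) f - pairing nu f =
      pairing (cadd (S s mu) (copp nu)) f.
    by rewrite pairing_cadd// pairing_copp.
  rewrite (le_trans (pairing_bound _ bf fN))//.
  have : `|0 - tv_norm (cadd (S s mu) (copp nu))| <= e / (N + 1) by near: s.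
  rewrite sub0r normrN ger0_norm ?tv_norm_ge0//.
  rewrite ler_pdivlMr ?ltr_wpDl// => /(le_trans _); apply.
  by rewrite mulrC ler_wpM2l ?tv_norm_ge0// lerDl.
apply/cvgrPdist_le => e e0; have [T HT] := cesaro_cvg0 bg g0 e0.
near=> t.
have t0 : 0 < t by near: t; apply: nbhs_pinfty_gt; exact: num_real.
rewrite distrC (average_pairing HS HC md metr t0)//.
have fU : (uniform_prob t0 setT < +oo)%E by rewrite probability_setT ltry.
have := HT t t0; rewrite /g (bintB fU); last 2 first.
- exact: (P_pairing_bmeas HS HC md metr).
- exact: bmeas_cst.
rewrite bint_cst [X in fine X](_ : _ = 1%E); last exact: probability_setT.
rewrite mulr1; apply; near: t; apply: nbhs_pinfty_gt; exact: num_real.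
Unshelve. all: by end_near. Qed.

Lemma Bb_ergodic_weakly_ergodic : Bb_ergodic S -> weakly_ergodic S.
Proof.
move=> BS mu; have [nu munu] := BS mu; exists nu => f cf.
exact: (munu f (continuous_bmeas cf)).
Qed.

Variable t0 : R.
Hypotheses (t0_gt0 : 0 < t0) (SF : strong_feller (S t0)).

(** [P t] is [P t0] after [P (t - t0)], so the strong Feller property persists at later times. *)
Lemma P_Cb t f : t0 <= t -> Bb f -> Cb (P S t f).
Proof.
move=> t0t bf; rewrite (_ : P S t f = adjoint (S t0) (P S (t - t0) f)).
  by apply: SF; exact: P_Bb.
apply/funext => x; rewrite -[t in LHS](subrK t0) (P_semigroup HS)//.
  by rewrite subr_ge0.
exact: ltW.
Qed.

(** The separating measure is the limit [nu] of the averages of a Dirac charge at a point [x] with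
    [f x <> 0]: as [f] is fixed, [nu] pairs with it to [f x]. Weak convergence can be tested on
    [P S s g] only if this function is continuous, so invariance is obtained for [t0 <= s] to begin
    with. *)
Lemma weakly_ergodic_fix_separates : weakly_ergodic S -> fix_separates S.
Proof.
move=> wS f [cf Pf] f0; have bf := continuous_bmeas cf.
have [x fx] : exists x, f x <> 0.
  apply: contrapT => /forallNP nf; apply: f0; apply/funext => x.
  exact: (contrapT (nf x)).
have [nu munu] := wS (dirac_charge R x).
have nuinv s g : t0 <= s -> Cb g -> pairing nu (P S s g) = pairing nu g.
  move=> t0s cg; have s0 : 0 <= s by rewrite (le_trans _ t0s)// ltW.
  have bg := continuous_bmeas cg; have /bmeasP[_ [N gN]] := bg.
  have := munu _ (P_Cb t0s bg); have := munu _ cg => h1 h2.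
  apply/eqP; rewrite -subr_eq0; apply/eqP.
  have h3 : pairing (average S t (dirac_charge R x)) (P S s g) -
      pairing (average S t (dirac_charge R x)) g @[t --> +oo] -->
      pairing nu (P S s g) - pairing nu g by exact: cvgB.
  have h4 : pairing (average S t (dirac_charge R x)) (P S s g) -
      pairing (average S t (dirac_charge R x)) g @[t --> +oo] --> 0.
    apply/cvgrPdist_le => e e0; near=> t.
    have t_gt0 : 0 < t by near: t; apply: nbhs_pinfty_gt; exact: num_real.
    (* From this time on the bound of [uniform_shift] is at most [e]. *)
    have tbig : 2 * N * s / e <= t by near: t; apply: nbhs_pinfty_ge; exact: num_real.
    rewrite sub0r normrN !(average_pairing HS HC md metr t_gt0)//; last exact: P_Bb.
    pose phi r := P S (tpos r) g x.
    rewrite [X in X - _](_ : _ = \int[uniform_prob t_gt0]_r phi (r + s)); last first.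
      rewrite [LHS](bint_uniform t_gt0); last first.
        by apply: (P_pairing_bmeas HS HC md metr); exact: P_Bb.
      rewrite [RHS](bint_uniform t_gt0); last first.
        apply: (@bmeas_of _ _ _ _ N) => [|r]; last exact: (kop_bound _ _ bg gN).
        apply: continuous_measurable_fun => r.
        apply: (@continuous_comp _ _ _ (fun r : R => r + s) phi).
          by apply: cvgD; [exact: cvg_id|exact: cvg_cst].
        exact: P_tpos_continuous.
      congr (_ * _); apply: eq_Rintegral => r; rewrite inE/= in_itv/= => /andP[r0 _].
      rewrite pairing_dirac; last by do 2 apply: P_Bb.
      by rewrite /phi !tposE ?addr_ge0// addrC (P_semigroup HS).
    rewrite [X in _ - X](_ : _ = \int[uniform_prob t_gt0]_r phi r); last first.
      by apply: eq_Rintegral => r _; rewrite pairing_dirac//; exact: P_Bb.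
    have phiN r : `|phi r| <= N by exact: (kop_bound _ _ bg gN).
    have cphi : continuous phi by exact: P_tpos_continuous.
    apply: (le_trans (uniform_shift t_gt0 cphi phiN s0)).
    by rewrite mulrC ler_pdivrMr// [leRHS]mulrC -ler_pdivrMr.
  by rewrite -(cvg_lim _ h3)// -(cvg_lim _ h4).
have [mS Hadd _] := HS.
have inv s : t0 <= s -> charge_eq (S s nu) nu.
  move=> t0s; have s0 : 0 <= s by rewrite (le_trans _ t0s)// ltW.
  apply: (Cb_charge_eq md metr) => g cg.
  by rewrite (P_pairing HS)//; [exact: nuinv|exact: continuous_bmeas].
exists nu; last first.
  have := munu f cf.
  have : pairing (average S t (dirac_charge R x)) f @[t --> +oo] --> f x.
    apply: cvg_near_cst; near=> t.
    have t_gt0 : 0 < t by near: t; apply: nbhs_pinfty_gt; exact: num_real.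
    rewrite (average_pairing HS HC md metr t_gt0)//.
    have -> : (fun s => pairing (dirac_charge R x) (P S (tpos s) f)) = fun=> f x.
      apply/funext => s; rewrite pairing_dirac; last exact: P_Bb.
      by have := Pf (tpos s) (tpos_ge0 s) => /(congr1 (fun h => h x)).
    rewrite bint_cst [X in fine X](_ : _ = 1%E); last exact: probability_setT.
    by rewrite mulr1.
  by move=> h1 h2; rewrite -(cvg_lim _ h2)// (cvg_lim _ h1).
(* For an arbitrary [s], replace [nu] by [S t0 nu]: then [S s nu] is [S (s + t0) nu], which is
   [nu]. *)
move=> s s0.
have t00 := ltW t0_gt0.
have [[ceq _ _ _] _] := mS s s0.
apply: (charge_eq_trans (ceq _ _ (charge_eq_sym (inv _ (lexx t0))))).
apply: (charge_eq_trans (charge_eq_sym (Hadd s t0 nu s0 t00))).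
by apply: inv; rewrite lerDr.
Unshelve. all: by end_near. Qed.

End easy_implications.

(** * Total boundedness of dominated kernels *)

Section totally_bounded_kernels.
Context d d' (X : measurableType d) (Y : measurableType d') (R : realType).
Variables (mu : {measure set X -> \bar R}) (m : {measure set Y -> \bar R}).
Hypotheses (fmu : (mu setT < +oo)%E) (fm : (m setT < +oo)%E).

(** Total boundedness in L1(mu) of the image of the unit ball of bounded functions. The centres of
    the net are arbitrary bounded measurable functions. *)
Definition totally_bounded (A : (Y -> R) -> X -> R) : Prop :=
  forall e : R, 0 < e -> exists (I : finType) (g : I -> X -> R),
    (forall i, bmeas (g i)) /\
    forall f, bmeas f -> (forall y, `|f y| <= 1) ->
      exists i, \int[mu]_x `|A f x - g i x| <= e.

Definition integral_operator (q : X * Y -> R) (f : Y -> R) (x : X) : R :=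
  \int[m]_y (q (x, y) * f y).

Lemma integral_operator_bmeas q f : bmeas q -> bmeas f ->
  bmeas (integral_operator q f).
Proof.
move=> bq bf; apply: (bmeas_bint2 fmu fm (f := fun z => q z * f z.2)).
apply: bmeasM => //; have /bmeasP[mf [N fN]] := bf.
apply: (@bmeas_of _ _ _ _ N) => [|z]; last exact: fN.
by apply: measurableT_comp.
Qed.

Lemma totally_bounded_approx (A : (Y -> R) -> X -> R) :
  (forall f, bmeas f -> bmeas (A f)) ->
  (forall e : R, 0 < e -> exists2 B : (Y -> R) -> X -> R,
    (forall f, bmeas f -> bmeas (B f)) /\ totally_bounded B &
    forall f, bmeas f -> (forall y, `|f y| <= 1) ->
      \int[mu]_x `|A f x - B f x| <= e) ->
  totally_bounded A.
Proof.
move=> bA H e e0; have e2 : 0 < e / 2 by rewrite divr_gt0.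
have [B [bB tB] AB] := H _ e2; have [I [g [bg Hg]]] := tB _ e2.
exists I, g; split=> // f bf f1; have [i Hi] := Hg f bf f1; exists i.
have bAB := bmeas_abs (bmeasB (bA f bf) (bB f bf)).
have bBg := bmeas_abs (bmeasB (bB f bf) (bg i)).
rewrite [leRHS](splitr e) (le_trans _ (lerD (AB f bf f1) Hi))//.
rewrite -(bintD fmu bAB bBg); apply: (le_bint fmu).
- exact: bmeas_abs (bmeasB (bA f bf) (bg i)).
- exact: bmeasD.
- by move=> x; exact: ler_distD.
Qed.

(** The image consists of the multiples [c * \1_A] with [|c| <= K], a bounded piece of a line. *)
Lemma totally_bounded_rectangle A B : measurable A -> measurable B ->
  totally_bounded (integral_operator (\1_(A `*` B))).
Proof.
move=> mA mB e e0.
pose K := fine (m setT); have K0 : 0 <= K by rewrite fine_ge0.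
pose L := fine (mu setT); have L0 : 0 <= L by rewrite fine_ge0.
(* Mesh of the net, chosen so that [del * L <= e]. As [c] lies between [- K] and [K], the truncation
   of [(c + K) / del] takes at most [n] values. *)
pose del := e / (L + 1); have del0 : 0 < del by rewrite divr_gt0// ltr_wpDl.
pose n := (Num.truncn (2 * K / del)).+1.
pose g (i : 'I_n) x := (i%:R * del - K) * (\1_A x : R).
exists 'I_n, g; split; first by move=> i; apply: bmeasZ; exact: bmeas_indic.
move=> f bf f1; pose c := \int[m]_y (\1_B y * f y).
have bBf : bmeas (fun y => \1_B y * f y) by apply: bmeasM => //; exact: bmeas_indic.
have cK : `|c| <= K.
  rewrite -[leRHS]mul1r; apply: (bint_bound fm bBf) => y.
  rewrite normrM; have := f1 y; have := normr_ge0 (f y).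
  by rewrite indicE; case: (_ \in _); rewrite ?normr1 ?normr0 ?mul1r ?mul0r.
have E x : integral_operator (\1_(A `*` B)) f x = c * \1_A x.
  rewrite mulrC -bintZ//; apply: eq_Rintegral => y _.
  by rewrite mulrA !indicE in_setX /= -natrM mulnb.
move: cK; rewrite ler_norml => /andP[c1 c2].
have cK0 : 0 <= c + K by lra.
have i_lt : (Num.truncn ((c + K) / del) < n)%N.
  rewrite ltnS; apply: le_truncn; rewrite ler_pM2r ?invr_gt0//; lra.
exists (Ordinal i_lt).
have /truncn_itv : 0 <= (c + K) / del by rewrite divr_ge0// ltW.
rewrite /g /=; set j := Num.truncn _.
rewrite ler_pdivlMr// ltr_pdivrMr// => /andP[j1 j2].
have bI : bmeas (\1_A : X -> R) by exact: bmeas_indic.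
rewrite (@eq_Rintegral _ _ _ _ _ (fun x => `|c - (j%:R * del - K)| * \1_A x)); last first.
  move=> x _; rewrite E -mulrBl normrM; congr (_ * _).
  by rewrite ger0_norm// indicE.
rewrite (bintZ fmu _ bI) bint_indic//.
have AL : fine (mu A) <= L.
  apply: fine_le; [exact: (fin_measure fmu mA)|
    exact: (fin_measure fmu measurableT)|].
  by apply: le_measure; rewrite ?inE.
have h : `|c - (j%:R * del - K)| <= del.
  rewrite ger0_norm; last by lra.
  by move: j2; rewrite -natr1 mulrDl mul1r; lra.
have A0 : 0 <= fine (mu A) by rewrite fine_ge0.
rewrite (le_trans (ler_pM (normr_ge0 _) A0 h AL))//.
rewrite /del mulrAC ler_pdivrMr ?ltr_wpDl// mulrDr mulr1 lerDl ltW//.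
Qed.

(** Monotone class induction on the kernel function, starting from rectangles. For bounded limits,
    the L1 distance of two kernel functions for the product measure bounds the L1 distance of their
    operators uniformly on the unit ball. *)
Lemma totally_bounded_integral_operator q : bmeas q ->
  totally_bounded (integral_operator q).
Proof.
pose G := [set A `*` B | A in @measurable _ X & B in @measurable _ Y].
have GI : setI_closed G.
  move=> _ _ [A mA [B mB <-]] [A' mA' [B' mB' <-]].
  exists (A `&` A'); first exact: measurableI.
  by exists (B `&` B'); [exact: measurableI|rewrite setXI].
have bop r : bmeas r -> forall f, bmeas f -> bmeas (integral_operator r f).
  by move=> br f bf; exact: integral_operator_bmeas.
have bsec (r : X * Y -> R) (f : Y -> R) (x : X) : bmeas r -> bmeas f -> bmeas (fun y => r (x, y) * f y).
  by move=> br bf; exact: (bmeasM (bmeas_section x br) bf).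
apply: (@bmeas_ind _ (X * Y)%type R G
  (fun q => totally_bounded (integral_operator q))
  (measurable_prod_measurableType _ _) GI).
- have := totally_bounded_rectangle measurableT measurableT.
  by rewrite setXTT indicT.
- by move=> _ [A mA [B mB <-]]; exact: totally_bounded_rectangle.
- move=> a r s br bs tr ts e e0.
  have ea : 0 < e / 2 / (`|a| + 1) by rewrite !divr_gt0// ltr_wpDl.
  have e2 : 0 < e / 2 by rewrite divr_gt0.
  have [I [g [bg Hg]]] := tr _ ea; have [J [h [bh Hh]]] := ts _ e2.
  exists (I * J)%type, (fun k x => a * g k.1 x + h k.2 x); split.
    by move=> k; apply: bmeasD => //; exact: bmeasZ.
  move=> f bf f1; have [i Hi] := Hg f bf f1; have [j Hj] := Hh f bf f1.
  exists (i, j) => /=.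
  have E x : integral_operator (fun z => a * r z + s z) f x =
      a * integral_operator r f x + integral_operator s f x.
    rewrite /integral_operator -(bintZ fm a (bsec r f x br bf)).
    rewrite -(bintD fm (bmeasZ a (bsec r f x br bf)) (bsec s f x bs bf)).
    by apply: eq_Rintegral => y _; ring.
  have b1 := bmeas_abs (bmeasB (bop r br f bf) (bg i)).
  have b2 := bmeas_abs (bmeasB (bop s bs f bf) (bh j)).
  apply: (@le_trans _ _ (\int[mu]_x (`|a| * `|integral_operator r f x - g i x| +
      `|integral_operator s f x - h j x|))).
    apply: (le_bint fmu).
    - under eq_fun do rewrite E.
      apply: bmeas_abs; apply: bmeasB; apply: bmeasD; try exact: bop; try exact: bh.
        by apply: bmeasZ; exact: bop.
      by apply: bmeasZ; exact: bg.
    - by apply: bmeasD => //; exact: bmeasZ.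
    - move=> x; rewrite E -normrM (le_trans _ (ler_normD _ _))//.
      by rewrite le_eqVlt; apply/orP; left; apply/eqP; congr `|_|; ring.
  rewrite (bintD fmu (bmeasZ _ b1) b2) (bintZ fmu _ b1) [leRHS](splitr e) lerD//.
  rewrite (le_trans (ler_wpM2l (normr_ge0 a) Hi))//.
  by rewrite mulrA ler_pdivrMr ?ltr_wpDl// mulrC mulrDr mulr1 lerDl ltW.
- move=> r_ r N br tr rN rr; have bR := bmeas_lim br rN rr.
  apply: totally_bounded_approx => [|e e0]; first exact: bop.
  pose rho := kjoint mu (kconst (X := X) fm).
  have frho : (rho setT < +oo)%E by exact: kjoint_fin.
  have bD n : bmeas (fun z => `|r_ n z - r z|).
    by apply: bmeas_abs; exact: bmeasB.
  have N2 n z : `| `|r_ n z - r z| | <= N + N.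
    rewrite normr_id (le_trans (ler_normB _ _))// lerD//.
    have h : `|r_ k z| @[k --> \oo] --> `|r z| by apply: cvg_norm; exact: rr.
    rewrite -(cvg_lim _ h)//; apply: limr_le.
      by apply/cvg_ex; eexists; exact: h.
    by apply: nearW => k; exact: rN.
  have c0 z : `|r_ n z - r z| @[n --> \oo] --> 0.
    rewrite -(normr0 R); apply: cvg_norm; rewrite -(subrr (r z)).
    by apply: cvgB; [exact: rr|exact: cvg_cst].
  have := bounded_cvg_Rintegral frho bD N2 c0.
  rewrite Rintegral_cst// mul0r => /cvgrPdist_le/(_ _ e0)[n _ /(_ n (leqnn n))] /=.
  rewrite sub0r normrN ger0_norm; last by apply: Rintegral_ge0.
  rewrite (kjoint_Rintegral (kconst fm) fmu (bD n)).2 => Hn.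
  exists (integral_operator (r_ n)); first by split; [exact: bop|exact: tr].
  move=> f bf f1; apply: le_trans Hn; apply: (le_bint fmu).
  + by apply: bmeas_abs; apply: bmeasB; exact: bop.
  + exact: (kjoint_Rintegral (kconst fm) fmu (bD n)).1.
  + move=> x; rewrite distrC /integral_operator.
    rewrite -(bintB fm (bsec _ _ x (br n) bf) (bsec _ _ x bR bf)).
    have bB : bmeas (fun y => r_ n (x, y) * f y - r (x, y) * f y).
      by apply: bmeasB; exact: bsec.
    rewrite (le_trans (le_norm_bint fm bB))//; apply: (le_bint fm).
    * exact: bmeas_abs.
    * exact: (bmeas_section x (bD n)).
    * move=> y; rewrite -mulrBl normrM ler_piMr//.
Qed.

Variable k : R.-pker X ~> Y.
Hypothesis dom : forall A, measurable A -> m A = 0%E -> forall x, k x A = 0%E.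

(** Domination gives mu(dx) k(x, dy) a density with respect to the product of [mu] and [m]. Taking
    the density on the product, instead of one for each [x], makes it jointly measurable. *)
Lemma totally_bounded_kernel : totally_bounded (kop k).
Proof.
apply: totally_bounded_approx => [|e e0]; first exact: kop_bmeas.
pose rho := kjoint mu (kconst (X := X) fm).
have frho : (rho setT < +oo)%E by exact: kjoint_fin.
pose K := kjoint mu k.
have fK : (K setT < +oo)%E by exact: kjoint_fin.
(* If [rho D] vanishes, almost every section of [D] is [m]-null, hence null for [k x]. *)
have Krho D : measurable D -> rho D = 0%E -> K D = 0%E.
  move=> mD rho0.
  have mk (l : R.-fker X ~> Y) : measurable_fun setT (fun x => l x (xsection D x)).
    by apply: measurable_fun_xsection_finite_kernel; rewrite inE.
  have : (\int[mu]_x `|m (xsection D x)| = 0)%E.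
    rewrite -[RHS]rho0; apply: eq_integral => x _.
    by rewrite gee0_abs.
  move/(ae_eq_integral_abs mu measurableT (mk (kconst fm))) => h.
  have h' : ae_eq mu setT (fun x => k x (xsection D x)) (cst 0%E).
    apply: filterS h => x /= /(_ Logic.I) mx _.
    by apply: dom => //; exact: measurable_xsection.
  transitivity (\int[mu]_x (cst 0%E x))%E; last by rewrite integral0.
  by apply: ae_eq_integral => //; exact: (mk k).
pose rhof := to_finite frho; pose Kf := to_finite fK.
have Kdom : charge_of_finite_measure Kf `<< rhof.
  by apply/null_content_dominatesP => D mD; exact: Krho.
pose kap := Radon_Nikodym (charge_of_finite_measure Kf) rhof.
have kfin z : kap z \is a fin_num by exact: Radon_Nikodym_fin_num.
have ikap : rho.-integrable setT kap by exact: (Radon_Nikodym_integrable Kdom).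
pose q z := fine (kap z).
have qE z : kap z = (q z)%:E by rewrite fineK.
have iq : rho.-integrable setT (EFin \o q).
  by apply: eq_integrable ikap => // z _; exact: qE.
have mq : measurable_fun setT q by apply/measurable_EFinP; case/integrableP: iq.
(* The density is only known to be integrable; its truncations are bounded and converge to it in
   L1(rho). *)
pose q_ (n : nat) z := Num.max (Num.min (q z) n%:R) (- n%:R).
have q_n n z : `|q_ n z| <= n%:R.
  have n0 : 0 <= n%:R :> R by [].
  by rewrite ler_norml /q_ le_max ge_max lexx orbT /= ge_min lexx orbT /=; lra.
have bq n : bmeas (q_ n).
  apply: (bmeas_of _ (q_n n)); apply: measurable_maxr => //.
  exact: measurable_minr.
have dq n z : `|q z - q_ n z| <= `|q z|.
  rewrite /q_; have n0 : 0 <= n%:R :> R by [].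
  have [h1|h1] := leP (q z) n%:R.
    have [h2|h2] := leP (q z) (- n%:R); last by rewrite subrr normr0.
    by rewrite !ler0_norm; lra.
  rewrite max_l; last by lra.
  by rewrite !ger0_norm; lra.
have cq z : `|q z - q_ n z| @[n --> \oo] --> 0.
  apply: cvg_near_cst; near=> n.
  have : `|q z| <= n%:R by near: n; exact: nbhs_infty_ger.
  rewrite ler_norml => /andP[h1 h2].
  by rewrite /q_ min_l// max_l// subrr normr0.
have idq n : rho.-integrable setT (EFin \o (fun z => q z - q_ n z)).
  have -> : EFin \o (fun z => q z - q_ n z) = ((EFin \o q) \- (EFin \o q_ n))%E.
    by [].
  by apply: integrableB => //; exact: bmeas_integrable.
have [n Hn] : exists n, \int[rho]_z `|q z - q_ n z| <= e.
  have [] := @dominated_convergence _ _ R rho setT measurableT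
    (fun n z => `|q z - q_ n z|%:E) (cst 0%E) (fun z => `|q z|%:E).
  - move=> n; apply/measurable_EFinP; apply: measurableT_comp => //.
    by apply: measurable_funB => //; case: (bq n).
  - exact: measurable_cst.
  - apply: aeW => z _; apply/fine_cvgP; split; first exact: nearW.
    exact: cq.
  - exact: (integrable_abse iq).
  - by apply: aeW => z n _; rewrite /= lee_fin normr_id.
  move=> _ _; rewrite integral_cst// mul0e => /fine_cvg/cvgrPdist_le/(_ _ e0).
  move=> [n _ /(_ n (leqnn n))] /=; rewrite sub0r normrN => h; exists n.
  exact: le_trans (ler_norm _) h.
exists (integral_operator (q_ n)).
  split; first by move=> f bf; exact: integral_operator_bmeas.
  exact: totally_bounded_integral_operator.
move=> f bf f1; apply: le_trans Hn.
pose D x := kop k f x - integral_operator (q_ n) f x.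
have bD : bmeas D.
  by apply: bmeasB; [exact: kop_bmeas|exact: integral_operator_bmeas].
(* With the sign of [D], the L1 norm becomes the integral of [psi z = s z.1 * f z.2] against a
   difference of densities, to which the Radon-Nikodym change of variables applies. *)
pose s x : R := if 0 <= D x then 1 else -1.
have bs : bmeas s.
  apply: (@bmeas_of _ _ _ _ 1) => [|x].
    apply: measurable_fun_ifT => //.
    by apply: measurable_fun_ler => //; case: bD.
  by rewrite /s; case: ifP; rewrite ?normrN normr1.
have sD x : `|D x| = s x * D x.
  rewrite /s; case: ifPn => h; first by rewrite mul1r ger0_norm.
  by rewrite mulN1r ltr0_norm// ltNge.
have b1 : bmeas (fun z : X * Y => s z.1).
  have /bmeasP[ms [N sN]] := bs; apply: (@bmeas_of _ _ _ _ N) => [|z]; last exact: sN.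
  exact: measurableT_comp.
have b2 : bmeas (fun z : X * Y => f z.2).
  have /bmeasP[mf [N fN]] := bf; apply: (@bmeas_of _ _ _ _ N) => [|z]; last exact: fN.
  exact: measurableT_comp.
pose psi (z : X * Y) := s z.1 * f z.2.
have bpsi : bmeas psi by exact: bmeasM.
have psi1 z : `|psi z| <= 1.
  rewrite normrM mulr_ile1//.
  by rewrite /s; case: ifP; rewrite ?normrN normr1.
have ipsiq : rho.-integrable setT (EFin \o (fun z => psi z * q z)).
  apply: (le_integrable measurableT _ _ iq).
    by apply/measurable_EFinP; apply: measurable_funM => //; case: bpsi.
  by move=> z _; rewrite /= lee_fin normrM ler_piMl.
have bpq := bmeasM bpsi (bq n).
have E1 : \int[mu]_x (s x * kop k f x) = \int[rho]_z (psi z * q z).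
  have -> : \int[mu]_x (s x * kop k f x) = \int[K]_z psi z.
    rewrite (kjoint_Rintegral k fmu bpsi).2; apply: eq_Rintegral => x _.
    by rewrite -kopZ.
  have iK : Kf.-integrable setT (EFin \o psi) by exact: (bmeas_integrable fK).
  have := Radon_Nikodym_change_of_variables Kdom measurableT iK.
  rewrite /Rintegral => H; congr fine; transitivity (\int[Kf]_z (EFin \o psi) z)%E => //.
  rewrite -H; apply: eq_integral => z _.
  by rewrite -/kap qE -EFinM.
have E2 : \int[mu]_x (s x * integral_operator (q_ n) f x) =
    \int[rho]_z (psi z * q_ n z).
  rewrite (kjoint_Rintegral (kconst fm) fmu bpq).2; apply: eq_Rintegral => x _.
  have bqf : bmeas (fun y => q_ n (x, y) * f y).
    by apply: bmeasM => //; exact: bmeas_section.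
  rewrite /integral_operator -(bintZ fm _ bqf); apply: eq_Rintegral => y _.
  by rewrite /psi /=; ring.
have -> : \int[mu]_x `|D x| = \int[rho]_z (psi z * (q z - q_ n z)).
  under eq_Rintegral do rewrite sD mulrBr.
  rewrite bintB//; [|by apply: bmeasM => //; exact: kop_bmeas
    |by apply: bmeasM => //; exact: integral_operator_bmeas].
  rewrite E1 E2 -RintegralB//; last exact: (bmeas_integrable frho).
  by apply: eq_Rintegral => z _; rewrite mulrBr.
have ipd : rho.-integrable setT (EFin \o (fun z => psi z * (q z - q_ n z))).
  apply: (le_integrable measurableT _ _ (idq n)).
    apply/measurable_EFinP; apply: measurable_funM; first by case: bpsi.
    by apply: measurable_funB => //; case: (bq n).
  by move=> z _; rewrite /= lee_fin normrM ler_piMl.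
rewrite (le_trans (ler_norm _))// (le_trans (le_normr_Rintegral _ ipd))//.
apply: le_Rintegral => //.
- exact: (integrable_norm ipd).
- exact: (integrable_norm (idq n)).
- by move=> z _; rewrite normrM ler_piMl.
Unshelve. all: by end_near. Qed.

End totally_bounded_kernels.

(** * Invariant measures *)

Section weighted_sum.
Context d (T : measurableType d) (R : realType).
Variable nu : nat -> {measure set T -> \bar R}.
Hypothesis fnu : forall n, (nu n setT < +oo)%E.

(** Dividing by 1 plus the mass keeps the n-th term below 2^-(n+1). The absolute value packages a
    positive number as a [{nonneg R}]. *)
Let weight n : {nonneg R} :=
  (`|2 ^- n.+1 / (1 + fine (nu n setT))|)%:nng.

Let weight_gt0 n : 0 < (weight n)%:num.
Proof.
by rewrite /= normr_gt0 gt_eqF// divr_gt0// ltr_pwDl// fine_ge0.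
Qed.

Definition weighted_sum : {measure set T -> \bar R} :=
  mseries (fun n => mscale (weight n) (nu n)) 0.

Lemma weighted_sum_fin : (weighted_sum setT < +oo)%E.
Proof.
apply: (@le_lt_trans _ _ (\sum_(0 <= n <oo) (1 / (2 ^ n.+1)%:R)%:E)%E); last first.
  exact: (le_lt_trans (epsilon_trick0 _ ler01) (ltry _)).
apply: lee_nneseries => n //= _.
rewrite /mscale/= -[nu n setT]fineK; last exact: (fin_measure (fnu n)).
set c := fine _; have c0 : 0 <= c by rewrite fine_ge0.
rewrite -EFinM lee_fin ger0_norm; last by rewrite divr_ge0// addr_ge0.
rewrite natrX div1r -mulrA ler_piMr ?invr_ge0//.
by rewrite mulrC ler_pdivrMr ?ltr_pwDl// mul1r lerDr.
Qed.

Lemma weighted_sum_gt0 n A : (0 < nu n A)%E -> (0 < weighted_sum A)%E.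
Proof.
move=> nuA; apply: (@lt_le_trans _ _ (mscale (weight n) (nu n) A)).
  by rewrite /mscale mule_gt0// lte_fin.
apply: le_trans (nneseries_lim_ge n.+1 _) => //.
by rewrite big_nat_recr//= leeDr// sume_ge0.
Qed.

Lemma weighted_sum_eq0 n A : weighted_sum A = 0%E -> nu n A = 0%E.
Proof.
move=> pA; apply/eqP; rewrite eq_le measure_ge0 andbT leNgt; apply/negP.
by move=> /weighted_sum_gt0; rewrite pA ltxx.
Qed.

Lemma kbind_weighted_sum (k : R.-fker T ~> T) A : measurable A ->
  (forall n, kbind (nu n) k A = nu n A) ->
  kbind weighted_sum k A = weighted_sum A.
Proof.
move=> mA H; have mk : measurable_fun setT (k ^~ A) by exact: measurable_kernel.
rewrite /kbind /weighted_sum ge0_integral_measure_series//.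
apply: eq_eseriesr => n _; rewrite ge0_integral_mscale//.
by rewrite /= /mscale; congr (_ * _)%E; exact: H.
Qed.

End weighted_sum.

Section invariant_measures.
Context (R : realType) (Omega : ptopologicalType).
Local Notation M := (signed_measure R Omega).
Variable S : R -> M -> M.
Hypotheses (HS : markovian_semigroup S).
Local Notation K t := (kernel_of (S t)).
Local Notation meas := {measure set (borel Omega) -> \bar R}.
Implicit Types (nu pi m : meas) (f : Omega -> R) (A : set (borel Omega)).

Definition invariant_measure nu : Prop := (nu setT < +oo)%E /\
  forall t A, 0 <= t -> measurable A -> kbind nu (K t) A = nu A.

Lemma invariant_bint nu t f : invariant_measure nu -> 0 <= t -> Bb f ->
  \int[nu]_x P S t f x = \int[nu]_x f x.
Proof.
move=> [fnu inu] t0 bf; rewrite /P -(kbind_Rintegral (K t) fnu bf).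
congr fine; apply: eq_measure_integral => A mA _; exact: inu.
Qed.

(** The inequality for the complement of [A] and the conservation of the total mass give the reverse
    inequality for [A]. *)
Let sub_invariant nu t : (nu setT < +oo)%E -> 0 <= t ->
  (forall A, measurable A -> fine (nu A) <= \int[nu]_x P S t (\1_A) x) ->
  forall A, measurable A -> kbind nu (K t) A = nu A.
Proof.
move=> fnu t0 H A mA.
have bA := bmeas_indic R mA; have bAc := bmeas_indic R (measurableC mA).
have fk := kbind_fin (K t) fnu.
suff E : fine (kbind nu (K t) A) = fine (nu A).
  rewrite -[LHS]fineK; last exact: (fin_measure fk mA).
  by rewrite E fineK//; exact: (fin_measure fnu mA).
rewrite -(bint_indic (kbind nu (K t)) mA) (kbind_Rintegral (K t) fnu bA).
apply/eqP; rewrite eq_le H// andbT.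
have : \int[nu]_x P S t (\1_A) x + \int[nu]_x P S t (\1_(~` A)) x =
    fine (nu A) + fine (nu (~` A)).
  rewrite -(bintD fnu (P_Bb S t bA) (P_Bb S t bAc)) -!bint_indic//; last exact: measurableC.
  rewrite -(bintD fnu bA bAc).
  have E1 x : \1_A x + \1_(~` A) x = 1 :> R.
    by rewrite !indicE in_setC; case: (x \in A) => /=; rewrite ?addr0 ?add0r.
  under [RHS]eq_Rintegral do rewrite E1.
  apply: eq_Rintegral => x _; rewrite /P -kopD//.
  under [X in kop _ X]funext do rewrite E1.
  by rewrite kop_cst.
move=> sumE; rewrite -(lerD2r (fine (nu (~` A)))) -sumE.
by rewrite lerD2l; exact: H (measurableC mA).
Qed.

(** On a Hahn set, the positive part of [mu] at [A] is the value of [mu], hence of [S t mu], at a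
    subset of [A], which is at most the integral of [P S t (\1_A)] against the positive part. The
    positive part is thus sub-invariant, hence invariant; likewise for the negative one. *)
Lemma fix_invariant (mu : M) : fix_semigroup S mu ->
  invariant_measure (positive_part mu) /\ invariant_measure (negative_part mu).
Proof.
move=> Smu; have fp := positive_part_fin mu; have fn := negative_part_fin mu.
have key t A B : 0 <= t -> measurable A -> measurable B -> A `<=` B ->
    fine (mu A) <= \int[positive_part mu]_x P S t (\1_B) x /\
    - fine (mu A) <= \int[negative_part mu]_x P S t (\1_B) x.
  move=> t0 mA mB AB.
  have bA := P_Bb S t (bmeas_indic R mA); have bB := P_Bb S t (bmeas_indic R mB).
  have AB' x : 0 <= P S t (\1_A) x <= P S t (\1_B) x.
    apply/andP; split.
      rewrite -(kop_cst (K t) 0 x); apply: kop_le.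
      - exact: bmeas_cst.
      - exact: bmeas_indic.
      - by move=> y; rewrite indicE.
    apply: kop_le; [exact: bmeas_indic|exact: bmeas_indic|move=> y].
    rewrite !indicE ler_nat; have [yA|//] := boolP (y \in A).
    by rewrite mem_set//; apply: AB; exact: set_mem.
  have E : fine (mu A) = \int[positive_part mu]_x P S t (\1_A) x -
      \int[negative_part mu]_x P S t (\1_A) x.
    by rewrite -(Smu t t0 A mA) -pairing_indic// (P_pairing HS)//; exact: bmeas_indic.
  have lep : \int[positive_part mu]_x P S t (\1_A) x <=
      \int[positive_part mu]_x P S t (\1_B) x.
    by apply: (le_bint fp bA bB) => x; have /andP[] := AB' x.
  have len : \int[negative_part mu]_x P S t (\1_A) x <=
      \int[negative_part mu]_x P S t (\1_B) x.
    by apply: (le_bint fn bA bB) => x; have /andP[] := AB' x.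
  have p0 : 0 <= \int[positive_part mu]_x P S t (\1_A) x.
    by apply: Rintegral_ge0 => x _; have /andP[] := AB' x.
  have n0 : 0 <= \int[negative_part mu]_x P S t (\1_A) x.
    by apply: Rintegral_ge0 => x _; have /andP[] := AB' x.
  rewrite E opprB; split.
    rewrite lerBlDr -[leLHS]addr0; exact: (lerD lep n0).
  rewrite lerBlDr -[leLHS]addr0; exact: (lerD len p0).
have [mP mN] : measurable (sval (hahn_sig mu)).1 /\
    measurable (sval (hahn_sig mu)).2.
  by have [[mP _] [mN _] _ _] := svalP (hahn_sig mu).
have PE A : measurable A ->
    positive_part mu A = mu (A `&` (sval (hahn_sig mu)).1).
  move=> mA; transitivity (jordan_pos (svalP (hahn_sig mu)) A) => //.
  by rewrite jordan_posE cjordan_posE /crestr0 mem_set.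
have NE A : measurable A ->
    negative_part mu A = (- mu (A `&` (sval (hahn_sig mu)).2))%E.
  move=> mA; transitivity (jordan_neg (svalP (hahn_sig mu)) A) => //.
  by rewrite jordan_negE cjordan_negE /crestr0 mem_set.
split; (split; [by []|move=> t A t0 mA; apply: sub_invariant => // {}A {}mA]).
- by rewrite PE//; apply: (key _ _ _ t0 _ _ _).1 => //; exact: measurableI.
- rewrite NE// fineN; apply: (key _ _ _ t0 _ _ _).2 => //; exact: measurableI.
Qed.

Hypothesis HC : stochastically_continuous S.
Variable d : Omega -> Omega -> R.
Hypotheses (md : is_metric d) (metr : metrizes d).
Variable D : set Omega.
Hypotheses (cD : countable D) (dD : dense D).
Variable t0 : R.
Hypotheses (t0_gt0 : 0 < t0) (SF : strong_feller (S t0)).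

Let t00 : 0 <= t0 := ltW t0_gt0.

Let Pt0_Cb f : Bb f -> Cb (P S t0 f).
Proof. by move=> bf; apply: SF. Qed.

(* A strong Feller kernel has all its values absolutely continuous with respect
   to a single measure, as [P S t0 (\1_A)] vanishes as soon as it vanishes on a
   dense sequence. *)
Lemma dominating_measure : exists m, (m setT < +oo)%E /\
  forall A, measurable A -> m A = 0%E -> forall x, K t0 x A = 0%E.
Proof.
have D0 : D !=set0.
  by have [x [_ Dx]] := dD (ex_intro _ point Logic.I) openT; exists x.
have [D0'|[g]] := pfcard_geP cD; first by move: D0; rewrite D0' => -[].
exists (weighted_sum (fun n => K t0 (g n))); split.
  by apply: weighted_sum_fin => n; exact: fker_fin.
move=> A mA mA0; have [cP _] := Pt0_Cb (bmeas_indic R mA).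
have Pg n : P S t0 (\1_A) (g n) = 0.
  by rewrite /P kop_indic// (weighted_sum_eq0 n mA0).
move=> x; suff Px : P S t0 (\1_A) x = 0.
  rewrite -[LHS]fineK; last exact: (fin_measure (fker_fin (K t0) x)).
  by rewrite -kop_indic//; congr EFin.
apply/eqP; rewrite -[_ == _]negbK; apply/negP => Px.
have oW : open (P S t0 (\1_A) @^-1` [set r : R | r != 0]).
  apply: open_comp; first by move=> y _; exact: cP.
  exact: open_neq.
have [] := dD _ oW; first by exists x.
move=> y [/= Py Dy]; have [n _ ny] := surj (f := g) Dy.
by move: Py; rewrite -ny Pg eqxx.
Qed.

(* An invariant measure is null on [A] if and only if it is null on the open set
   where [P S t0 (\1_A)] does not vanish: one invariant measure for each set of
   a countable base is enough. *)
Lemma maximal_invariant : exists pi, invariant_measure pi /\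
  forall nu, invariant_measure nu -> forall A, measurable A -> pi A = 0%E -> nu A = 0%E.
Proof.
have [B [oB HB]] := dense_countable_base md metr cD dD.
have mB n : measurable (B n : set (borel Omega)) by apply: sub_sigma_algebra; exact: oB.
have /choice[nu Hnu] : forall n, exists nu, invariant_measure nu /\
    forall nu', invariant_measure nu' -> (0 < nu' (B n))%E -> (0 < nu (B n))%E.
  move=> n; have [[nu [inu nuB]]|H] := pselect (exists nu, invariant_measure nu /\ (0 < nu (B n))%E).
    by exists nu.
  (* No invariant measure charges [B n]: the zero measure serves as default. *)
  exists (mzero : meas); split; last by move=> nu' inu' h; exfalso; apply: H; exists nu'.
  split; first by rewrite /= /mzero ltry.
  by move=> t A _ _; rewrite /kbind integral_measure_zero.
have fnu n : (nu n setT < +oo)%E by have [[]] := Hnu n.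
exists (weighted_sum nu); split.
  split; first exact: weighted_sum_fin.
  move=> t A t_ge0 mA; apply: kbind_weighted_sum => // n.
  by have [[_ +] _] := Hnu n; apply.
move=> nu' inu' A mA pA0.
have [fnu' _] := inu'.
have bA := bmeas_indic R mA.
pose f := P S t0 (\1_A); have [cf _] := Pt0_Cb bA.
have bf : Bb f by exact: P_Bb.
have f0 x : 0 <= f x by apply: Rintegral_ge0 => y _; rewrite indicE.
pose W := f @^-1` [set r : R | r != 0].
have oW : open W by apply: open_comp; [move=> y _; exact: cf|exact: open_neq].
have mW : measurable (W : set (borel Omega)) by exact: sub_sigma_algebra.
have invpi : invariant_measure (weighted_sum nu).
  split; first exact: weighted_sum_fin.
  move=> t C t_ge0 mC; apply: kbind_weighted_sum => // n.
  by have [[_ +] _] := Hnu n; apply.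
have piW : weighted_sum nu W = 0%E.
  have : \int[weighted_sum nu]_x f x = 0.
    by rewrite (invariant_bint invpi t00 bA) bint_indic// pA0.
  move=> /(bint_eq0 (weighted_sum_fin fnu) bf f0) [N [mN N0 WN]].
  apply/eqP; rewrite eq_le measure_ge0 andbT -N0; apply: le_measure; rewrite ?inE//.
  by move=> x /= /eqP fx; apply: WN.
have nuW : nu' W = 0%E.
  apply: (measure_negligible mW).
  (* [W] is covered by the base sets it contains. One of them charged by [nu'] would be charged by
     the chosen [nu n], hence by the weighted sum, which vanishes on [W]. *)
  apply: (@negligibleS _ _ _ nu' (\bigcup_n (if `[< B n `<=` W >] then B n else set0))).
    move=> x Wx; have [n [Bx BW]] := HB W x oW Wx.
    by exists n => //; rewrite asboolT.
  apply: negligible_bigcup => n; case: asboolP => [BW|_]; last exact: negligible_set0.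
  apply/(negligibleP _ (mB n)); apply/eqP.
  rewrite eq_le measure_ge0 andbT leNgt; apply/negP => nuB.
  have := weighted_sum_gt0 ((Hnu n).2 _ inu' nuB).
  rewrite ltNge => /negP; apply; rewrite -piW; apply: le_measure => //; rewrite inE//.
have : \int[nu']_x f x = 0.
  transitivity (\int[nu']_x (0 : R)); last by rewrite Rintegral_cst// mul0r.
  apply: (ae_eq_bint bf (bmeas_cst _ 0)).
  exists W; split => // x /= /eqP fx; exact: fx.
rewrite (invariant_bint inu' t00 bA) bint_indic// => h.
by rewrite -[LHS]fineK ?h//; exact: (fin_measure fnu' mA).
Qed.

(** [N] is the zero set of the density of [pi] with respect to [m]: off [N] the density is positive,
    so [pi]-null sets are [m]-null there. *)
Lemma singular_set pi m : (pi setT < +oo)%E -> (m setT < +oo)%E ->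
  (forall A, measurable A -> m A = 0%E -> pi A = 0%E) ->
  exists N : set (borel Omega), [/\ measurable N, pi N = 0%E &
    forall A, measurable A -> pi A = 0%E -> m (A `\` N) = 0%E].
Proof.
move=> fpi fm pim.
have dom : to_finite fpi `<< to_finite fm by apply/null_content_dominatesP.
have [h [h0 ih piE]] := radon_nikodym_finite dom.
have mh : measurable_fun setT h by case/integrableP: ih.
have mN : measurable [set x | h x = 0%E].
  have := mh measurableT [set 0%E] (emeasurable_set1 _); rewrite setTI.
  by congr measurable; apply/seteqP; split.
exists [set x | h x = 0%E]; split => //.
  rewrite [LHS](piE _ mN) integral0_eq// => x; by [].
move=> A mA piA0; have mAN := measurableD mA mN.
have : (pi (A `\` [set x | h x = 0%E]) = 0)%E.
  apply/eqP; rewrite eq_le measure_ge0 andbT -[leRHS]piA0.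
  by apply: le_measure; [exact: mem_set|exact: mem_set|exact: subDsetl].
rewrite [X in X = _](piE _ mAN) => I0.
have /(ae_eq_integral_abs _ mAN) : (\int[m]_(x in A `\` [set x | h x = 0]) `|h x| = 0)%E.
  rewrite -[RHS]I0; apply: eq_integral => x _; by rewrite gee0_abs.
have mhA : measurable_fun (A `\` [set x | h x = 0%E]) h by exact: measurable_funTS.
move=> /(_ mhA) [Z [mZ Z0 ZA]].
apply/eqP; rewrite eq_le measure_ge0 andbT -[leRHS]Z0.
apply: le_measure; [exact: mem_set|exact: mem_set|].
by move=> x [Ax hx]; apply: ZA => /= /(_ (conj Ax hx)).
Qed.

(** The monotonicity rests on [f = P S s (\1_N)] having integral 0 for [pi]: the set [A] where it
    does not vanish is [pi]-null, so [f] is at most [\1_N + \1_(A \ N)], and [P t] kills the second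
    term for [t0 <= t]. *)
Lemma transient_part pi N : fix_separates S -> invariant_measure pi ->
  (forall nu, invariant_measure nu -> forall A, measurable A -> pi A = 0%E -> nu A = 0%E) ->
  measurable N -> pi N = 0%E ->
  (forall A, measurable A -> pi A = 0%E -> forall x, K t0 x (A `\` N) = 0%E) ->
  forall x, P S (n.+1%:R * t0) (\1_N) x @[n --> \oo] --> 0.
Proof.
move=> sep invpi maxpi mN piN0 KN.
have [fpi _] := invpi.
have bN := bmeas_indic R mN.
have P1 t A x : measurable A -> 0 <= P S t (\1_A) x <= 1.
  move=> mA; apply/andP; split; first by apply: Rintegral_ge0 => y _; rewrite indicE.
  rewrite -(kop_cst (K t) 1 x); apply: kop_le; [exact: bmeas_indic|exact: bmeas_cst|].
  by move=> y; rewrite indicE; case: (_ \in _).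
have dec s t x : 0 <= s -> t0 <= t -> P S (s + t) (\1_N) x <= P S t (\1_N) x.
  move=> s0 t0t; have t_ge0 : 0 <= t by exact: le_trans t0t.
  pose f := P S s (\1_N); have bf : Bb f by exact: P_Bb.
  pose A := f @^-1` [set r : R | r != 0].
  have mA : measurable (A : set (borel Omega)).
    rewrite -[X in measurable X]setTI; apply: bf.1 => //.
    by apply: open_measurable; exact: open_neq.
  have piA : pi A = 0%E.
    have : \int[pi]_y f y = 0 by rewrite (invariant_bint invpi s0 bN) bint_indic// piN0.
    have f0 y : 0 <= f y by have /andP[] := P1 s N y mN.
    move=> /(bint_eq0 fpi bf f0) [Z [mZ Z0 AZ]].
    apply/eqP; rewrite eq_le measure_ge0 andbT -Z0; apply: le_measure; rewrite ?inE//.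
    by move=> y /= /eqP fy; apply: AZ.
  have mAN := measurableD mA mN; have bAN := bmeas_indic R mAN.
  have PAN y : P S t (\1_(A `\` N)) y = 0.
    rewrite -[t](subrKC t0) (P_semigroup HS) ?subr_ge0//.
    have -> : P S t0 (\1_(A `\` N)) = fun=> 0.
      by apply/funext => z; rewrite /P kop_indic// KN.
    by rewrite /P kop_cst.
  rewrite (P_semigroup HS)// -[leRHS]addr0 -[X in _ <= _ + X](PAN x) /P -kopD//.
  apply: kop_le => //; first exact: bmeasD.
  move=> y; have /andP[fy0 fy1] := P1 s N y mN.
  rewrite -[leLHS]/(f y) !indicE; have [yN|yN] := boolP (y \in N).
    by rewrite (le_trans fy1)// lerDl.
  have [fy|fy] := eqVneq (f y) 0; first by rewrite fy addr_ge0.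
  rewrite mem_set ?add0r//; split=> //.
  by move/mem_set; apply/negP.
(* The index [n.+1] keeps all times above [t0], as [dec] demands. *)
pose u n x := P S (n.+1%:R * t0) (\1_N) x.
have n_t0 n : t0 <= n.+1%:R * t0 by rewrite ler_peMl// ler1n.
have u_dec x : nonincreasing_seq (u ^~ x).
  move=> p q pq; rewrite /u.
  have -> : q.+1%:R * t0 = (q - p)%:R * t0 + p.+1%:R * t0.
    by rewrite -mulrDl -natrD addnS subnK.
  by apply: dec => //; rewrite mulr_ge0.
have u_cvg x : u ^~ x @ \oo --> limn (u ^~ x).
  apply: (nonincreasing_is_cvgn (u_dec x)).
  by exists 0 => _ [n _ <-]; have /andP[] := P1 (n.+1%:R * t0) N x mN.
pose g x := limn (u ^~ x).
have ub n : Bb (u n) by exact: P_Bb.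
have u1 n x : `|u n x| <= 1.
  by have /andP[h1 h2] := P1 (n.+1%:R * t0) N x mN; rewrite ger0_norm.
have bg : Bb g by exact: (bmeas_lim ub u1 u_cvg).
have Pg s : 0 <= s -> P S s g = g.
  move=> s0; apply/funext => x.
  have h1 : P S s (u n) x @[n --> \oo] --> P S s g x by exact: (kop_lim ub u1 u_cvg).
  have h2 : P S s (u n) x @[n --> \oo] --> g x.
    have E n : P S s (u n) x = P S (n.+1%:R * t0 + s) (\1_N) x.
      by rewrite (P_semigroup HS)// mulr_ge0.
    under eq_cvg do rewrite E.
    pose p := (Num.truncn (s / t0)).+1.
    have sp : s <= p%:R * t0 by rewrite -ler_pdivrMr// ltW// truncnS_gt.
    apply: (@squeeze_cvgr _ _ _ _ (fun n => u (n + p)%N x) (fun n => u n x)).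
    - apply: nearW => n; apply/andP; split.
        have -> : u (n + p)%N x = P S ((p%:R * t0 - s) + (n.+1%:R * t0 + s)) (\1_N) x.
          by rewrite /u addrCA subrK -mulrDl -natrD addSn.
        by apply: dec; [rewrite subr_ge0|rewrite (le_trans (n_t0 n))// lerDl].
      by rewrite addrC; exact: dec.
    - have := u_cvg x; rewrite -(cvg_shiftn p); exact.
    - exact: u_cvg.
  exact: (cvg_unique _ h1 h2).
have g0 x : 0 <= g x.
  apply: limr_ge; first by apply/cvg_ex; eexists; exact: u_cvg.
  by apply: nearW => n; have /andP[] := P1 (n.+1%:R * t0) N x mN.
have gfix : fix_adjoint S g.
  split; last by move=> t t_ge0; exact: Pg.
  by rewrite -(Pg t0 t00); exact: Pt0_Cb.
have [gE|gN0] := pselect (g = cst 0).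
  by move=> x; have := u_cvg x; rewrite -/(g x) gE.
have [nu nufix] := sep g gfix gN0.
have [ip im] := fix_invariant nufix.
have I0 la : invariant_measure la -> \int[la]_x g x = 0.
  move=> ila; have [fla _] := ila; apply/eqP; rewrite eq_le; apply/andP; split; last first.
    exact: Rintegral_ge0.
  (* The limit [g] is below [u 0], whose integral against [la] is the mass of [N], a null set for
     every invariant measure by [maxpi]. *)
  have -> : 0 = \int[la]_x P S t0 (\1_N) x.
    by rewrite (invariant_bint ila t00 bN) bint_indic// (maxpi _ ila _ mN piN0).
  apply: (le_bint fla bg (P_Bb S t0 bN)) => x.
  have := nonincreasing_cvgn_ge (u_dec x) (cvgP _ (u_cvg x)) 0.
  by rewrite /u mul1r.
by rewrite /pairing (I0 _ ip) (I0 _ im) subrr.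
Qed.

End invariant_measures.

(** * Convergence in the mean of an invariant measure *)

Lemma ae_forall_rat d (T : measurableType d) (R : realType)
    (mu : {measure set T -> \bar R}) (Q : rat -> T -> Prop) :
  (forall q, {ae mu, forall x, Q q x}) -> {ae mu, forall x, forall q, Q q x}.
Proof.
move=> H; have := ae_foralln (fun n => H (odflt 0 (unpickle n))).
by apply: filterS => x Hx q; have := Hx (pickle q); rewrite pickleK.
Qed.

(** Nearest-point projection onto [-1, 1]: it brings limits and net centres into the unit ball
    without increasing their distance to functions already there. *)
Definition clamp (R : realType) (r : R) : R := Num.max (Num.min r 1) (-1).

Lemma clamp_norm_le1 (R : realType) (r : R) : `|clamp r| <= 1.
Proof.
by rewrite ler_norml /clamp le_max ge_max lexx orbT /= ge_min lexx orbT /=; lra.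
Qed.

Lemma clamp_dist (R : realType) (a b : R) :
  `|a| <= 1 -> `|a - clamp b| <= `|a - b|.
Proof.
rewrite ler_norml => /andP[a1 a2]; rewrite /clamp.
have [h1|h1] := leP b 1.
  have [h2|h2] := leP b (-1); last by [].
  by rewrite !ger0_norm; lra.
rewrite max_l; last by lra.
by rewrite !ler0_norm; lra.
Qed.

Lemma clamp_bmeas d (T : measurableType d) (R : realType) (f : T -> R) :
  measurable_fun setT f -> bmeas (fun x => clamp (f x)).
Proof.
move=> mf; apply: (@bmeas_of _ _ _ _ 1) => [|x]; last exact: clamp_norm_le1.
by apply: measurable_maxr => //; exact: measurable_minr.
Qed.

Section invariant_L1.
Context (R : realType) (Omega : ptopologicalType).
Local Notation M := (signed_measure R Omega).
Variable S : R -> M -> M.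
Hypotheses (HS : markovian_semigroup S) (HC : stochastically_continuous S).
Local Notation K t := (kernel_of (S t)).
Local Notation meas := {measure set (borel Omega) -> \bar R}.
Variable t0 : R.
Hypotheses (t0_gt0 : 0 < t0) (SF : strong_feller (S t0)).
Variable pi : meas.
Hypothesis invpi : invariant_measure S pi.
Implicit Types (f g F : Omega -> R).

Let t00 : 0 <= t0 := ltW t0_gt0.
Let fpi : (pi setT < +oo)%E := invpi.1.

Local Notation norm1 f := (\int[pi]_x `|f x|).

Let PB t f : Bb f -> Bb (P S t f). Proof. exact: P_Bb. Qed.

Let Pbound t f x (N : R) : Bb f -> (forall y, `|f y| <= N) -> `|P S t f x| <= N.
Proof. exact: kop_bound. Qed.

Let norm1_tri f g h : Bb f -> Bb g -> Bb h ->
  norm1 (fun x => f x - h x) <=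
  norm1 (fun x => f x - g x) + norm1 (fun x => g x - h x).
Proof.
move=> bf bg bh.
have b1 := bmeas_abs (bmeasB bf bg); have b2 := bmeas_abs (bmeasB bg bh).
rewrite -(bintD fpi b1 b2); apply: (le_bint fpi).
- exact: (bmeas_abs (bmeasB bf bh)).
- exact: bmeasD.
- by move=> x; exact: ler_distD.
Qed.

Let norm1C f g : norm1 (fun x => f x - g x) = norm1 (fun x => g x - f x).
Proof. by apply: eq_Rintegral => x _; rewrite distrC. Qed.

(** By positivity [|P (f - g)| <= P |f - g|], and [pi] is invariant. *)
Lemma P_contraction t f g : 0 <= t -> Bb f -> Bb g ->
  norm1 (fun x => P S t f x - P S t g x) <= norm1 (fun x => f x - g x).
Proof.
move=> t_ge0 bf bg; have bd := bmeasB bf bg; have ba := bmeas_abs bd.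
rewrite -(invariant_bint invpi t_ge0 ba); apply: (le_bint fpi).
- exact: (bmeas_abs (bmeasB (PB t bf) (PB t bg))).
- exact: PB.
- by move=> x; rewrite /P -kopB//; exact: kop_norm_le.
Qed.

(** The difference of the two sides is the variance of [f] under the transition probability from
    [x]. *)
Lemma P_sqr t f x : Bb f -> P S t f x ^+ 2 <= P S t (fun y => f y ^+ 2) x.
Proof.
move=> bf; set c := P S t f x.
have bf2 : Bb (fun y => f y ^+ 2).
  by under eq_fun do rewrite expr2; exact: bmeasM.
have : 0 <= P S t (fun y => (f y - c) ^+ 2) x.
  by apply: Rintegral_ge0 => y _; exact: sqr_ge0.
have -> : (fun y => (f y - c) ^+ 2) =
    (fun y => (f y ^+ 2 + (- 2 * c) * f y) + c ^+ 2).
  by apply/funext => y; ring.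
have b1 := bmeasZ (- 2 * c) bf; have b2 := bmeas_cst (borel Omega) (c ^+ 2).
rewrite /P (kopD (K t) x (bmeasD bf2 b1) b2) (kopD (K t) x bf2 b1).
rewrite (kopZ (K t) _ x bf) (kop_cst (K t)) -/(P S t f x) -/c => h.
by rewrite -subr_ge0; move: h; congr (_ <= _); rewrite /P; ring.
Qed.

Definition recurrent F : Prop := forall e : R, 0 < e -> forall T : R,
  exists2 r, T <= r & norm1 (fun x => P S r F x - F x) <= e.

(** * Recurrent functions are fixed *)

Section recurrent.
Variable F : Omega -> R.
Hypotheses (bF : Bb F) (F1 : forall x, `|F x| <= 1) (recF : recurrent F).

Let bF2 : Bb (fun y => F y ^+ 2).
Proof. by under eq_fun do rewrite expr2; exact: bmeasM. Qed.

(* The L2(pi)-norm of [P S t F] is nonincreasing and comes back to its initial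
   value, so that the conditional variances vanish. *)
Lemma recurrent_variance t : 0 <= t ->
  {ae pi, forall x : borel Omega, P S t (fun y => F y ^+ 2) x = P S t F x ^+ 2}.
Proof.
move=> t_ge0; pose V r := \int[pi]_x (P S r F x ^+ 2).
have bP2 r : Bb (fun x => P S r F x ^+ 2).
  by under eq_fun do rewrite expr2; apply: bmeasM; exact: PB.
have Vdec r : t <= r -> V r <= V t.
  move=> tr; have rt : 0 <= r - t by rewrite subr_ge0.
  rewrite [leRHS](_ : _ = \int[pi]_x P S (r - t) (fun y => P S t F y ^+ 2) x).
    apply: (le_bint fpi (bP2 r)); first exact: PB.
    move=> x; rewrite -[r in leLHS](subrKC t) (P_semigroup HS)//.
    by apply: P_sqr; exact: PB.
  by rewrite (invariant_bint invpi rt (bP2 t)).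
have VF : \int[pi]_x (F x ^+ 2) <= V t.
  apply/ler_addgt0Pr => e e0; have e2 : 0 < e / 2 by rewrite divr_gt0.
  have [r tr Hr] := recF e2 t.
  apply: (@le_trans _ _ (V r + e)); last by rewrite lerD2r; exact: Vdec.
  have bd := bmeas_abs (bmeasB (PB r bF) bF).
  (* For [|a| <= 1] and [|b| <= 1], [b ^+ 2 - a ^+ 2] is at most [2 * |a - b|]. *)
  apply: (@le_trans _ _ (\int[pi]_x (P S r F x ^+ 2 + 2 * `|P S r F x - F x|))).
    apply: (le_bint fpi bF2 (bmeasD (bP2 r) (bmeasZ 2 bd))).
    move=> x; set a := P S r F x; set b := F x.
    have a1 : `|a| <= 1 by exact: Pbound.
    have b1 : `|b| <= 1 by exact: F1.
    rewrite -lerBlDl -[X in 2 * X]normrN opprB subr_sqr.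
    rewrite (le_trans (ler_norm _))// normrM mulrC ler_wpM2r//.
    by rewrite (le_trans (ler_normD _ _))//; lra.
  rewrite (bintD fpi (bP2 r) (bmeasZ 2 bd)) lerD2l (bintZ fpi 2 bd).
  by rewrite -ler_pdivlMl// mulrC.
have bPF2 := PB t bF2.
have d0 x : 0 <= P S t (fun y => F y ^+ 2) x - P S t F x ^+ 2.
  by rewrite subr_ge0; exact: P_sqr.
have : \int[pi]_x (P S t (fun y => F y ^+ 2) x - P S t F x ^+ 2) = 0.
  apply/eqP; rewrite eq_le Rintegral_ge0// andbT.
  rewrite (bintB fpi bPF2 (bP2 t)) (invariant_bint invpi t_ge0 bF2).
  by rewrite subr_le0.
move=> /(bint_eq0 fpi (bmeasB bPF2 (bP2 t)) d0); apply: filterS => x /eqP.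
by rewrite subr_eq0 => /eqP.
Qed.

Let sup_level (c : R) : set (borel Omega) := [set y | c < F y].

Let sup_level_measurable c : measurable (sup_level c).
Proof.
have := bF.1 measurableT `]c, +oo[%classic (measurable_itv _).
rewrite setTI; congr measurable; apply/seteqP; split => y /=;
  by rewrite in_itv/= andbT.
Qed.

(** Zero variance means that [F] is almost surely equal to its mean [P S t F x] under the transition
    probability from [x], so a superlevel set has mass 0 or 1. *)
Let variance0_level t x c :
  P S t (fun y => F y ^+ 2) x = P S t F x ^+ 2 ->
  P S t (\1_(sup_level c)) x = (nat_of_bool (c < P S t F x)%R)%:R.
Proof.
set a := P S t F x => var0; have fk := fker_fin (K t) x.
have bV : bmeas (fun y : borel Omega => (F y - a) ^+ 2).
  under eq_fun do rewrite expr2; apply: bmeasM;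
  by apply: bmeasB => //; exact: bmeas_cst.
have : \int[K t x]_y ((F y - a) ^+ 2) = 0.
  rewrite -[LHS]/(kop (K t) (fun y => (F y - a) ^+ 2) x).
  have -> : (fun y => (F y - a) ^+ 2) =
      (fun y => (F y ^+ 2 + (- 2 * a) * F y) + a ^+ 2).
    by apply/funext => y; ring.
  have b1 := bmeasZ (- 2 * a) bF; have b2 := bmeas_cst (borel Omega) (a ^+ 2).
  rewrite (kopD (K t) x (bmeasD bF2 b1) b2) (kopD (K t) x bF2 b1).
  rewrite (kopZ (K t) _ x bF) (kop_cst (K t)).
  rewrite -/(P S t F x) -/(P S t (fun y => F y ^+ 2) x) var0 -/a; ring.
move=> /(bint_eq0 fk bV (fun y => sqr_ge0 _)) aeF.
rewrite /P -[RHS](kop_cst (K t) _ x); apply: (ae_eq_bint _ (bmeas_cst _ _)).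
  exact: bmeas_indic.
apply: filterS aeF => y /eqP; rewrite sqrf_eq0 subr_eq0 => /eqP Fy.
rewrite indicE; congr ((nat_of_bool _)%:R); rewrite -Fy.
by apply/idP/idP => [/set_mem|h]; [|exact: mem_set].
Qed.

(* [s |-> P S (t0 + s) (\1_(sup_level c)) x] is continuous by the strong Feller
   property and takes its values in {0, 1}. *)
Let level_constant c : {ae pi, forall x : borel Omega, forall s, 0 <= s ->
  P S (t0 + s) (\1_(sup_level c)) x = P S t0 (\1_(sup_level c)) x}.
Proof.
have bE : Bb (\1_(sup_level c) : Omega -> R) by exact: bmeas_indic.
(* Only rational times, so that a single null set serves for all of them; continuity in time takes
   care of the others. *)
have aeq : {ae pi, forall x : borel Omega, forall q : rat,
    P S (t0 + tpos (ratr q)) (fun y => F y ^+ 2) x =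
    P S (t0 + tpos (ratr q)) F x ^+ 2}.
  apply: ae_forall_rat => q; apply: recurrent_variance.
  by rewrite addr_ge0// tpos_ge0.
apply: filterS aeq => x Hx s s0.
have cG : Cb (P S t0 (\1_(sup_level c))) by apply: SF.
pose phi r := P S (tpos r) (P S t0 (\1_(sup_level c))) x.
have phiE r : 0 <= r -> phi r = P S (t0 + r) (\1_(sup_level c)) x.
  by move=> r0; rewrite /phi tposE// (P_semigroup HS).
have cphi : continuous phi by exact: (P_tpos_continuous HS HC).
have phiq q : 0 <= ratr q :> R -> phi (ratr q) = 0 \/ phi (ratr q) = 1.
  move=> q0; rewrite phiE// variance0_level; last first.
    by have := Hx q; rewrite tposE.
  by case: (c < _); [right|left].
have phi01 r : 0 <= phi r <= 1.
  have G01 y : 0 <= P S t0 (\1_(sup_level c)) y <= 1.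
    apply/andP; split; first by apply: Rintegral_ge0 => z _; rewrite indicE.
    rewrite -(kop_cst (K t0) 1 y); apply: kop_le; [exact: bE|exact: bmeas_cst|].
    by move=> z; rewrite indicE; case: (_ \in _).
  apply/andP; split; first by apply: Rintegral_ge0 => z _; have /andP[] := G01 z.
  rewrite -(kop_cst (K (tpos r)) 1 x); apply: kop_le; [exact: PB|exact: bmeas_cst|].
  by move=> z; have /andP[] := G01 z.
have phi0 : phi 0 = P S t0 (\1_(sup_level c)) x by rewrite phiE// addr0.
rewrite -phiE// -phi0; apply: contrapT => phis.
(* If [phi] were not constant, it would take at some [u] the value [v], strictly between 0 and 1. At
   a rational time just to the right of [u], hence nonnegative, it is close to [v] and yet equal to
   0 or 1. *)
pose v := (phi 0 + phi s) / 2.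
have /andP[a1 a2] := phi01 0; have /andP[b1 b2] := phi01 s.
have v01 : 0 < v < 1.
  rewrite /v; have : phi 0 < phi s \/ phi s < phi 0.
    by apply/orP; rewrite -neq_lt; apply/eqP => h; apply: phis.
  by move=> [?|?]; apply/andP; split; lra.
have [u us phiu] : exists2 u, u \in `[0, s] & phi u = v.
  apply: IVT => //; first exact: continuous_subspaceT.
  by rewrite /v ge_min le_max; have [h|h] := leP (phi 0) (phi s);
    apply/andP; split; apply/orP; ((left; lra) || (right; lra)).
have u0 : 0 <= u by move: us; rewrite in_itv/= => /andP[].
have /andP[v0 v1] := v01.
have e0 : 0 < Num.min v (1 - v) by rewrite lt_min v0 subr_gt0.
have /cvgrPdist_lt/(_ _ e0)[r /= r0 Hr] := cphi u.
have ur : u < u + r by rewrite ltrDl.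
have [q] := rat_in_itvoo ur; rewrite in_itv/= => /andP[uq qr].
have : `|phi u - phi (ratr q)| < Num.min v (1 - v).
  by apply: Hr; rewrite /= ltr0_norm; lra.
rewrite phiu lt_min => /andP[h1 h2].
have q0 : 0 <= ratr q :> R by rewrite (le_trans u0)// ltW.
move: h1 h2; case: (phiq q q0) => ->.
  by rewrite subr0 gtr0_norm// ltxx.
by rewrite ltr0_norm ?subr_lt0// opprB ltxx.
Qed.

(** Almost everywhere, the two numbers exceed the same rational levels. *)
Let recurrent_eventually_fixed s : 0 <= s ->
  {ae pi, forall x : borel Omega, P S (t0 + s) F x = P S t0 F x}.
Proof.
move=> s0; have ts0 : 0 <= t0 + s by rewrite addr_ge0.
have : {ae pi, forall x : borel Omega, forall q : rat, forall s, 0 <= s ->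
  P S (t0 + s) (\1_(sup_level (ratr q))) x = P S t0 (\1_(sup_level (ratr q))) x}.
  by apply: ae_forall_rat => q; exact: level_constant.
have := recurrent_variance t00; have := recurrent_variance ts0.
apply: filterS3 => x v1 v0 Hq.
have E q : (ratr q < P S (t0 + s) F x) = (ratr q < P S t0 F x).
  have := Hq q s s0; rewrite !variance0_level//.
  by case: (_ < _); case: (_ < _) => // /eqP; rewrite ?oner_eq0// eq_sym oner_eq0.
apply/eqP; rewrite -[_ == _]negbK; apply/negP; rewrite neq_lt => /orP[] lt;
  have [q] := rat_in_itvoo lt; rewrite in_itv/= => /andP[q1 q2].
  by have := E q; rewrite q2 ltNge (ltW q1).
by have := E q; rewrite q2 ltNge (ltW q1).
Qed.

(** [P S r F] with [t0 <= r] is already fixed in L1(pi), and recurrence brings it arbitrarily close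
    to [F]. *)
Lemma recurrent_fixed s : 0 <= s -> norm1 (fun x => P S s F x - F x) = 0.
Proof.
move=> s0; apply/eqP; rewrite eq_le Rintegral_ge0// andbT.
apply/ler_addgt0Pr => e e0; rewrite add0r.
have e2 : 0 < e / 2 by rewrite divr_gt0.
have [r t0r Hr] := recF e2 t0.
have r0 : 0 <= r by exact: le_trans t0r.
have rt0 : 0 <= r - t0 by rewrite subr_ge0.
have bPr := PB r bF; have bPs := PB s bF; have bPsr := PB s bPr.
apply: (le_trans (norm1_tri bPs bPsr bF)).
rewrite [leRHS](splitr e); apply: lerD.
  by apply: (le_trans (P_contraction s0 bF bPr)); rewrite norm1C; exact: Hr.
apply: (le_trans (norm1_tri bPsr bPr bF)).
rewrite -[leRHS]add0r; apply: lerD; last exact: Hr.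
have -> : P S s (P S r F) = P S (r - t0) (P S (t0 + s) F).
  apply/funext => x; rewrite -!(P_semigroup HS)//; last by rewrite addr_ge0.
  by congr (P S _ F x); ring.
have -> : P S r F = P S (r - t0) (P S t0 F).
  by apply/funext => x; rewrite -(P_semigroup HS)// subrKC.
have bPt0 := PB t0 bF; have bPts := PB (t0 + s) bF.
apply: (le_trans (P_contraction rt0 bPts bPt0)).
rewrite (ae_eq_bint (bmeas_abs (bmeasB bPts bPt0)) (bmeas_cst _ 0)).
  by rewrite Rintegral_cst// mul0r.
apply: filterS (recurrent_eventually_fixed s0) => x ->.
by rewrite subrr normr0.
Qed.

End recurrent.

(** * Convergence of the orbits in L1(pi) *)

Variable m : meas.
Hypotheses (fm : (m setT < +oo)%E).
Hypothesis dom : forall A : set (borel Omega), measurable A -> m A = 0%E ->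
  forall x, K t0 x A = 0%E.

Lemma P_factor t f : t0 <= t -> Bb f -> (forall x, `|f x| <= 1) ->
  P S t f = P S t0 (P S (t - t0) f) /\
  (forall x, `|P S (t - t0) f x| <= 1).
Proof.
move=> t0t bf f1; split; last by move=> x; exact: Pbound.
by apply/funext => x; rewrite -(P_semigroup HS) ?subrK// subr_ge0.
Qed.

(** The centres are clamped because the convergence of orbits, stated on the unit ball, will be
    applied to them. *)
Let cover e : 0 < e -> exists (I : finType) (g : I -> Omega -> R),
  [/\ forall i, Bb (g i), forall i x, `|g i x| <= 1 &
    forall f, Bb f -> (forall x, `|f x| <= 1) ->
      exists i, norm1 (fun x => P S t0 f x - g i x) <= e].
Proof.
move=> e0; have [I [g [bg Hg]]] := totally_bounded_kernel fpi fm dom e0.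
exists I, (fun i x => clamp (g i x)); split.
- by move=> i; apply: clamp_bmeas; case: (bg i).
- by move=> i x; exact: clamp_norm_le1.
- move=> f bf f1; have [i Hi] := Hg f bf f1; exists i.
  apply: le_trans Hi; apply: (le_bint fpi).
  + apply: bmeas_abs; apply: bmeasB; first exact: PB.
    by apply: clamp_bmeas; case: (bg i).
  + by apply: bmeas_abs; apply: bmeasB; [exact: kop_bmeas|exact: bg].
  + by move=> x; apply: clamp_dist; exact: Pbound.
Qed.

Lemma P_cvg_L1 f : Bb f -> (forall x, `|f x| <= 1) ->
  exists F, Bb F /\ forall e, 0 < e -> exists T : R, forall t, T <= t ->
    norm1 (fun x => P S t f x - F x) <= e.
Proof.
move=> bf f1.
have [U [UU sU]] := @ultraFilterLemma R (+oo : set_system R) _.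
(* Otherwise the ultrafilter would contain the complements of the finitely many balls, hence a time
   [t >= t0] lying in all of them, against [cover]. *)
have near_center e : 0 < e -> exists g, Bb g /\
    U [set t | t0 <= t /\ norm1 (fun x => P S t f x - g x) <= e].
  move=> e0; have [I [g [bg g1 Hg]]] := cover e0.
  apply: contrapT => /forallNP H.
  have HU i : \forall t \near U, ~ (t0 <= t /\
      norm1 (fun x => P S t f x - g i x) <= e).
    have [Ui|//] := in_ultra_setVsetC [set t | t0 <= t /\
        norm1 (fun x => P S t f x - g i x) <= e] UU.
    by exfalso; apply: (H (g i)).
  have Ut0 : \forall t \near U, t0 <= t.
    by apply: sU; apply: nbhs_pinfty_ge; exact: num_real.
  have [t [t0t Ht]] := filter_ex (filterI Ut0 (filter_forall _ HU)).
  have [E1 E2] := P_factor t0t bf f1.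
  have [i Hi] := Hg _ (PB (t - t0) bf) E2.
  by apply: (Ht i); split; [exact: t0t|rewrite E1; exact: Hi].
(* Completeness is used through charges: those of density [P S t f] converge uniformly on sets, and
   the Radon-Nikodym derivative of the limit is the cluster point. *)
pose u t := induced_charge (bmeas_integrable fpi (PB t bf)).
have uE t A : measurable A -> fine (u t A) = \int[pi]_(x in A) P S t f x by [].
have iA t (A : set (borel Omega)) : measurable A ->
    pi.-integrable A (EFin \o P S t f).
  by move=> mA; apply: integrableS (bmeas_integrable fpi (PB t bf)).
have u_cauchy e : 0 < e -> exists2 V : set R, U V &
    forall s t, V s -> V t -> forall A, measurable A ->
      `|fine (u s A) - fine (u t A)| <= e.
  move=> e0; have e2 : 0 < e / 2 by rewrite divr_gt0.
  have [g [bg Ug]] := near_center _ e2.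
  exists [set t | t0 <= t /\ norm1 (fun x => P S t f x - g x) <= e / 2] => //.
  move=> s t [_ Hs] [_ Ht] A mA; rewrite (uE s A mA) (uE t A mA).
  rewrite -(RintegralB mA (iA s A mA) (iA t A mA)).
  have bst := bmeasB (PB s bf) (PB t bf).
  have ist : pi.-integrable setT (EFin \o (fun x => P S s f x - P S t f x)).
    exact: bmeas_integrable.
  have istA : pi.-integrable A (EFin \o (fun x => P S s f x - P S t f x)).
    exact: integrableS ist.
  apply: (le_trans (le_normr_Rintegral mA istA)).
  apply: (@le_trans _ _ (norm1 (fun x => P S s f x - P S t f x))).
    rewrite Rintegral_mkcond; apply: le_Rintegral => //.
    - rewrite -restrict_EFin; apply/(integrable_mkcond _ mA).
      exact: (integrable_norm istA).
    - exact: (integrable_norm ist).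
    - move=> x _; rewrite /patch; case: ifP => _; first exact: lexx.
      exact: normr_ge0.
  apply: (le_trans (norm1_tri (PB s bf) bg (PB t bf))).
  rewrite [leRHS](splitr e); apply: lerD; first exact: Hs.
  by rewrite norm1C; exact: Ht.
have [nu nuP] := charge_cauchy_cvg u_cauchy.
have nupi : nu `<< to_finite fpi.
  apply/null_content_dominatesP => A mA piA0.
  rewrite -[LHS](fineK (charge_fin nu mA)); congr EFin; apply/eqP.
  rewrite -normr_le0; apply/ler_addgt0Pr => e e0; rewrite add0r.
  have [t Ht] := filter_ex (nuP e e0); have := Ht A mA.
  rewrite uE// (_ : \int[pi]_(x in A) P S t f x = 0) ?sub0r ?normrN//.
  by rewrite /Rintegral null_set_integral//; exact: (measurable_int pi (iA t A mA)).
pose F0 x := fine (Radon_Nikodym nu (to_finite fpi) x).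
have iF0 : pi.-integrable setT (EFin \o F0).
  have iRN : pi.-integrable setT (Radon_Nikodym nu (to_finite fpi)).
    exact: (Radon_Nikodym_integrable nupi).
  apply: eq_integrable iRN => // x _.
  by rewrite /= fineK//; exact: Radon_Nikodym_fin_num.
have nuE A : measurable A -> fine (nu A) = \int[pi]_(x in A) F0 x.
  move=> mA; rewrite (Radon_Nikodym_integral nupi mA); congr fine.
  apply: eq_integral => x _; rewrite fineK//; exact: Radon_Nikodym_fin_num.
have mF0 : measurable_fun setT F0 by apply/measurable_EFinP; case/integrableP: iF0.
(* [F0] is only known to be integrable; clamping makes it bounded and no further from [P S t f]. *)
pose F x := clamp (F0 x).
have bF : Bb F by exact: clamp_bmeas.
have F1 x : `|F x| <= 1 by exact: clamp_norm_le1.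
have UF e : 0 < e -> U [set t | 0 <= t /\ norm1 (fun x => P S t f x - F x) <= e].
  move=> e0; have e2 : 0 < e / 2 by rewrite divr_gt0.
  have Ut0 : U [set t | 0 <= t].
    by apply: sU; apply: nbhs_pinfty_ge; exact: num_real.
  apply: filterS (filterI Ut0 (nuP _ e2)) => t [t_ge0 Ht]; split=> //.
  pose h (x : borel Omega) : R := P S t f x - F0 x.
  have mh : measurable_fun setT h by apply: measurable_funB => //; case: (PB t bf).
  have ih : pi.-integrable setT (EFin \o h).
    rewrite (_ : EFin \o h = ((EFin \o P S t f) \- (EFin \o F0))%E)//.
    by apply: integrableB => //; exact: (bmeas_integrable fpi (PB t bf)).
  (* The estimate uniform on sets yields the L1 estimate: the sets where [h] is nonnegative and
     negative cost [e / 2] each. *)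
  pose A := [set x : borel Omega | 0 <= h x].
  have mA : measurable A.
    have := mh measurableT `[0, +oo[%classic (measurable_itv _).
    rewrite setTI; congr measurable; apply/seteqP; split => y /=;
      by rewrite in_itv/= andbT.
  apply: (@le_trans _ _ (\int[pi]_x `|h x|)).
    apply: le_Rintegral => //.
    - exact: (bmeas_integrable fpi (bmeas_abs (bmeasB (PB t bf) bF))).
    - exact: integrable_norm ih.
    - by move=> x _; apply: clamp_dist; exact: Pbound.
  have hA B : measurable B -> `|\int[pi]_(x in B) h x| <= e / 2.
    move=> mB; rewrite RintegralB//; [|exact: iA|exact: integrableS iF0].
    by rewrite -nuE// -uE//; exact: Ht.
  have -> : \int[pi]_x `|h x| = \int[pi]_(x in A) h x - \int[pi]_(x in ~` A) h x.
    have iA' : pi.-integrable (A `|` ~` A) (EFin \o (fun x => `|h x|)).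
      by rewrite setUv; exact: integrable_norm ih.
    rewrite -[X in Rintegral _ X _](setUv A) Rintegral_setU//; last first.
    - by apply/disj_setPS; rewrite setICr.
    - exact: measurableC.
    congr (_ + _).
      by apply: eq_Rintegral => x /set_mem /= hx; rewrite ger0_norm.
    rewrite -[RHS]mulN1r -RintegralZl//.
    - apply: eq_Rintegral => x /set_mem /= /negP; rewrite -ltNge => hx.
      by rewrite ltr0_norm// mulN1r.
    - exact: measurableC.
    - by apply: integrableS ih => //; exact: measurableC.
  have := hA _ mA; have := hA _ (measurableC mA).
  by rewrite !ler_norml => /andP[? ?] /andP[? ?]; lra.
(* For two good times [t <= s], [P (s - t) F] is close to [P (s - t) (P t f) = P s f], hence to
   [F]. *)
have recF : recurrent F.
  move=> e e0 T; have e2 : 0 < e / 2 by rewrite divr_gt0.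
  have [t [t_ge0 Ht]] := filter_ex (UF _ e2).
  have UT : U [set s | t + Num.max T 0 <= s].
    by apply: sU; apply: nbhs_pinfty_ge; exact: num_real.
  have [s [Ts [s_ge0 Hs]]] := filter_ex (filterI UT (UF _ e2)).
  have Tst : Num.max T 0 <= s - t by rewrite lerBrDl.
  have st0 : 0 <= s - t by rewrite (le_trans _ Tst)// le_max lexx orbT.
  exists (s - t); first by rewrite (le_trans _ Tst)// le_max lexx.
  have bPt := PB t bf; have bPs := PB s bf.
  apply: (le_trans (norm1_tri (PB (s - t) bF) bPs bF)).
  rewrite [leRHS](splitr e); apply: lerD; last exact: Hs.
  have -> : P S s f = P S (s - t) (P S t f).
    by apply/funext => x; rewrite -(P_semigroup HS)// subrKC.
  by apply: (le_trans (P_contraction st0 bF bPt)); rewrite norm1C; exact: Ht.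
exists F; split=> // e e0; have [T [T0 HT]] := filter_ex (UF _ e0).
(* As [F] is fixed and [P] contracts, the distance of the orbit to [F] does not increase: one good
   time is enough. *)
exists T => t Tt; have tT : 0 <= t - T by rewrite subr_ge0.
have -> : P S t f = P S (t - T) (P S T f).
  by apply/funext => x; rewrite -(P_semigroup HS)// subrKC.
apply: (le_trans (norm1_tri (PB _ (PB T bf)) (PB (t - T) bF) bF)).
rewrite (recurrent_fixed bF F1 recF tT) addr0.
by apply: (le_trans (P_contraction tT (PB T bf) bF)); exact: HT.
Qed.

Lemma P_uniform_cauchy_L1 e : 0 < e -> exists T : R, forall s t f,
  T <= s -> T <= t -> Bb f -> (forall x, `|f x| <= 1) ->
  norm1 (fun x => P S s f x - P S t f x) <= e.
Proof.
move=> e0; have e4 : 0 < e / 4 by rewrite divr_gt0.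
have [I [g [bg g1 Hg]]] := cover e4.
have /choice[F HF] : forall i, exists F, Bb F /\ forall e, 0 < e ->
    exists T : R, forall t, T <= t -> norm1 (fun x => P S t (g i) x - F x) <= e.
  by move=> i; exact: P_cvg_L1.
have /choice[T HT] : forall i, exists T : R, forall t, T <= t ->
    norm1 (fun x => P S t (g i) x - F i x) <= e / 4.
  by move=> i; exact: ((HF i).2 _ e4).
(* A nonnegative common bound for the finitely many times. *)
pose T' := \sum_i `|T i|.
have TT' i : T i <= T'.
  rewrite (le_trans (ler_norm _))// /T' (bigD1 i)//= lerDl.
  by apply: sumr_ge0.
have T'0 : 0 <= T' by apply: sumr_ge0.
exists (T' + t0) => s t f Ts Tt bf f1.
have [i Hi] := Hg f bf f1; have [bF _] := HF i.
have half r : T' + t0 <= r -> norm1 (fun x => P S r f x - F i x) <= e / 2.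
  move=> Tr; have Tr0 : T' <= r - t0 by rewrite lerBrDr.
  have r0 : 0 <= r - t0 by exact: le_trans Tr0.
  have -> : P S r f = P S (r - t0) (P S t0 f).
    by apply/funext => x; rewrite -(P_semigroup HS)// subrKC.
  have bPf := PB t0 bf.
  apply: (le_trans (norm1_tri (PB _ bPf) (PB (r - t0) (bg i)) bF)).
  have -> : e / 2 = e / 4 + e / 4 by lra.
  apply: lerD; last by apply: HT; exact: le_trans (TT' i) Tr0.
  by apply: (le_trans (P_contraction r0 bPf (bg i))); exact: Hi.
apply: (le_trans (norm1_tri (PB s bf) bF (PB t bf))).
rewrite [leRHS](splitr e); apply: lerD; first exact: (half s Ts).
by rewrite norm1C; exact: (half t Tt).
Qed.

End invariant_L1.

(** * Convergence in total variation *)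

Section convergence.
Context (R : realType) (Omega : ptopologicalType).
Local Notation M := (signed_measure R Omega).
Variable S : R -> M -> M.
Hypotheses (HS : markovian_semigroup S) (HC : stochastically_continuous S).
Local Notation K t := (kernel_of (S t)).
Local Notation meas := {measure set (borel Omega) -> \bar R}.
Variable d : Omega -> Omega -> R.
Hypotheses (md : is_metric d) (metr : metrizes d).
Variable D : set Omega.
Hypotheses (cD : countable D) (dD : dense D).
Variable t0 : R.
Hypotheses (t0_gt0 : 0 < t0) (SF : strong_feller (S t0)).
Hypothesis sep : fix_separates S.

(* [mu k_(n t0)] is the sum of its restriction to [N], which is small for large
   [n], and of a measure dominated by [pi]. *)
Lemma P_uniform_cauchy (mu : meas) : (mu setT < +oo)%E ->
  forall e : R, 0 < e -> exists T : R, forall s t f, T <= s -> T <= t ->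
    Bb f -> (forall x, `|f x| <= 1) ->
    \int[mu]_x `|P S s f x - P S t f x| <= e.
Proof.
move=> fmu e e0; have t00 := ltW t0_gt0.
have [m [fm dom]] := dominating_measure cD dD SF.
have [pi [invpi maxpi]] := maximal_invariant md metr cD dD t0_gt0 SF.
have [fpi _] := invpi.
have pim (A : set (borel Omega)) : measurable A -> m A = 0%E -> pi A = 0%E.
  move=> mA mA0; have bA := bmeas_indic R mA.
  rewrite -[LHS](fineK (fin_measure fpi mA)) -(bint_indic pi mA).
  rewrite -(invariant_bint invpi t00 bA) (@eq_Rintegral _ _ _ _ _ (fun=> 0)).
    by rewrite Rintegral_cst// mul0r.
  by move=> x _; rewrite /P kop_indic// dom.
have [N [mN piN0 mdN]] := singular_set fpi fm pim.
have KN (A : set (borel Omega)) : measurable A -> pi A = 0%E ->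
    forall x, K t0 x (A `\` N) = 0%E.
  by move=> mA piA0; apply: dom; [exact: measurableD|exact: mdN].
have PN0 := transient_part HS t0_gt0 SF sep invpi maxpi mN piN0 KN.
have bN := bmeas_indic R mN.
have P1 t (A : set (borel Omega)) (x : Omega) : measurable A -> `|P S t (\1_A) x| <= 1.
  move=> mA; apply: kop_bound; first exact: bmeas_indic.
  by move=> y; rewrite indicE; case: (_ \in _); rewrite ?normr1 ?normr0.
(* The final sum is [2 * (e / 8)] from [N], [e / 8] from [eta] and [2 * (e / 8)] from [A] off [N];
   the factors 2 come from [w <= 2]. *)
have e4 : 0 < e / 8 by rewrite divr_gt0.
have := bounded_cvg_Rintegral fmu (fun n => P_Bb S (n.+1%:R * t0) bN)
  (fun n x => P1 _ N x mN) PN0.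
rewrite Rintegral_cst// mul0r => /cvgrPdist_le/(_ _ e4)[n _ /(_ n (leqnn n))] /=.
rewrite sub0r normrN => /(le_trans (ler_norm _)).
pose tn := n.+1%:R * t0; rewrite -/tn => muN.
have tn0 : 0 <= tn by rewrite mulr_ge0.
pose la := kbind mu (K tn).
have fla : (la setT < +oo)%E by exact: kbind_fin.
have mNc : measurable (~` N) by exact: measurableC.
(* As [tn = t0 + n%:R * t0], the last step of [la] is made by the kernel at [t0], which does not
   charge [pi]-null sets off [N]. *)
pose la' := mrestr la mNc.
have fla' : (la' setT < +oo)%E.
  apply: le_lt_trans fla; apply: le_measure; rewrite ?inE//.
  exact: measurableI.
have ladom : charge_of fla' `<< pi.
  apply/null_content_dominatesP => A mA piA0.
  rewrite charge_ofE -[LHS]/(kbind mu (K tn) (A `&` ~` N)) /kbind integral0_eq// => x _.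
  have mAN : measurable (A `&` ~` N) by exact: measurableI.
  rewrite -[LHS](fineK (fin_measure (fker_fin (K tn) x) mAN)).
  rewrite -kop_indic// -/(P S tn (\1_(A `&` ~` N)) x); congr EFin.
  have -> : tn = t0 + n%:R * t0 by rewrite /tn -natr1 mulrDl mul1r addrC.
  rewrite (P_semigroup HS)//; [|by rewrite mulr_ge0|exact: bmeas_indic].
  have -> : P S t0 (\1_(A `&` ~` N)) = fun=> 0.
    apply/funext => y; rewrite /P kop_indic// -setDE.
    by rewrite KN.
  by rewrite /P kop_cst.
have [Pset [Nset PNset]] := Hahn_decomposition (charge_of fla').
have [del [del0 Hdel]] := charge_variation_continuous PNset ladom e4.
pose L := fine (la setT); have L0 : 0 <= L by rewrite fine_ge0.
(* Chosen so that [eta * L <= e / 8]. By Markov's inequality an L1(pi) bound of [del / 2 * eta] on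
   [w] gives the set where [w] exceeds [eta] a [pi]-mass below [del], so [la'] is small on it. *)
pose eta := e / 8 / (L + 1); have eta0 : 0 < eta by rewrite !divr_gt0// ltr_wpDl.
have ed0 : 0 < del / 2 * eta by rewrite mulr_gt0// divr_gt0.
have [T1 HT1] := P_uniform_cauchy_L1 HS HC t0_gt0 SF invpi fm dom ed0.
pose T := Num.max 0 T1; have T0 : 0 <= T by rewrite le_max lexx.
have HT u v f : T <= u -> T <= v -> Bb f -> (forall x, `|f x| <= 1) ->
    \int[pi]_x `|P S u f x - P S v f x| <= del / 2 * eta.
  by rewrite !ge_max => /andP[_ uT] /andP[_ vT]; exact: HT1.
exists (T + tn) => s t f Ts Tt bf f1.
have Ts' : T <= s - tn by rewrite lerBrDr.
have Tt' : T <= t - tn by rewrite lerBrDr.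
have s_tn : P S s f = P S tn (P S (s - tn) f).
  by apply/funext => x; rewrite -(P_semigroup HS) ?subrK//; exact: le_trans T0 Ts'.
have t_tn : P S t f = P S tn (P S (t - tn) f).
  by apply/funext => x; rewrite -(P_semigroup HS) ?subrK//; exact: le_trans T0 Tt'.
pose w y := `|P S (s - tn) f y - P S (t - tn) f y|.
have bs := P_Bb S (s - tn) bf; have bt := P_Bb S (t - tn) bf.
have bw : Bb w := bmeas_abs (bmeasB bs bt).
have w2 y : w y <= 2.
  have h1 : `|P S (s - tn) f y| <= 1 by exact: kop_bound.
  have h2 : `|P S (t - tn) f y| <= 1 by exact: kop_bound.
  by rewrite /w (le_trans (ler_normB _ _))// -[2]/(1 + 1) lerD.
apply: (@le_trans _ _ (\int[la]_y w y)).
  rewrite (kbind_Rintegral (K tn) fmu bw); apply: (le_bint fmu).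
  - exact: (bmeas_abs (bmeasB (P_Bb S s bf) (P_Bb S t bf))).
  - exact: P_Bb.
  - move=> x; rewrite s_tn t_tn -[P S tn]/(kop (K tn)) -(kopB _ _ bs bt).
    exact: (kop_norm_le (K tn) x (bmeasB bs bt)).
pose A : set (borel Omega) := [set y | eta < w y].
have mA : measurable A.
  have := bw.1 measurableT `]eta, +oo[%classic (measurable_itv _).
  rewrite setTI; congr measurable; apply/seteqP; split => y /=;
    by rewrite in_itv/= andbT.
have mAN : measurable (A `&` ~` N) by exact: measurableI.
have piA : (pi A < del%:E)%E.
  rewrite -(fineK (fin_measure fpi mA)) lte_fin.
  suff : fine (pi A) <= del / 2 by move=> /le_lt_trans; apply; lra.
  rewrite -(ler_pM2r eta0).
  have HTst := HT _ _ f Ts' Tt' bf f1; apply: le_trans HTst.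
  rewrite -(bint_indic pi mA) mulrC -(bintZ fpi eta (bmeas_indic R mA)).
  apply: (le_bint fpi (bmeasZ eta (bmeas_indic R mA)) bw) => y.
  rewrite indicE; have [/set_mem yA|_] := boolP (y \in A).
    by rewrite mulr1 ltW.
  by rewrite mulr0 normr_ge0.
have la'A : fine (la (A `&` ~` N)) <= e / 8.
  have fA := fin_measure fla mAN.
  rewrite -lee_fin (fineK fA); apply: le_trans (ltW (Hdel A mA piA)).
  apply: le_trans (abse_charge_variation PNset mA).
  by rewrite gee0_abs.
have laN : fine (la N) <= e / 8.
  by rewrite -(bint_indic la mN) (kbind_Rintegral (K tn) fmu bN).
have bAN := bmeas_indic R mAN; have beta := bmeas_cst (borel Omega) eta.
have bsum := bmeasD (bmeasZ 2 bN) (bmeasD beta (bmeasZ 2 bAN)).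
apply: (@le_trans _ _ (\int[la]_y (2 * \1_N y + (eta + 2 * \1_(A `&` ~` N) y)))).
  apply: (le_bint fla bw bsum) => y.
  have i1 : 0 <= (\1_(A `&` ~` N) y : R) by rewrite indicE.
  have [yN|yN] := pselect (N y).
    have -> : \1_N y = 1 :> R by rewrite indicE mem_set.
    by have := w2 y; lra.
  have i2 : 0 <= (\1_N y : R) by rewrite indicE.
  have [yA|yA] := leP (w y) eta; first by lra.
  have -> : \1_(A `&` ~` N) y = 1 :> R by rewrite indicE mem_set.
  by have := w2 y; lra.
rewrite (bintD fla (bmeasZ 2 bN) (bmeasD beta (bmeasZ 2 bAN))).
rewrite (bintD fla beta (bmeasZ 2 bAN)) (bintZ fla 2 bN) (bintZ fla 2 bAN).
rewrite !bint_indic// bint_cst -/L.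
have : eta * L <= e / 8.
  by rewrite /eta mulrAC ler_pdivrMr ?ltr_wpDl// mulrDr mulr1 lerDl ltW.
move: la'A laN; lra.
Qed.

(** Indicators belong to the unit ball, so [P_uniform_cauchy] for the two Jordan parts of [mu] makes
    [S t mu] Cauchy uniformly over measurable sets, and signed measures are complete. *)
Lemma fix_separates_tv_convergent : tv_convergent S.
Proof.
move=> mu; have [mS _ _] := HS.
have pinfty_proper : ProperFilter (+oo : set_system R) by exact: proper_pinfty_nbhs.
have cauchy (e : R) : 0 < e -> exists2 V : set R, (+oo : set_system R) V &
    forall s t, V s -> V t -> forall A : set (borel Omega), measurable A ->
      `|fine (S s mu A) - fine (S t mu A)| <= e.
  move=> e0; have e2 : 0 < e / 2 by rewrite divr_gt0.
  have [Tp HTp] := P_uniform_cauchy (positive_part_fin mu) e2.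
  have [Tn HTn] := P_uniform_cauchy (negative_part_fin mu) e2.
  pose T := Num.max 0 (Num.max Tp Tn).
  exists [set t | T <= t]; first by apply: nbhs_pinfty_ge; exact: num_real.
  move=> s t; rewrite /= /T !ge_max => /andP[s0 /andP[ps ns]] /andP[tt0 /andP[pt nt]].
  move=> A mA; have bA := bmeas_indic R mA.
  have A1 (x : Omega) : `|\1_A x : R| <= 1.
    by rewrite indicE; case: (_ \in _); rewrite ?normr1 ?normr0.
  rewrite -!pairing_indic// !(P_pairing HS)// -pairingB; try exact: P_Bb.
  rewrite /pairing (le_trans (ler_normB _ _))// [leRHS](splitr e).
  have bD := bmeasB (P_Bb S s bA) (P_Bb S t bA).
  apply: lerD.
    apply: (le_trans (le_norm_bint (positive_part_fin mu) bD)).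
    exact: (HTp s t _ ps pt bA A1).
  apply: (le_trans (le_norm_bint (negative_part_fin mu) bD)).
  exact: (HTn s t _ ns nt bA A1).
have [nu Hnu] := charge_cauchy_cvg cauchy.
exists nu; apply/cvgrPdist_le => e e0; have e2 : 0 < e / 2 by rewrite divr_gt0.
have := Hnu _ e2; apply: filterS => t Ht.
rewrite sub0r normrN ger0_norm ?tv_norm_ge0//.
rewrite (_ : e = 2 * (e / 2)); last by field.
apply: tv_norm_le => A mA; rewrite /cadd /copp /= fineB; try exact: charge_fin.
exact: Ht.
Qed.

End convergence.

Theorem corollary3p7 (R : realType) (Omega : ptopologicalType)
  (T : R -> signed_measure R Omega -> signed_measure R Omega) :
  polish R Omega ->
  markovian_semigroup T ->
  stochastically_continuous T ->
  (exists2 t0 : R, 0 < t0 & strong_feller (T t0)) ->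
  [<-> fix_separates T;
       weakly_ergodic T;
       Bb_ergodic T;
       tv_convergent T].
Proof.
move=> [[D cD dD] [d [md metr _]]] HT HC [t0 t0_gt0 SF].
have i_iv : fix_separates T -> tv_convergent T.
  exact: (fix_separates_tv_convergent HT HC md metr cD dD t0_gt0 SF).
have iv_iii : tv_convergent T -> Bb_ergodic T.
  exact: (tv_convergent_Bb_ergodic HT HC md metr).
have iii_ii : Bb_ergodic T -> weakly_ergodic T.
  exact: Bb_ergodic_weakly_ergodic.
have ii_i : weakly_ergodic T -> fix_separates T.
  exact: (weakly_ergodic_fix_separates HT HC md metr t0_gt0 SF).
tfae; tauto.
Qed.
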